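(* Let $\gamma\in(0,1)$, $N_\gamma=\lfloor\gamma^{-1}\rfloor$, let $\mathbf W$ be a geometric rough path of regularity $\gamma$, and let $f_1,\dots,f_d$ be vector fields on $\mathbb R^n$ of class $C^{2N_\gamma+1}_b$. Given $\mu\in\mathcal M(\mathbb R^n)$, there exists a unique measure-valued solution $\rho:[0,T]\to\mathcal M(\mathbb R^n)$ of the rough continuity equation $\mathrm d\rho_t=\sum_{i=1}^d\operatorname{div}_x(f_i\rho_t)\,\mathrm d\mathbf W^i_t$, $\rho_0=\mu$. It is explicitly given, for $\phi\in C^{N_\gamma+1}_b(\mathbb R^n)$, by $$\rho_t(\phi)=\int\phi(X^{0,x}_t)\,\mu(dx),$$ where $X^{0,x}$ is the unique solution of the rough differential equation $\mathrm dX_t=\sum_{i=1}^df_i(X_t)\,\mathrm d\mathbf W^i_t$ with $X^{0,x}_0=x$.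
   Context: Words and rough paths. Fix $T>0$, $d,n\ge1$. A word is a finite sequence $w=(i_1,\dots,i_p)$ of letters in $\{1,\dots,d\}$, $|w|=p$; $\varepsilon$ is the empty word; $uv$ denotes concatenation. $H_N=\bigoplus_{p=0}^N(\mathbb R^d)^{\otimes p}$ has basis $e_w=e_{i_1}\otimes\cdots\otimes e_{i_p}$, $|w|\le N$, with $e_\varepsilon=\mathbf 1$; $(e_w^* )$ is the dual basis and $\mathbf 1^*=e_\varepsilon^*$. Let $ш$ denote the usual shuffle product of words, extended bilinearly. For $g,h\in H_N^*$ put $\langle g\star h,e_w\rangle=\sum_{uv=w}\langle g,e_u\rangle\langle h,e_v\rangle$. $G^{(N)}$ is the group (under $\star$, with identity $\mathbf 1^*$) of all $g\in H_N^*$ with $\langle g,\mathbf 1\rangle=1$ and $\langle g,x\,ш\,y\rangle=\langle g,x\rangle\langle g,y\rangle$ for $x\in(\mathbb R^d)^{\otimes p}$, $y\in(\mathbb R^d)^{\otimes q}$, $p+q\le N$. A (weakly) geometric rough path of regularity $\gamma$ is a map $\mathbf W:[0,T]\to G^{(N_\gamma)}$ whose increments $\mathbf W_{st}=\mathbf W_s^{-1}\star\mathbf W_t$ satisfy $\sup_{s\ne t}|\langle\mathbf W_{st},e_w\rangle|/|t-s|^{|w|\gamma}<\infty$ for all $|w|\le N_\gamma$ (equivalently, $\mathbf W$ is $\gamma$-Hölder for a homogeneous left-invariant metric on $G^{(N_\gamma)}$). $C^k_b$: functions of class $C^k$ bounded together with all derivatives up to order $k$. Controlled paths. For $1\le N\le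 N_\gamma+1$, $\mathscr D^{N\gamma}_{\mathbf W}$ is the space of $\mathbf X:[0,T]\to H_{N-1}$ such that for $|w|\le N-1$ the path $t\mapsto\langle e_w^*,\mathbf X_t\rangle$ is $\gamma$-Hölder and $|\langle e_w^*,\mathbf X_t\rangle-\sum_{|v|\le N-1-|w|}\langle\mathbf W_{st},e_v\rangle\langle e_{vw}^*,\mathbf X_s\rangle|\le C|t-s|^{(N-|w|)\gamma}$ for $s<t$. $(\mathscr D^{N\gamma}_{\mathbf W})^n$: same for $\mathbb R^n$-valued coefficients. Composition. For $\phi\in C^N(\mathbb R^n,\mathbb R^m)$ and $\mathbf X\in(\mathscr D^{N\gamma}_{\mathbf W})^n$ with $X_t=\langle\mathbf 1^*,\mathbf X_t\rangle$, the lift $\mathbf\Phi(\mathbf X)\in(\mathscr D^{N\gamma}_{\mathbf W})^m$ of $\phi(X)$ has $\langle\mathbf 1^*,\mathbf\Phi(\mathbf X)_t\rangle=\phi(X_t)$ and, for $w\ne\varepsilon$, $\langle e_w^*,\mathbf\Phi(\mathbf X)_t\rangle=\sum_{k=1}^{|w|}\frac1{k!}\sum_{u_1,\dots,u_k\neq\varepsilon}\langle e_w^*,e_{u_1}ш\cdotsш e_{u_k}\rangle D^k\phi(X_t)(\langle e_{u_1}^*,\mathbf X_t\rangle,\dots,\langle e_{u_k}^*,\mathbf X_t\rangle)$. Rough integral. For $\mathbf Y\in\mathscr D^{N_\gamma\gamma}_{\mathbf W}$ with $Y=\langle\mathbf 1^*,\mathbf Y\rangle$: $\int_0^tY_u\,\mathrm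 d\mathbf W^i_u=\lim_{|\pi|\to0}\sum_{[a,b]\in\pi}\sum_{|w|\le N_\gamma-1}\langle e_w^*,\mathbf Y_a\rangle\langle\mathbf W_{ab},e_{wi}\rangle$ over partitions $\pi$ of $[0,t]$; $\int_0^\cdot\mathbf Y_u\,\mathrm d\mathbf W^i_u\in\mathscr D^{(N_\gamma+1)\gamma}_{\mathbf W}$ has $\mathbf 1^*$-coefficient $\int_0^tY\,\mathrm d\mathbf W^i$, $e_{wi}^*$-coefficient $\langle e_w^*,\mathbf Y_t\rangle$, and all others zero; $\int_s^t=\int_0^t-\int_0^s$. RDE solution. Define $F_\varepsilon=\mathrm{id}$, $F_{iw}(x)=DF_w(x)f_i(x)$. A path $X:[0,T]\to\mathbb R^n$ solves $\mathrm dX=\sum_if_i(X)\,\mathrm d\mathbf W^i$ if there is $\mathbf X\in(\mathscr D^{N_\gamma\gamma}_{\mathbf W})^n$ with $\langle\mathbf 1^*,\mathbf X_t\rangle=X_t$, $\langle e_w^*,\mathbf X_0\rangle=F_w(X_0)$ for $|w|\le N_\gamma-1$, and $\mathbf X_t-\mathbf X_s=\sum_{i=1}^d\int_s^t\mathbf F_i(\mathbf X)_u\,\mathrm d\mathbf W^i_u$ in $(H_{N_\gamma-1})^n$ for all $s<t$, where $\mathbf F_i(\mathbf X)$ is the lift of $f_i(X)$. For $f_i\in C^{N_\gamma+1}_b$ there is a unique global solution for each initial value. Differential operators. $\Gamma_i\phi(x)=f_i(x)\cdot D\phi(x)$, $\Gamma_w=\Gamma_{i_1}\circ\cdots\circ\Gamma_{i_p}$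 for $w=(i_1,\dots,i_p)$, $\Gamma_\varepsilon=\mathrm{id}$. Measure-valued solution. $\mathcal M(\mathbb R^n)$ is the set of finite Borel measures on $\mathbb R^n$, and $\rho(\phi)=\int\phi\,d\rho$. A map $\rho:[0,T]\to\mathcal M(\mathbb R^n)$ with $\rho_0=\mu$ is a measure-valued solution if for every word $w$ with $|w|\le N_\gamma$ and every bounded subset $B$ of $C^{N_\gamma+1}_b(\mathbb R^n)$ there is a constant $C$ with $$\Big|\rho_t(\Gamma_w\phi)-\sum_{0\le|v|\le N_\gamma-|w|}\rho_s(\Gamma_{vw}\phi)\langle\mathbf W_{st},e_v\rangle\Big|\le C|t-s|^{(N_\gamma+1-|w|)\gamma}$$ for all $s<t$ in $[0,T]$ and $\phi\in B$. *)

(* Defs.v *)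
(* MathComp / MathComp-Analysis *)
From HB Require Import structures.
From mathcomp Require Export all_boot all_order all_algebra.
From mathcomp Require Export all_classical all_reals all_analysis.
Export Order.TTheory GRing.Theory Num.Theory numFieldNormedType.Exports.

Set Implicit Arguments.
Unset Strict Implicit.
Unset Printing Implicit Defensive.

Local Open Scope classical_set_scope.
Local Open Scope ring_scope.

(* A word is a [seq 'I_d], with [::] the empty word; the letters 1..d of the
   paper are numbered 0..d-1.  A vector or linear form on the truncated tensor
   space H_N is given by its coordinates on the basis (e_w), |w| <= N; it is
   encoded as a function on all words that vanishes when |w| > N. *)
Notation word d := (seq 'I_d).

Section Shuffle.
Variable A : Type.

(* All shuffles of two words, listed with multiplicity: <e_w^*, u sh v> is the
   number of occurrences of w in [shuffle u v]. *)
Fixpoint shuffle (u : seq A) {struct u} : seq A -> seq (seq A) :=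
  if u is a :: u' then
    fix shuffle_u (v : seq A) : seq (seq A) :=
      if v is b :: v' then
        [seq a :: w | w <- shuffle u' v] ++ [seq b :: w | w <- shuffle_u v']
      else [:: u]
  else fun v => [:: v].

(* Likewise for the iterated product u_1 sh ... sh u_k. *)
Definition shuffles (us : seq (seq A)) : seq (seq A) :=
  foldr (fun u ws => flatten [seq shuffle u w | w <- ws]) [:: [::]] us.

End Shuffle.

Section TruncatedTensors.
Variables (R : realType) (d : nat).

Definition truncated (U : nmodType) (N : nat) (g : word d -> U) : Prop :=
  forall w, (N < size w)%N -> g w = 0.

Definition star (N : nat) (g h : word d -> R) : word d -> R := fun w =>
  if (size w <= N)%N
  then \sum_(k < (size w).+1) g (take k w) * h (drop k w) else 0.

Definition star_one : word d -> R := fun w => (w == [::])%:R.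

(* The inverse for [star N]. It exists and is unique as soon as g [::] is
   nonzero, in particular on the group G^(N). *)
Definition star_inv (N : nat) (g : word d -> R) : word d -> R :=
  get [set h | [/\ truncated N h, star N g h = star_one
                 & star N h g = star_one]].

(* The group G^(N). By bilinearity the shuffle relation is stated on words. *)
Definition in_group (N : nat) (g : word d -> R) : Prop :=
  [/\ truncated N g, g [::] = 1 &
      forall u v : word d, (size u + size v <= N)%N ->
        \sum_(w <- shuffle u v) g w = g u * g v].

End TruncatedTensors.

Section SmoothFunctions.
Variables (R : realType) (n : nat) (U : normedModType R).
Implicit Types (phi : 'rV[R]_n -> U) (k : nat).

(* [Ck k phi]: phi is of class C^k. As R^n is finite dimensional, the
   derivative x |-> 'd phi x is C^k as soon as x |-> 'd phi x v is C^k for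
   each fixed v. *)
Fixpoint Ck k phi : Prop :=
  if k is k'.+1 then
    (forall x, differentiable phi x) /\
    (forall v : 'rV[R]_n, Ck k' (fun x => 'd phi x v))
  else continuous phi.

(* [Dk phi [:: v_1; ..; v_k] x] is D^k phi(x)(v_1, .., v_k). *)
Fixpoint Dk phi (vs : seq 'rV[R]_n) : 'rV[R]_n -> U :=
  if vs is v :: vs' then fun x => 'd (Dk phi vs') x v else phi.

(* The operator norms of D^j phi(x), j <= k, are at most M for all x. *)
Definition derivatives_le k (M : R) phi : Prop :=
  forall (vs : seq 'rV[R]_n) (x : 'rV[R]_n), (size vs <= k)%N ->
    all (fun v => `|v| <= 1) vs -> `|Dk phi vs x| <= M.

Definition Ckb k phi : Prop := Ck k phi /\ exists M, derivatives_le k M phi.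

Definition bounded_in_Ckb k (B : set ('rV[R]_n -> U)) : Prop :=
  exists M, forall phi, B phi -> Ck k phi /\ derivatives_le k M phi.

End SmoothFunctions.

Section DifferentialOperators.
Variables (R : realType) (d n : nat) (f : 'I_d -> 'rV[R]_n -> 'rV[R]_n).

Definition Gamma (U : normedModType R) (w : word d) (phi : 'rV[R]_n -> U) :
    'rV[R]_n -> U :=
  foldr (fun i psi x => 'd psi x (f i x)) phi w.

(* F_[::] = id and F_(i :: w)(x) = DF_w(x) f_i(x). *)
Definition Fvf (w : word d) : 'rV[R]_n -> 'rV[R]_n := Gamma w id.

End DifferentialOperators.

Section RoughPaths.
Variables (R : realType) (d : nat) (T gamma : R).

Definition Ngamma : nat := Num.truncn gamma^-1.

Definition increment (W : R -> word d -> R) (s t : R) : word d -> R :=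
  star Ngamma (star_inv Ngamma (W s)) (W t).

Definition geometric_rough_path (W : R -> word d -> R) : Prop :=
  (forall t, 0 <= t <= T -> in_group Ngamma (W t)) /\
  (forall w : word d, (size w <= Ngamma)%N -> exists C : R,
     forall s t, 0 <= s <= T -> 0 <= t <= T -> s != t ->
       `|increment W s t w| <= C * `|t - s| `^ ((size w)%:R * gamma)).

Variable W : R -> word d -> R.

(* The space of controlled paths D^{N gamma}_W, with coefficients in U; such
   paths take values in H_{N-1}, so only words with |w| < N matter. *)
Definition controlled (N : nat) (U : normedModType R)
    (X : R -> word d -> U) : Prop :=
  [/\ forall t, 0 <= t <= T -> truncated N.-1 (X t),
      forall w : word d, (size w < N)%N -> exists C : R,
        forall s t, 0 <= s <= T -> 0 <= t <= T ->
          `|X t w - X s w| <= C * `|t - s| `^ gamma &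
      forall w : word d, (size w < N)%N -> exists C : R,
        forall s t, 0 <= s -> s < t -> t <= T ->
          `|X t w - \sum_(v : (N.-1 - size w).-bseq 'I_d)
                      increment W s t v *: X s (v ++ w)|
          <= C * `|t - s| `^ ((N - size w)%:R * gamma)].

(* Coefficients of the lift of phi(X) to H_{N-1}, at a fixed time. Since
   <e_w^*, u_1 sh ... sh u_k> vanishes unless the |u_j| add up to |w|, the sum
   over u_1, .., u_k is restricted to words of length at most |w|. *)
Definition lift (N n : nat) (U : normedModType R) (phi : 'rV[R]_n -> U)
    (X : word d -> 'rV[R]_n) : word d -> U := fun w =>
  if (N <= size w)%N then 0
  else if w == [::] then phi (X [::])
  else \sum_(1 <= k < (size w).+1) (k`!%:R)^-1 *:
         \sum_(u : k.-tuple ((size w).-bseq 'I_d)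
                 | [::] \notin [seq bseqval v | v <- tval u])
            (count_mem w (shuffles [seq bseqval v | v <- tval u]))%:R *:
            Dk phi [seq X (bseqval v) | v <- tval u] (X [::]).

(* The partition a = p_0 < p_1 < .. < p_m of [a, p_m] is represented by a and
   the sequence p = [:: p_1; ..; p_m], as in [itv_partition]. *)
Definition mesh (a : R) (p : seq R) : R :=
  \big[Num.max/0]_(0 <= k < size p) (nth a (a :: p) k.+1 - nth a (a :: p) k).

Definition compensated_sum (U : normedModType R) (Y : R -> word d -> U)
    (i : 'I_d) (a : R) (p : seq R) : U :=
  \sum_(0 <= k < size p) \sum_(w : Ngamma.-1.-bseq 'I_d)
     increment W (nth a (a :: p) k) (nth a (a :: p) k.+1) (rcons w i)
       *: Y (nth a (a :: p) k) w.

Definition is_rough_integral (U : normedModType R) (Y : R -> word d -> U)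
    (i : 'I_d) (t : R) (I : U) : Prop :=
  forall e : R, 0 < e -> exists2 r : R, 0 < r &
    forall p : seq R, itv_partition 0 t p -> mesh 0 p < r ->
      `|compensated_sum Y i 0 p - I| < e.

(* Z is the controlled path t |-> int_0^t Y dW^i, with values in
   H_{Ngamma}. *)
Definition is_integral_lift (U : normedModType R) (Y : R -> word d -> U)
    (i : 'I_d) (Z : R -> word d -> U) : Prop :=
  forall t, 0 <= t <= T ->
    [/\ truncated Ngamma (Z t),
        is_rough_integral Y i t (Z t [::]) &
        forall (w : word d) (j : 'I_d), (size w < Ngamma)%N ->
          Z t (rcons w j) = if j == i then Y t w else 0].

Definition rde_solution (n : nat) (f : 'I_d -> 'rV[R]_n -> 'rV[R]_n)
    (X : R -> 'rV[R]_n) : Prop :=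
  exists XX : R -> word d -> 'rV[R]_n,
    [/\ controlled Ngamma XX,
        forall t, 0 <= t <= T -> XX t [::] = X t,
        forall w : word d, (size w < Ngamma)%N -> XX 0 w = Fvf f w (X 0) &
        exists Z : 'I_d -> R -> word d -> 'rV[R]_n,
          (forall i,
             is_integral_lift (fun t => lift Ngamma (f i) (XX t)) i (Z i)) /\
          (forall s t (w : word d), 0 <= s -> s < t -> t <= T ->
             (size w < Ngamma)%N ->
             XX t w - XX s w = \sum_(i < d) (Z i t w - Z i s w))].

End RoughPaths.

(* R^n with its Borel sigma-algebra. *)
Notation borelRn R n := (g_sigma_algebraType (@open 'rV[R]_n)).
Notation finite_borel_measure R n :=
  {finite_measure set (g_sigma_algebraType (@open 'rV[R]_n)) -> \bar R}.

Section MeasureValuedSolutions.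
Variables (R : realType) (d n : nat) (T gamma : R) (W : R -> word d -> R).
Variable f : 'I_d -> 'rV[R]_n -> 'rV[R]_n.

Definition measure_valued_solution (mu : finite_borel_measure R n)
    (rho : R -> finite_borel_measure R n) : Prop :=
  (forall A : set (borelRn R n), measurable A -> rho 0 A = mu A) /\
  (forall (w : word d) (B : set ('rV[R]_n -> R)),
     (size w <= Ngamma gamma)%N ->
     bounded_in_Ckb (Ngamma gamma).+1 B ->
     exists C : R, forall s t phi, 0 <= s -> s < t -> t <= T -> B phi ->
       `|\int[rho t]_x Gamma f w phi x
         - \sum_(v : (Ngamma gamma - size w).-bseq 'I_d)
             (\int[rho s]_x Gamma f (v ++ w) phi x) * increment gamma W s t v|
       <= C * `|t - s| `^ (((Ngamma gamma).+1 - size w)%:R * gamma)).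

End MeasureValuedSolutions.

(* Main.v *)
(** Write N for N_gamma, a = (N + 1) gamma > 1, and let
    y_st(x) = sum_(|v| <= N) <W_st, e_v> F_v(x) be the Euler maps.  The shuffle
    relations turn the Taylor expansion of phi at x into
    phi(y_st(x)) = sum_(|v| <= N) <W_st, e_v> Gamma_v phi(x) + O(|t - s|^a), so
    that y_tu o y_st - y_su = O(|u - s|^a) by Chen's relation.  Hence the
    compositions of Euler maps along partitions converge to a Lipschitz flow X,
    and the solutions of the RDE are the paths with
    |X_t - y_st(X_s)| <= L |t - s|^a (Davie).  Expanding phi along X shows that
    the image of mu under X_t solves the continuity equation.

    Conversely, a solution rho satisfies
    rho_t(phi) - rho_s(phi o y_st) = O(|t - s|^a), uniformly for phi in a bounded
    subset of C^(N+1)_b.  The functions phi o y o ... o y stay in such a subset,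
    because the differential of a composition of Euler maps is the composition
    of the Euler maps of the tangent fields (x, h) |-> (f(x), Df(x) h); this is
    where the 2 N + 1 derivatives of f are spent.  Telescoping over a partition
    and refining it gives rho_t(phi) = mu(phi o X_t), and C^(N+1)_b determines
    finite measures. *)

From HB Require Import structures.
Require Import Defs.
From mathcomp Require Import measurable_realfun ring lra zify.

Set Implicit Arguments.
Unset Strict Implicit.
Unset Printing Implicit Defensive.

Local Open Scope classical_set_scope.
Local Open Scope ring_scope.

(** * Deconcatenation and shuffles *)

(** What shapes the proof is uniformity. The functions phi o y o ... o y must stay bounded in
    C^(N+1) whatever the number of factors. Passing to the tangent fields turns one derivative into
    a value, but (x, h) |-> Df(x) h is unbounded in h, so that bounds hold only on the sets |h| <=
    r, and each of the N + 1 successive passages doubles the dimension. The estimates are therefore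
    stated for fields bounded on each member [D r] of an exhaustion, together with the property
    [no_explosion] that fine schemes started in [D r] remain in some [D r']. It passes to the
    tangent system because the latter is linear in h.

    The definition of a solution through controlled paths is met by algebra. The equation forces the
    coefficient of e_w to be F_w(X_t), and the composition formula, with its factors 1/k! and its
    shuffle coefficients, is a sum over set partitions: the same sum that iterated differentiation
    along the fields produces (Faa di Bruno). This identity serves again in the expansion along the
    Euler maps. *)

Section Deconcatenation.
Variable A : Type.

(** The cuts w = u v, listed by recursion on w so that sums over them unfold by induction;
    [sum_decE] identifies them with the [take] and [drop] sums of [star]. *)
Fixpoint dec (w : seq A) : seq (seq A * seq A) :=
  if w is a :: w' then
    ([::], w) :: [seq (a :: p.1, p.2) | p <- dec w']
  else [:: ([::], [::])].

Lemma sum_dec_cons (V : nmodType) a w (F : seq A * seq A -> V) :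
  \sum_(p <- dec (a :: w)) F p
  = F ([::], a :: w) + \sum_(p <- dec w) F (a :: p.1, p.2).
Proof. by rewrite /= big_cons big_map. Qed.

Lemma sum_dec_nil (V : nmodType) (F : seq A * seq A -> V) :
  \sum_(p <- dec [::]) F p = F ([::], [::]).
Proof. by rewrite /= big_seq1. Qed.

Lemma sum_decE (V : nmodType) w (F : seq A * seq A -> V) :
  \sum_(p <- dec w) F p = \sum_(k < (size w).+1) F (take k w, drop k w).
Proof.
elim: w F => [|a w IH] F; first by rewrite sum_dec_nil big_ord1.
by rewrite sum_dec_cons big_ord_recl IH.
Qed.

Lemma sum_dec_eq (V : nmodType) w (F G : seq A * seq A -> V) :
  (forall u v, u ++ v = w -> F (u, v) = G (u, v)) ->
  \sum_(p <- dec w) F p = \sum_(p <- dec w) G p.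
Proof.
by move=> h; rewrite !sum_decE; apply: eq_bigr => k _; apply: h; rewrite cat_take_drop.
Qed.

Lemma sum_dec_nill (V : nmodType) w (F : seq A * seq A -> V) :
  (forall u v, u ++ v = w -> u <> [::] -> F (u, v) = 0) ->
  \sum_(p <- dec w) F p = F ([::], w).
Proof.
case: w => [|a w] h; first by rewrite sum_dec_nil.
rewrite sum_dec_cons (@sum_dec_eq _ _ _ (fun=> 0)) ?big1 ?addr0 //.
by move=> u v e; apply: h; rewrite -?e.
Qed.

Lemma sum_dec_nilr (V : nmodType) w (F : seq A * seq A -> V) :
  (forall u v, u ++ v = w -> v <> [::] -> F (u, v) = 0) ->
  \sum_(p <- dec w) F p = F (w, [::]).
Proof.
elim: w F => [|a w IH] F h; first by rewrite sum_dec_nil.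
rewrite sum_dec_cons (h [::] (a :: w)) // add0r (IH (fun p => F (a :: p.1, p.2))) //.
by move=> u v e; apply: h; rewrite -e.
Qed.

(** Coassociativity of deconcatenation: both sides run over the cuts of w into three words. *)
Lemma sum_dec_assoc (V : nmodType) w (F : seq A -> seq A -> seq A -> V) :
  \sum_(p <- dec w) \sum_(q <- dec p.1) F q.1 q.2 p.2
  = \sum_(p <- dec w) \sum_(q <- dec p.2) F p.1 q.1 q.2.
Proof.
elim: w F => [|a w IH] F; first by rewrite !sum_dec_nil.
rewrite !sum_dec_cons sum_dec_nil /= -addrA; congr (_ + _).
rewrite -(IH (fun u => F (a :: u))) -big_split /=.
by apply: eq_bigr => p _; rewrite sum_dec_cons.
Qed.

End Deconcatenation.

Section ShuffleSums.
Variables (A : eqType) (V : nmodType).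
Implicit Types (u v w : seq A) (F : seq A -> V).

Lemma sum_shuffle0s v F : \sum_(w <- shuffle [::] v) F w = F v.
Proof. by rewrite /= big_seq1. Qed.

Lemma sum_shuffles0 u F : \sum_(w <- shuffle u [::]) F w = F u.
Proof. by case: u => [|a u]; rewrite /= big_seq1. Qed.

Lemma sum_shuffle_cons a u b v F :
  \sum_(w <- shuffle (a :: u) (b :: v)) F w
  = \sum_(w <- shuffle u (b :: v)) F (a :: w)
    + \sum_(w <- shuffle (a :: u) v) F (b :: w).
Proof. by rewrite /= big_cat /= !big_map. Qed.

Lemma size_shuffle u v w : w \in shuffle u v -> size w = (size u + size v)%N.
Proof.
elim: u v w => [|a u IHu] v w; first by rewrite inE => /eqP ->.
elim: v w => [|b v IHv] w; first by rewrite inE => /eqP ->; rewrite addn0.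
rewrite /= mem_cat => /orP[] /mapP[x hx ->] /=.
  by rewrite (IHu _ _ hx).
by rewrite (IHv _ hx) addnS.
Qed.

Local Arguments shuffle : simpl never.

(** The bialgebra compatibility of shuffle and deconcatenation: a cut of a shuffle is a pair of
    shuffles of the parts of two cuts. The induction compares first letters, the empty left part
    being treated apart. *)
Lemma sum_shuffle_dec u v (F : seq A -> seq A -> V) :
  \sum_(w <- shuffle u v) \sum_(p <- dec w) F p.1 p.2
  = \sum_(p <- dec u) \sum_(q <- dec v)
      \sum_(x <- shuffle p.1 q.1) \sum_(y <- shuffle p.2 q.2) F x y.
Proof.
elim: u v F => [|a u IHu] v F.
  rewrite sum_dec_nil sum_shuffle0s; apply: eq_bigr => q _.
  by rewrite !sum_shuffle0s.
elim: v F => [|b v IHv] F.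
  rewrite sum_shuffles0; apply: eq_bigr => p _.
  by rewrite sum_dec_nil !sum_shuffles0.
rewrite sum_shuffle_cons.
under eq_bigr do rewrite sum_dec_cons.
rewrite big_split /=.
under [X in _ + X]eq_bigr do rewrite sum_dec_cons.
rewrite [X in _ + X]big_split /=.
rewrite (IHu (b :: v) (fun x => F (a :: x))) (IHv (fun x => F (b :: x))).
rewrite [RHS]sum_dec_cons /=.
rewrite [X in _ = X + _]sum_dec_cons !sum_shuffle0s sum_shuffle_cons.
rewrite -!addrA; congr (_ + _).
rewrite addrCA; congr (_ + _).
rewrite [X in _ = _ + X](eq_bigr (fun p : seq A * seq A =>
  \sum_(x <- shuffle (a :: p.1) [::]) \sum_(y <- shuffle p.2 (b :: v)) F x y
  + \sum_(q <- dec v) (\sum_(x <- shuffle p.1 (b :: q.1)) \sum_(y <- shuffle p.2 q.2) F (a :: x) y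
    + \sum_(x <- shuffle (a :: p.1) q.1) \sum_(y <- shuffle p.2 q.2) F (b :: x) y))); last first.
  move=> p _; rewrite sum_dec_cons; congr (_ + _).
  by apply: eq_bigr => q _; rewrite sum_shuffle_cons.
under [in RHS]eq_bigr do rewrite big_split /= addrA.
rewrite [in RHS]big_split /= sum_dec_cons .
rewrite addrCA; congr (_ + (_ + _)); last 1 first.
- by apply: eq_bigr => p _; rewrite sum_dec_cons !sum_shuffles0.
- by apply: eq_bigr => q _; rewrite !sum_shuffle0s.
Qed.

End ShuffleSums.

(** * The group G^(N) and Chen's relation *)

Section StarProduct.
Variables (R : realType) (d N : nat).
Implicit Types (g h k : word d -> R) (u v w : word d).

Lemma starE g h w : (size w <= N)%N ->
  star N g h w = \sum_(p <- dec w) g p.1 * h p.2.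
Proof. by move=> hw; rewrite /star hw sum_decE. Qed.

Lemma star_truncated g h : truncated N (star N g h).
Proof. by move=> w hw; rewrite /star leqNgt hw. Qed.

Lemma star_ext g g' h h' :
  (forall w, (size w <= N)%N -> g w = g' w) ->
  (forall w, (size w <= N)%N -> h w = h' w) -> star N g h = star N g' h'.
Proof.
move=> eg eh; apply/funext => w; rewrite /star; case: ifP => // hw.
apply: eq_bigr => i _; rewrite eg ?eh // ?size_takel ?size_drop //.
- by rewrite (leq_trans (leq_subr _ _)).
- by rewrite (leq_trans _ hw) // -ltnS.
- by rewrite -ltnS.
Qed.

Lemma star_assoc g h k : star N (star N g h) k = star N g (star N h k).
Proof.
apply/funext => w; case: (leqP (size w) N) => hw; last first.
  by rewrite !star_truncated.
rewrite !starE //.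
rewrite (@sum_dec_eq _ _ _ _ (fun p => \sum_(q <- dec p.1) g q.1 * h q.2 * k p.2)); last first.
  move=> u v e; rewrite starE ?mulr_suml //.
  by rewrite (leq_trans _ hw) // -e size_cat leq_addr.
rewrite (sum_dec_assoc w (fun x y z => g x * h y * k z)).
apply: sum_dec_eq => u v e; rewrite starE ?mulr_sumr.
  by apply: eq_bigr => q _; rewrite mulrA.
by rewrite (leq_trans _ hw) // -e size_cat leq_addl.
Qed.

Lemma star1l h : truncated N h -> star N (@star_one R d) h = h.
Proof.
move=> th; apply/funext => w; case: (leqP (size w) N) => hw; last first.
  by rewrite star_truncated // th.
rewrite starE // sum_dec_nill /star_one ?eqxx ?mul1r //.
by move=> [|a u] v // _ _; rewrite mul0r.
Qed.

Lemma star1r h : truncated N h -> star N h (@star_one R d) = h.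
Proof.
move=> th; apply/funext => w; case: (leqP (size w) N) => hw; last first.
  by rewrite star_truncated // th.
rewrite starE // sum_dec_nilr /star_one ?eqxx ?mulr1 //.
by move=> u [|a v] // _ _; rewrite mulr0.
Qed.

Lemma star_one_truncated : truncated N (@star_one R d).
Proof. by case=> [|a w]. Qed.

(* One Newton step h - (g * h - 1) gains one tensor level. *)
Lemma star_rinv_ex g : g [::] = 1 ->
  exists2 h, truncated N h & star N g h = @star_one R d.
Proof.
move=> g1.
have /choice[h hP] : forall m, exists h, forall w, (size w <= m)%N -> (size w <= N)%N ->
    star N g h w = @star_one R d w.
  elim=> [|m [h hP]].
    exists (@star_one R d) => w; rewrite leqn0 size_eq0 => /eqP -> _.
    by rewrite starE // sum_dec_nil /= g1 mul1r.
  exists (fun w => h w - (star N g h w - @star_one R d w)) => w hw hN.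
  rewrite starE //.
  under eq_bigr do rewrite mulrBr.
  rewrite sumrB -starE //.
  rewrite [X in _ - X]sum_dec_nill /= ?g1 ?mul1r; first by rewrite opprB addrC subrK.
  move=> u v e nu /=; rewrite hP ?subrr ?mulr0 //.
    rewrite -ltnS (leq_trans _ hw) // -e size_cat.
    by case: u nu {e} => // a u _; rewrite addSn ltnS leq_addl.
  by rewrite (leq_trans _ hN) // -e size_cat leq_addl.
exists (fun w => if (size w <= N)%N then h N w else 0).
  by move=> w; rewrite ltnNge => /negbTE ->.
rewrite (@star_ext _ g _ (h N)) // => [|w ->//].
apply/funext => w; case: (leqP (size w) N) => hw; first exact: hP.
by rewrite star_truncated // star_one_truncated.
Qed.

Lemma star_linv_ex g : g [::] = 1 ->
  exists2 h, truncated N h & star N h g = @star_one R d.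
Proof.
move=> g1.
have /choice[h hP] : forall m, exists h, forall w, (size w <= m)%N -> (size w <= N)%N ->
    star N h g w = @star_one R d w.
  elim=> [|m [h hP]].
    exists (@star_one R d) => w; rewrite leqn0 size_eq0 => /eqP -> _.
    by rewrite starE // sum_dec_nil /= g1 mulr1.
  exists (fun w => h w - (star N h g w - @star_one R d w)) => w hw hN.
  rewrite starE //.
  under eq_bigr do rewrite mulrBl.
  rewrite sumrB -starE //.
  rewrite [X in _ - X]sum_dec_nilr /= ?g1 ?mulr1; first by rewrite opprB addrC subrK.
  move=> u v e nu /=; rewrite hP ?subrr ?mul0r //.
    rewrite -ltnS (leq_trans _ hw) // -e size_cat.
    by case: v nu {e} => // a v _; rewrite addnS ltnS leq_addr.
  by rewrite (leq_trans _ hN) // -e size_cat leq_addr.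
exists (fun w => if (size w <= N)%N then h N w else 0).
  by move=> w; rewrite ltnNge => /negbTE ->.
rewrite (@star_ext _ (h N) g g) // => [|w ->//].
apply/funext => w; case: (leqP (size w) N) => hw; first exact: hP.
by rewrite star_truncated // star_one_truncated.
Qed.

Lemma star_invP g : truncated N g -> g [::] = 1 ->
  [/\ truncated N (star_inv N g), star N g (star_inv N g) = @star_one R d
    & star N (star_inv N g) g = @star_one R d].
Proof.
move=> tg g1.
pose P : set (word d -> R) := [set h | [/\ truncated N h, star N g h = @star_one R d
  & star N h g = @star_one R d]]%classic.
suff : P (star_inv N g) by [].
apply: getPex.
have [h th hP] := star_rinv_ex g1; have [k tk kP] := star_linv_ex g1.
exists h; split => //; suff -> : h = k by [].
by rewrite -(star1l th) -kP star_assoc hP star1r.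
Qed.

Lemma star_left_cancel g h h' : truncated N g -> g [::] = 1 ->
  truncated N h -> truncated N h' -> star N g h = star N g h' -> h = h'.
Proof.
move=> tg g1 th th' e; have [_ _ e1] := star_invP tg g1.
by rewrite -(star1l th) -e1 star_assoc e -star_assoc e1 star1l.
Qed.

(** Spares the proof that the inverse of g is group-like. In the shuffle identity for g * h, every
    term with a nonempty left part involves the defect of h on shorter words, hence vanishes by
    induction; only the defect of h at (u, v) survives. *)
Lemma in_group_star_left g h : in_group N g -> truncated N h ->
  in_group N (star N g h) -> in_group N h.
Proof.
move=> [tg g1 gS] th [_ s1 sS].
have h1 : h [::] = 1.
  by move: s1; rewrite starE // sum_dec_nil /= g1 mul1r.
split=> // u v.
have [m] := ubnP (size u + size v); elim: m u v => // m IH u v.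
rewrite ltnS => hm huv.
have hu : (size u <= N)%N by rewrite (leq_trans _ huv) // leq_addr.
have hv : (size v <= N)%N by rewrite (leq_trans _ huv) // leq_addl.
have := sS u v huv.
rewrite (eq_big_seq (fun w => \sum_(p <- dec w) g p.1 * h p.2)); last first.
  by move=> w /size_shuffle e; rewrite starE // e.
rewrite (sum_shuffle_dec u v (fun x y => g x * h y)).
rewrite !starE // mulr_suml.
under [in RHS]eq_bigr do rewrite mulr_sumr.
pose F (p q : word d * word d) := g p.1 * g q.1 *
  (\sum_(y <- shuffle p.2 q.2) h y - h p.2 * h q.2).
move=> e.
have : \sum_(p <- dec u) \sum_(q <- dec v) F p q = 0.
  move/eqP: e; rewrite -subr_eq0 -sumrB => /eqP e; rewrite -[RHS]e.
  apply: sum_dec_eq => u1 u2 eu; rewrite -sumrB; apply: sum_dec_eq => v1 v2 ev /=.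
  under eq_bigr do rewrite -mulr_sumr.
  rewrite -mulr_suml gS; first by rewrite /F /=; ring.
  by rewrite (leq_trans _ huv) // -eu -ev !size_cat; lia.
have F0 u1 u2 v1 v2 : u1 ++ u2 = u -> v1 ++ v2 = v -> (u1, v1) <> ([::], [::]) ->
    F (u1, u2) (v1, v2) = 0.
  move=> eu ev ne; rewrite /F /= IH ?subrr ?mulr0 //.
    rewrite (leq_trans _ hm) // -eu -ev !size_cat.
    by case: u1 v1 ne {eu ev} => [|? ?] [|? ?] //= _; lia.
  by rewrite (leq_trans _ huv) // -eu -ev !size_cat; lia.
rewrite sum_dec_nill; last first.
  move=> u1 u2 eu ne; rewrite (@sum_dec_eq _ _ _ _ (fun=> 0)) ?big1 // => v1 v2 ev.
  by apply: F0 => // -[].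
rewrite sum_dec_nill; last by move=> v1 v2 ev ne; apply: F0 => // -[].
by rewrite /F /= g1 !mul1r => /eqP; rewrite subr_eq0 => /eqP.
Qed.

End StarProduct.

Section Increments.
Variables (R : realType) (d : nat) (T gamma : R) (W : R -> word d -> R).
Hypothesis hW : geometric_rough_path T gamma W.
Let N := Ngamma gamma.
Let w_ := increment gamma W.

Lemma star_increment s t : 0 <= s <= T -> 0 <= t <= T -> star N (W s) (w_ s t) = W t.
Proof.
move=> hs ht; have [/(_ s hs)[ts s1 _] _] := hW; have [/(_ t ht)[tt _ _] _] := hW.
by have [_ e _] := star_invP ts s1; rewrite /w_ /increment -/N -star_assoc e star1l.
Qed.

Lemma increment_chen s t u : 0 <= s <= T -> 0 <= t <= T -> 0 <= u <= T ->
  w_ s u = star N (w_ s t) (w_ t u).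
Proof.
move=> hs ht hu; have [/(_ s hs)[ts s1 _] _] := hW.
apply: (star_left_cancel ts s1); try exact: star_truncated.
by rewrite star_increment // -star_assoc !star_increment.
Qed.

Lemma increment_in_group s t : 0 <= s <= T -> 0 <= t <= T -> in_group N (w_ s t).
Proof.
move=> hs ht; have [h _] := hW; apply: (in_group_star_left (h s hs)).
  exact: star_truncated.
by rewrite star_increment //; exact: h.
Qed.

Lemma increment_refl s : 0 <= s <= T -> w_ s s = @star_one R d.
Proof.
move=> hs; have [/(_ s hs)[ts s1 _] _] := hW.
by have [_ _] := star_invP ts s1.
Qed.

End Increments.

(** * Shuffles and set partitions *)

Section SetPartitions.
Variable A : eqType.
Implicit Types (i : A) (u v w : seq A) (us vs : seq (seq A)).

Fixpoint insertions (v : seq A) us : seq (seq (seq A)) :=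
  (v :: us) :: if us is u :: us' then [seq u :: vs | vs <- insertions v us'] else [::].

Fixpoint head_extensions i us : seq (seq (seq A)) :=
  if us is u :: us' then
    ((i :: u) :: us') :: [seq u :: vs | vs <- head_extensions i us'] else [::].

(** The transpose of [insertions [:: i]] and [head_extensions i] taken together: undoing either of
    them is deleting a leading i from one block, and then discarding that block if it has become
    empty. *)
Fixpoint head_deletions i us : seq (seq (seq A)) :=
  if us is u :: us' then
    (if u is j :: u' then if j == i then [:: u' :: us'] else [::] else [::])
    ++ [seq u :: vs | vs <- head_deletions i us'] else [::].

(* The partitions of the set of positions of w into ordered, resp. unordered,
   families of nonempty blocks, each block being given by the subword it
   carries. *)
Fixpoint ordered_blocks w : seq (seq (seq A)) :=
  if w is i :: w' then
    flatten [seq insertions [:: i] us ++ head_extensions i us | us <- ordered_blocks w']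
  else [:: [::]].

Fixpoint blocks w : seq (seq (seq A)) :=
  if w is i :: w' then
    flatten [seq ([:: i] :: us) :: head_extensions i us | us <- blocks w']
  else [:: [::]].

Lemma sum_flatten_map (V : nmodType) (B C : Type) (h : B -> seq C) s (F : C -> V) :
  \sum_(x <- flatten [seq h b | b <- s]) F x = \sum_(b <- s) \sum_(x <- h b) F x.
Proof. by rewrite big_flatten big_map. Qed.

Lemma sum_shuffles_cons (V : nmodType) u us (F : seq A -> V) :
  \sum_(w <- shuffles (u :: us)) F w
  = \sum_(v <- shuffles us) \sum_(w <- shuffle u v) F w.
Proof. exact: sum_flatten_map. Qed.

Local Arguments shuffle : simpl never.

(** Removing a leading letter i is a derivation of the shuffle product, because the first letter of
    a shuffle is the first letter of exactly one factor. *)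
Lemma sum_shuffles_head (V : nmodType) i us (H : seq A -> V) :
  \sum_(v <- shuffles us) (if v is j :: v' then if j == i then H v' else 0 else 0)
  = \sum_(vs <- head_deletions i us) \sum_(v <- shuffles vs) H v.
Proof.
elim: us H => [|u us IH] H; first by rewrite /= big_seq1 big_nil.
rewrite sum_shuffles_cons /= big_cat /= big_map.
under [X in _ = _ + X]eq_bigr do rewrite sum_shuffles_cons.
rewrite -(IH (fun v => \sum_(w <- shuffle u v) H w)).
have e1 : \sum_(vs <- (if u is j :: u' then if j == i then [:: u' :: us] else [::] else [::]))
    \sum_(v <- shuffles vs) H v
  = \sum_(v <- shuffles us) if u is j :: u' then if j == i then \sum_(w <- shuffle u' v) H w
      else 0 else 0.
  case: u => [|j u']; first by rewrite big_nil big1.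
  by case: ifP => _; rewrite ?big_seq1 ?sum_shuffles_cons // big_nil big1.
rewrite e1 -big_split /=; apply: eq_bigr => v _.
case: u v {e1} => [|j u] [|k v] /=.
- by rewrite sum_shuffle0s addr0.
- by rewrite sum_shuffle0s add0r; case: ifP => //; rewrite sum_shuffle0s.
- by rewrite sum_shuffles0 addr0; case: ifP => //; rewrite sum_shuffles0.
rewrite sum_shuffle_cons; congr (_ + _).
  by case: ifP => _ //; rewrite big1.
by case: ifP => _ //; rewrite big1.
Qed.

Lemma sum_shuffles_nonempty (V : nmodType) us (F : seq A -> V) :
  \sum_(v <- shuffles us) F v = \sum_(v <- shuffles [seq u <- us | u != [::]]) F v.
Proof.
elim: us F => // u us IH F; rewrite sum_shuffles_cons /=.
case: eqP => [->|_] /=; last by rewrite sum_shuffles_cons IH.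
by rewrite -IH; apply: eq_bigr => v _; rewrite sum_shuffle0s.
Qed.

Lemma count_sum (B : eqType) (x : B) s : count_mem x s = (\sum_(y <- s) (y == x))%N.
Proof. by rewrite -sum1_count big_mkcond; apply: eq_bigr => y _ /=; case: (y == x). Qed.

Lemma ordered_blocks_nonempty w us : us \in ordered_blocks w -> [::] \notin us.
Proof.
elim: w us => [|i w IH] us; first by rewrite inE => /eqP ->.
move=> /flatten_mapP[vs /IH {IH} hvs]; rewrite mem_cat => /orP[].
  elim: vs hvs us => [|v vs IH] hvs us /=; first by rewrite !inE => /eqP->.
  move: hvs; rewrite inE negb_or => /andP[hv hvs]; rewrite inE => /orP[/eqP->|].
    by rewrite !inE !negb_or hv.
  by move=> /mapP[ws hws ->]; rewrite inE negb_or hv IH.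
elim: vs hvs us => [|v vs IH] hvs us //=.
move: hvs; rewrite inE negb_or => /andP[hv hvs]; rewrite inE => /orP[/eqP->|].
  by rewrite inE negb_or.
by move=> /mapP[ws hws ->]; rewrite inE negb_or hv IH.
Qed.

(** Double counting of the ways to pass from [us'] to [us] by adding a letter i in front, either as
    a new block or on top of an old one. The new block is the case where the deletion leaves an
    empty word, removed by the filter. *)
Lemma count_insert_extend i us us' : [::] \notin us -> [::] \notin us' ->
  (count_mem us (insertions [:: i] us') + count_mem us (head_extensions i us')
  = \sum_(vs <- head_deletions i us) ([seq u <- vs | u != [::]] == us'))%N.
Proof.
have countc (u x : seq A) us1 (s : seq (seq (seq A))) :
    count_mem (u :: us1) [seq x :: vs | vs <- s] = ((u == x) * count_mem us1 s)%N.
  rewrite count_map; case: eqP => [->|ne].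
    by rewrite mul1n; apply: eq_count => y /=; rewrite eqseq_cons eqxx.
  by rewrite mul0n -(count_pred0 s); apply: eq_count => y /=; rewrite eqseq_cons; case: eqP => // e; case: ne; rewrite e.
elim: us us' => [|u us IH] us'.
  by move=> _ _; rewrite big_nil; case: us' => [|x us'] //=; rewrite !count_map !count_pred0.
rewrite inE negb_or eq_sym => /andP[hu hus] hus'.
have cus : [seq u0 <- us | u0 != [::]] = us.
  by apply/all_filterP/allP => x hx; apply: contraNneq hus => <-.
rewrite /= big_cat big_map /= hu.
have e1 : (\sum_(vs <- (if u is j :: u' then if j == i then [:: u' :: us] else [::] else [::]))
    ([seq u0 <- vs | u0 != [::]] == us') =
  (u == [:: i]) && (us == us') + (if us' is x :: us1 then (u == i :: x) && (us == us1) else false))%N.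
  case: u hu => // j u' _; rewrite eqseq_cons; have [->|ne] := eqVneq j i; last first.
    by rewrite big_nil; case: us' {hus'} => // x us1; rewrite eqseq_cons (negbTE ne).
  rewrite big_seq1 /= cus /=; case: u' => [|k u'] /=.
    case: us' hus' => [|x us1] hus'; first by rewrite addn0.
    by move: hus'; rewrite eqseq_cons inE negb_or => /andP[/negbTE -> _]; rewrite andbF addn0.
  by case: us' {hus'} => // x us1; rewrite !eqseq_cons eqxx.
rewrite e1 {e1}.
case: us' hus' => [|x us1] hus'.
  rewrite /= !addn0 eqseq_cons [in RHS]big1 ?addn0 => [|vs _]; last by [].
  by rewrite eq_sym [_ == us]eq_sym.
move: (hus'); rewrite inE negb_or => /andP[hx hus1].
have e2 : (\sum_(vs <- head_deletions i us) (u :: [seq u0 <- vs | u0 != [::]] == x :: us1)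
   = (u == x) * \sum_(vs <- head_deletions i us) ([seq u0 <- vs | u0 != [::]] == us1))%N.
  by rewrite big_distrr /=; apply: eq_bigr => vs _; rewrite eqseq_cons mulnb.
rewrite e2 -IH // /= !countc ![_ == u :: us]eq_sym !eqseq_cons. by rewrite mulnDr addnACA.
Qed.

(** The coefficient of e_w in u_1 sh ... sh u_k counts the ways to distribute the positions of w
    over k blocks, the j-th of which reads u_j. Both counts obey the same recursion on the first
    letter of w. *)
Lemma count_shuffles w us : [::] \notin us ->
  count_mem w (shuffles us) = count_mem us (ordered_blocks w).
Proof.
elim: w us => [|i w IH] us hus.
  case: us hus => // -[|a u] // us _ /=.
  rewrite addn0 count_sum sum_flatten_map big1 // => v _.
  rewrite big_seq big1 // => x /size_shuffle; case: x => //.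
have hvs vs : vs \in head_deletions i us -> [::] \notin [seq u <- vs | u != [::]].
  by move=> _; rewrite mem_filter eqxx.
rewrite count_sum -(@eq_bigr _ _ _ _ _ _ (fun v => if v is j :: v' then
   if j == i then (v' == w : nat) else 0%N else 0%N)); last first.
  by move=> [|j v] _ //; rewrite eqseq_cons; case: eqP.
rewrite (sum_shuffles_head i us (fun v => (v == w : nat))).
under eq_big_seq => vs hv.
  rewrite (sum_shuffles_nonempty vs (fun v => (v == w : nat))) -count_sum.
  rewrite IH ?hvs // count_sum.
  over.
rewrite exchange_big /= count_sum sum_flatten_map; apply: eq_big_seq => us' hus'.
under eq_bigr do rewrite eq_sym.
by rewrite -count_insert_extend ?(ordered_blocks_nonempty hus') // -!count_sum count_cat.
Qed.

Lemma ordered_blocks_size w us : us \in ordered_blocks w ->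
  (size us <= size w)%N /\ (forall u, u \in us -> (size u <= size w)%N).
Proof.
move=> h; have hne := ordered_blocks_nonempty h.
have : (0 < count_mem w (shuffles us))%N.
  by rewrite (count_shuffles _ hne) -has_count has_pred1.
rewrite -has_count has_pred1 => {h}.
elim: us w hne => [|u us IH] w; first by [].
rewrite inE negb_or => /andP[hu hne] /flatten_mapP[v hv /size_shuffle e].
have [h1 h2] := IH v hne hv; split.
  by rewrite /= e; case: u hu {e} => // a u _; rewrite /= addSn ltnS (leq_trans h1) // leq_addl.
move=> x; rewrite inE => /orP[/eqP->|/h2 hx]; rewrite e ?leq_addr //.
by rewrite (leq_trans hx) // leq_addl.
Qed.

(** Symmetry in the entries, in the form in which it is checked for D^k phi: one entry may be moved
    to the front. *)
Definition front_invariant (V : Type) (G : seq (seq A) -> V) :=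
  forall us1 u us2, G (us1 ++ u :: us2) = G (u :: us1 ++ us2).

Lemma sum_insertions (V : nmodType) v us (G : seq (seq A) -> V) : front_invariant G ->
  \sum_(vs <- insertions v us) G vs = G (v :: us) *+ (size us).+1.
Proof.
move=> hG; suff gen vs0 : \sum_(vs <- insertions v us) G (vs0 ++ vs) =
    G (v :: vs0 ++ us) *+ (size us).+1 by have := gen [::].
elim: us vs0 => [|u us IH] vs0 /=; first by rewrite big_seq1 mulr1n hG.
rewrite big_cons big_map hG mulrS; congr (_ + _).
under eq_bigr do rewrite -cat_rcons.
by rewrite IH cat_rcons.
Qed.

Lemma head_extensions_cat i us vs : head_extensions i (us ++ vs) =
  [seq us' ++ vs | us' <- head_extensions i us] ++ [seq us ++ vs' | vs' <- head_extensions i vs].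
Proof.
elim: us => [|u us IH] /=; first by rewrite map_id.
by rewrite IH map_cat -!map_comp.
Qed.

Lemma front_invariant_ext (V : nmodType) i (G : seq (seq A) -> V) : front_invariant G ->
  front_invariant (fun us => G ([:: i] :: us) + \sum_(vs <- head_extensions i us) G vs).
Proof.
move=> hG us1 u us2.
have -> : G ([:: i] :: us1 ++ u :: us2) = G ([:: i] :: u :: us1 ++ us2).
  exact: etrans (hG ([:: i] :: us1) u us2) (esym (hG [:: [:: i]] u (us1 ++ us2))).
congr (_ + _).
rewrite head_extensions_cat /= !big_cat /= big_cons !big_map /=.
rewrite head_extensions_cat /= big_cons big_map big_cat /= !big_map hG.
rewrite addrCA; congr (_ + (_ + _)).
  by apply: eq_bigr => vs _; rewrite hG.
by apply: eq_bigr => vs _; rewrite hG.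
Qed.

(** The factor 1/k! forgets the order of the blocks: a new singleton can be inserted at k + 1 places
    among k blocks, which turns 1/(k + 1)! into 1/k!, while extending an old block leaves k
    unchanged. *)
Lemma sum_ordered_blocks (R : numFieldType) w (G : seq (seq A) -> R) : front_invariant G ->
  \sum_(us <- ordered_blocks w) ((size us)`!%:R)^-1 * G us = \sum_(us <- blocks w) G us.
Proof.
elim: w G => [|i w IH] G hG /=; first by rewrite !big_seq1 invr1 mul1r.
rewrite !sum_flatten_map.
under [in RHS]eq_bigr do rewrite big_cons.
rewrite -(IH _ (front_invariant_ext i hG)); apply: eq_bigr => us _.
rewrite big_cat /= mulrDr; congr (_ + _).
  have -> : \sum_(vs <- insertions [:: i] us) ((size vs)`!%:R)^-1 * G vs =
      ((size us).+1`!%:R)^-1 * \sum_(vs <- insertions [:: i] us) G vs.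
    rewrite mulr_sumr; apply: eq_big_seq => vs hvs.
    suff -> : size vs = (size us).+1 by [].
    elim: us vs hvs => [|u us IHu] vs /=; first by rewrite inE => /eqP->.
    by rewrite inE => /orP[/eqP->//|/mapP[ws /IHu e ->]] /=; rewrite e.
  rewrite sum_insertions // factS natrM invfM -(mulr_natl (G _)) mulrACA.
  by rewrite mulVf ?mul1r // pnatr_eq0.
rewrite mulr_sumr; apply: eq_big_seq => vs hvs.
suff -> : size vs = size us by [].
elim: us vs hvs => [|u us IHu] vs //=.
by rewrite inE => /orP[/eqP->//|/mapP[ws /IHu e ->]] /=; rewrite e.
Qed.

End SetPartitions.

Section TupleSums.
Variables (R : realType) (d : nat).
Implicit Types (w : word d) (G : seq (word d) -> R).

Lemma sum_tuple_count (B k : nat) (L : seq (seq (word d))) G :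
  (forall us, us \in L -> [::] \notin us /\ (forall u, u \in us -> (size u <= B)%N)) ->
  \sum_(u : k.-tuple (B.-bseq 'I_d) | [::] \notin [seq bseqval v | v <- tval u])
     (count_mem [seq bseqval v | v <- tval u] L)%:R * G [seq bseqval v | v <- tval u]
  = \sum_(us <- L | size us == k) G us.
Proof.
elim: L => [|us L IH] h.
  by rewrite big_nil big1 // => u _; rewrite mul0r.
rewrite big_cons -IH => [|vs hvs]; last by apply: h; rewrite inE hvs orbT.
have [hne hB] := h us (mem_head _ _).
under eq_bigr do rewrite /= natrD mulrDl.
rewrite big_split /=.
suff -> : \sum_(u : k.-tuple (B.-bseq 'I_d) | [::] \notin [seq bseqval v | v <- tval u])
   (us == [seq bseqval v | v <- tval u])%:R * G [seq bseqval v | v <- tval u] =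
  if size us == k then G us else 0.
  by case: ifP => // _; rewrite add0r.
case: eqP => [hk|hk]; last first.
  rewrite big1 // => u _; case: eqP => [e|]; last by rewrite mul0r.
  by case: hk; rewrite e size_map size_tuple.
pose b (x : word d) : B.-bseq 'I_d := insub_bseq B x.
have bK x : x \in us -> bseqval (b x) = x.
  by move=> /hB hx; rewrite /b /insub_bseq /insubd (insubT (fun x : seq 'I_d => (size x <= B)%N) hx).
have hs : size (map b us) == k by rewrite size_map hk.
have e : [seq bseqval v | v <- tval (Tuple hs)] = us.
  by rewrite /= -map_comp map_id_in // => y /bK.
rewrite (bigD1 (Tuple hs)) /= ?e // eqxx mul1r big1 ?addr0 // => u /andP[_ hu].
case: eqP => [eu|]; last by rewrite mul0r.
case/eqP: hu; apply/val_inj => /=; apply: (inj_map val_inj).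
exact: etrans (esym eu) (esym e).
Qed.

(** From the composition formula to set partitions. The bounds B on the length of the words and K on
    their number are arbitrary above |w|, since larger tuples have coefficient zero; this lets one
    statement serve both [lift] and the Taylor expansion. *)
Lemma sum_shuffle_coefs (B K : nat) w G : (size w <= B)%N -> (size w <= K)%N ->
  front_invariant G ->
  \sum_(k < K.+1) (k`!%:R)^-1 *
     (\sum_(u : k.-tuple (B.-bseq 'I_d) | [::] \notin [seq bseqval v | v <- tval u])
       (count_mem w (shuffles [seq bseqval v | v <- tval u]))%:R
         * G [seq bseqval v | v <- tval u])
  = \sum_(us <- blocks w) G us.
Proof.
move=> hB hK hG; rewrite -sum_ordered_blocks //.
have step (k : 'I_K.+1) : (k`!%:R)^-1 *
     (\sum_(u : k.-tuple (B.-bseq 'I_d) | [::] \notin [seq bseqval v | v <- tval u])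
       (count_mem w (shuffles [seq bseqval v | v <- tval u]))%:R
         * G [seq bseqval v | v <- tval u])
  = \sum_(us <- ordered_blocks w | size us == k) ((size us)`!%:R)^-1 * G us.
  under eq_bigr => u hu do rewrite count_shuffles //.
  rewrite sum_tuple_count; last first.
    move=> us hus; split; first exact: ordered_blocks_nonempty hus.
    by move=> u /(ordered_blocks_size hus).2 /leq_trans; apply.
  by rewrite mulr_sumr; apply: eq_bigr => us /eqP ->.
rewrite (eq_bigr _ (fun k _ => step k)) /=.
under eq_bigr do rewrite big_mkcond /=.
rewrite exchange_big /=; apply: eq_big_seq => us hus.
have hk : (size us < K.+1)%N.
  by rewrite ltnS (leq_trans (ordered_blocks_size hus).1).
rewrite (bigD1 (Ordinal hk)) //= eqxx big1 ?addr0 // => i hi.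
by case: eqP => // e; case/eqP: hi; apply/val_inj.
Qed.

End TupleSums.

(** * Sums over words *)

Section WordSums.
Variables (d : nat) (V : nmodType).
Implicit Types (G : word d -> V) (N M : nat).

Lemma sum_bseq_seq N G (L : seq (word d)) : uniq L ->
  (forall w, (w \in L) = (size w <= N)%N) ->
  \sum_(v : N.-bseq 'I_d) G v = \sum_(w <- L) G w.
Proof.
move=> uL hL; rewrite -(big_map (@bseqval N _) xpredT G).
apply/perm_big/uniq_perm => //.
  by rewrite map_inj_uniq ?index_enum_uniq //; exact: val_inj.
move=> w; rewrite hL; apply/mapP/idP => [[x _ ->]|hw]; first exact: size_bseq.
by exists (Bseq hw) => //; rewrite mem_index_enum.
Qed.

Definition words N : seq (word d) := [seq bseqval v | v <- index_enum (N.-bseq 'I_d : finType)].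

Lemma words_uniq N : uniq (words N).
Proof. by rewrite map_inj_uniq ?index_enum_uniq //; exact: val_inj. Qed.

Lemma mem_words N w : (w \in words N) = (size w <= N)%N.
Proof.
apply/mapP/idP => [[x _ ->]|hw]; first exact: size_bseq.
by exists (Bseq hw) => //; rewrite mem_index_enum.
Qed.

Lemma sum_bseq_words N G : \sum_(v : N.-bseq 'I_d) G v = \sum_(w <- words N) G w.
Proof. by rewrite /words big_map. Qed.

Lemma sum_bseq0 G : \sum_(v : 0.-bseq 'I_d) G v = G [::].
Proof.
rewrite (@sum_bseq_seq _ _ [:: [::]]) ?big_seq1 // => w.
by rewrite inE leqn0 size_eq0.
Qed.

Lemma sum_bseqS N G : \sum_(v : N.+1.-bseq 'I_d) G v
  = G [::] + \sum_(i < d) \sum_(v : N.-bseq 'I_d) G (i :: v).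
Proof.
rewrite (@sum_bseq_seq _ _ ([::] :: [seq i :: w | i <- index_enum 'I_d, w <- words N])).
- rewrite big_cons; congr (_ + _).
  rewrite big_allpairs_dep; apply: eq_bigr => i _.
  by rewrite (sum_bseq_words N (fun v => G (i :: v))).
- rewrite cons_uniq; apply/andP; split.
    by apply/negP => /allpairsP[[i w]] /= [].
  apply: allpairs_uniq; rewrite ?index_enum_uniq ?words_uniq //.
  by move=> [i w] [j v] _ _ /= [-> ->].
move=> [|i w]; first by rewrite mem_head.
rewrite inE /= ltnS -mem_words; apply/allpairsP/idP => [[[j v]] /= [_ hv [_ ->]]//|hw].
by exists (i, w); split => //=; rewrite mem_index_enum.
Qed.

Lemma sum_bseq_le N M G : (M <= N)%N ->
  \sum_(v : M.-bseq 'I_d) G v = \sum_(v : N.-bseq 'I_d | (size v <= M)%N) G v.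
Proof.
move=> hM; rewrite (@sum_bseq_seq _ _ [seq w <- words N | (size w <= M)%N]).
- by rewrite big_filter /words big_map.
- by rewrite filter_uniq // words_uniq.
by move=> w; rewrite mem_filter mem_words andb_idr // => /leq_trans; apply.
Qed.

Lemma sum_bseq_nil N G :
  \sum_(v : N.-bseq 'I_d) G v = G [::] + \sum_(v : N.-bseq 'I_d | v != [::] :> word d) G v.
Proof. by rewrite (bigD1 [bseq]). Qed.

Lemma sum_bseq_dec_l N (F : word d -> word d -> V) :
  \sum_(w : N.-bseq 'I_d) \sum_(p <- dec w) F p.1 p.2
  = \sum_(u : N.-bseq 'I_d) \sum_(v : (N - size u).-bseq 'I_d) F u v.
Proof.
elim: N F => [|N IH] F.
  rewrite (sum_bseq0 (fun w => \sum_(p <- dec w) F p.1 p.2)) sum_dec_nil.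
  rewrite (sum_bseq0 (fun u => \sum_(v : (0 - size u).-bseq 'I_d) F u v)).
  by rewrite (sum_bseq0 (F [::])).
rewrite (sum_bseqS N (fun w => \sum_(p <- dec w) F p.1 p.2)).
rewrite (sum_bseqS N (fun u => \sum_(v : (N.+1 - size u).-bseq 'I_d) F u v)) sum_dec_nil.
rewrite /= (sum_bseqS N (F [::])) -addrA -big_split /=; congr (_ + _).
apply: eq_bigr => i _.
by rewrite -(IH (fun u => F (i :: u))) -big_split /=; apply: eq_bigr => v _; rewrite sum_dec_cons.
Qed.

(** Both sides run over the pairs with |u| + |v| <= N. The right factor v is put outermost because
    Chen's relation leaves, for each v, the expansion of F_v at the earlier time. *)
Lemma sum_bseq_dec N (F : word d -> word d -> V) :
  \sum_(w : N.-bseq 'I_d) \sum_(p <- dec w) F p.1 p.2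
  = \sum_(v : N.-bseq 'I_d) \sum_(u : (N - size v).-bseq 'I_d) F u v.
Proof.
rewrite sum_bseq_dec_l.
under eq_bigr => u _ do rewrite (sum_bseq_le (F u) (leq_subr (size u) N)) big_mkcond.
rewrite exchange_big /=; apply: eq_bigr => v _.
rewrite (sum_bseq_le (F^~ v) (leq_subr (size v) N)) [RHS]big_mkcond.
apply: eq_bigr => u _; congr (if _ then _ else _).
by have := size_bseq u; have := size_bseq v; lia.
Qed.

End WordSums.

Lemma sum_seq_words (R : pzRingType) (d M : nat) (L : seq (word d)) (F : word d -> R) :
  \sum_(w <- L | (size w <= M)%N) F w
  = \sum_(w : M.-bseq 'I_d) (count_mem (w : word d) L)%:R * F w.
Proof.
elim: L => [|x L IH]; first by rewrite big_nil big1 // => w _; rewrite mul0r.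
rewrite big_cons IH.
under [in RHS]eq_bigr do rewrite /= natrD mulrDl.
rewrite big_split /=.
suff -> : \sum_(w : M.-bseq 'I_d) (x == w)%:R * F w = if (size x <= M)%N then F x else 0.
  by case: ifP => //; rewrite add0r.
rewrite (sum_bseq_words M (fun w => (x == w)%:R * F w)); case: ifP => hx.
  rewrite (bigD1_seq x) ?words_uniq ?mem_words //= eqxx mul1r big1 ?addr0 // => w.
  by rewrite eq_sym => /negbTE ->; rewrite mul0r.
rewrite big_seq big1 // => w; rewrite mem_words; case: eqP => [<-|]; first by rewrite hx.
by rewrite mul0r.
Qed.

(** * Functions with bounded partial derivatives *)

Section RowVectors.
Variables (R : realType) (n : nat).
Implicit Types (v x : 'rV[R]_n).

Lemma norm_coord_le v j : `|v 0 j| <= `|v|.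
Proof.
rewrite [leRHS]/Num.Def.normr /= mx_normE.
apply: (@le_trans _ _ (`|v (0, j).1 (0, j).2|%:nng)%:num) => //.
exact: (@le_bigmax _ _ _ 0%:nng (fun i : 'I_1 * 'I_n => `|v i.1 i.2|%:nng) (0, j)).
Qed.

Lemma norm_rV_le v c : 0 <= c -> (forall j, `|v 0 j| <= c) -> `|v| <= c.
Proof.
move=> c0 h; rewrite [leLHS]/Num.Def.normr /= mx_normE -[c]/((NngNum c0)%:num).
rewrite num_le; apply/bigmax_leP; split => // -[i j] _.
by rewrite -num_le /= (ord1 i).
Qed.

Lemma rV_sum_delta v : v = \sum_j v 0 j *: delta_mx 0 j.
Proof. exact: row_sum_delta. Qed.

Lemma norm_delta_mx (j : 'I_n) : `|delta_mx 0 j : 'rV[R]_n| <= 1.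
Proof.
apply: norm_rV_le => // k; rewrite mxE eqxx /=.
by case: eqP; rewrite ?normr1 ?normr0.
Qed.

End RowVectors.

Definition pd (R : realType) (n : nat) (j : 'I_n) (phi : 'rV[R]_n -> R) : 'rV[R]_n -> R :=
  fun x => 'd phi x (delta_mx 0 j).

Section ScalarDifferentials.
Variables (R : realType).

Lemma diff_pd n (phi : 'rV[R]_n -> R) x v : 'd phi x v = \sum_j v 0 j * pd j phi x.
Proof.
rewrite {1}(rV_sum_delta v) linear_sum; apply: eq_bigr => j _.
by rewrite linearZ.
Qed.

Section Rules.
Variables (V : normedModType R).
Implicit Types (phi psi : V -> R) (x v : V).

Lemma diff_mul phi psi x v : differentiable phi x -> differentiable psi x ->
  'd (fun y => phi y * psi y) x v = phi x * 'd psi x v + psi x * 'd phi x v.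
Proof. by move=> h1 h2; have -> := diffM h1 h2. Qed.

Lemma diff_add phi psi x v : differentiable phi x -> differentiable psi x ->
  'd (fun y => phi y + psi y) x v = 'd phi x v + 'd psi x v.
Proof. by move=> h1 h2; have -> := diffD h1 h2. Qed.

Lemma diff_const (c : R) x v : 'd (fun=> c) x v = 0.
Proof. by have -> := @diff_cst R V _ c x. Qed.

Lemma diff_scale c phi x v : differentiable phi x ->
  'd (fun y => c * phi y) x v = c * 'd phi x v.
Proof. by move=> h; have -> := diffZ c h. Qed.

Lemma differentiable_scale c phi x : differentiable phi x ->
  differentiable (fun y => c * phi y) x.
Proof. by move=> h; exact: (differentiableZ c h). Qed.

Lemma differentiable_add phi psi x : differentiable phi x -> differentiable psi x ->
  differentiable (fun y => phi y + psi y) x.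
Proof. by move=> h1 h2; exact: (differentiableD h1 h2). Qed.

Lemma differentiable_mul phi psi x : differentiable phi x -> differentiable psi x ->
  differentiable (fun y => phi y * psi y) x.
Proof. by move=> h1 h2; exact: (differentiableM h1 h2). Qed.

Lemma differentiable_bigsum (I : Type) (s : seq I) (P : pred I) (F : I -> V -> R) x :
  (forall i, P i -> differentiable (F i) x) ->
  differentiable (fun y => \sum_(i <- s | P i) F i y) x.
Proof.
move=> h; elim: s => [|i s IH].
  by under eq_fun do rewrite big_nil; exact: differentiable_cst.
under eq_fun do rewrite big_cons.
by have := h i; case: (P i) => // hi; apply: differentiable_add => //; exact: hi.
Qed.

Lemma diff_bigsum (I : Type) (s : seq I) (P : pred I) (F : I -> V -> R) x v :
  (forall i, P i -> differentiable (F i) x) ->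
  'd (fun y => \sum_(i <- s | P i) F i y) x v = \sum_(i <- s | P i) 'd (F i) x v.
Proof.
move=> h; elim: s => [|i s IH].
  by under eq_fun do rewrite big_nil; rewrite diff_const big_nil.
under eq_fun do rewrite big_cons.
rewrite big_cons; have := h i; case: (P i) => // /(_ isT) hi.
apply: (etrans (diff_add v hi (differentiable_bigsum s h))).
by congr (_ + _).
Qed.

End Rules.

Lemma diff_chain (V V' : normedModType R) (phi : V' -> R) (Y : V -> V') x v :
  differentiable Y x -> differentiable phi (Y x) ->
  'd (fun y => phi (Y y)) x v = 'd phi (Y x) ('d Y x v).
Proof. by move=> h1 h2; have -> := diff_comp h1 h2. Qed.

Lemma differentiable_chain (V V' V'' : normedModType R) (phi : V' -> V'') (Y : V -> V') x :
  differentiable Y x -> differentiable phi (Y x) ->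
  differentiable (fun y => phi (Y y)) x.
Proof. by move=> h1 h2; exact: (differentiable_comp h1 h2). Qed.

Lemma diff_linear_fun (V W : normedModType R) (F : V -> W) x :
  linear F -> continuous F -> differentiable F x /\ forall v, 'd F x v = F v.
Proof.
move=> lF cF; pose L := GRing.isLinear.Build _ _ _ _ F lF.
pose LF : {linear V -> W} := HB.pack F L.
split; first exact: (@linear_differentiable R V W LF x cF).
by move=> v; have := @diff_lin R V W LF x cF => /= ->.
Qed.

Lemma diff_addl_const (V W : normedModType R) (F : V -> W) (w : W) x : differentiable F x ->
  differentiable (fun y => w + F y) x /\ forall v, 'd (fun y => w + F y) x v = 'd F x v.
Proof.
move=> h; split; first exact: (@differentiableD _ _ _ (cst w) F x (differentiable_cst w x) h).
move=> v; have e := congr1 (@^~ v) (@diffD _ _ _ (cst w) F x (differentiable_cst w x) h).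
have e0 := congr1 (@^~ v) (@diff_cst _ V W w x).
by rewrite -['d F x v]add0r -[X in X + _]e0; exact: e.
Qed.

Lemma diff_scalel (W : normedModType R) (w : W) (t : R) :
  differentiable (fun s : R => s *: w) t /\ forall v, 'd (fun s : R => s *: w) t v = v *: w.
Proof.
have hi : differentiable (id : R -> R) t by exact: (@ex_diff _ _ _ _ _ _ _ (is_diff_id t)).
split; first exact: (@differentiableZl _ _ _ id w t hi).
move=> v; have -> := @diffZl _ _ _ id w t hi.
by have -> := @diff_val _ _ _ _ _ _ _ (is_diff_id t).
Qed.

Lemma diff_rV_coord n (x v : 'rV[R]_n) j : 'd (fun y : 'rV[R]_n => y 0 j) x v = v 0 j.
Proof.
have lF : linear (fun y : 'rV[R]_n => y 0 j) by move=> a u w; rewrite !mxE.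
have cF : continuous (fun y : 'rV[R]_n => y 0 j) by exact: coord_continuous.
exact: (diff_linear_fun x lF cF).2.
Qed.

Lemma differentiable_rV_coord n (x : 'rV[R]_n) j : differentiable (fun y : 'rV[R]_n => y 0 j) x.
Proof. exact: differentiable_coord. Qed.

Lemma differentiable_coords (V : normedModType R) n (F : V -> 'rV[R]_n) x :
  (forall j, differentiable (fun y => F y 0 j) x) -> differentiable F x.
Proof.
move=> h; have -> : F = \sum_j (fun y => F y 0 j *: delta_mx 0 j).
  by apply/funext => y; rewrite fct_sumE; exact: rV_sum_delta.
by apply: differentiable_sum => j; exact: differentiableZl.
Qed.

Lemma differentiable_coordE (V : normedModType R) n (F : V -> 'rV[R]_n) x j :
  differentiable F x -> differentiable (fun y => F y 0 j) x.
Proof.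
by move=> h; apply: (@differentiable_chain _ _ _ (fun y : 'rV[R]_n => y 0 j) F) => //; exact: differentiable_rV_coord.
Qed.

Lemma diff_coord (V : normedModType R) n (F : V -> 'rV[R]_n) x v j : differentiable F x ->
  ('d F x v) 0 j = 'd (fun y => F y 0 j) x v.
Proof.
move=> h; rewrite (@diff_chain _ _ (fun y : 'rV[R]_n => y 0 j) F) ?diff_rV_coord //.
exact: differentiable_rV_coord.
Qed.

End ScalarDifferentials.

(* [Cbd k D phi]: the functions phi i are of class C^k on the whole space, and
   their partial derivatives up to order k are bounded on D uniformly in i.  In
   particular [Cbd k set0] is mere smoothness. *)
Fixpoint Cbd (R : realType) (n k : nat) (D : set 'rV[R]_n) (I : Type)
    (phi : I -> 'rV[R]_n -> R) {struct k} : Prop :=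
  (exists M, forall i x, D x -> `|phi i x| <= M) /\
  (if k is k'.+1 then
     (forall i x, differentiable (phi i) x) /\
     (forall j, Cbd k' D (fun i => pd j (phi i)))
   else forall i, continuous (phi i)).

Section BoundedFamilies.
Variables (R : realType) (n : nat).
Implicit Types (D : set 'rV[R]_n) (I : Type) (k : nat).

Lemma Cbd_bounded k D I (phi : I -> 'rV[R]_n -> R) : Cbd k D phi ->
  exists M, 0 <= M /\ forall i x, D x -> `|phi i x| <= M.
Proof.
have : Cbd k D phi -> exists M, forall i x, D x -> `|phi i x| <= M by case: k => [|k] [].
move=> h /h [M hM]; exists `|M|; split=> // i x /hM/le_trans; apply; exact: ler_norm.
Qed.

Lemma Cbd_continuous k D I (phi : I -> 'rV[R]_n -> R) i : Cbd k D phi -> continuous (phi i).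
Proof.
case: k => [[_ h]|k [_ [h _]]]; first exact: h.
by move=> x; apply: differentiable_continuous; exact: h.
Qed.

Lemma Cbd_differentiable k D I (phi : I -> 'rV[R]_n -> R) i x :
  Cbd k.+1 D phi -> differentiable (phi i) x.
Proof. by case=> _ [h _]; exact: h. Qed.

Lemma Cbd_pd k D I (phi : I -> 'rV[R]_n -> R) j :
  Cbd k.+1 D phi -> Cbd k D (fun i => pd j (phi i)).
Proof. by case=> _ [_]; exact. Qed.

Lemma CbdW k D I (phi : I -> 'rV[R]_n -> R) : Cbd k.+1 D phi -> Cbd k D phi.
Proof.
elim: k I phi => [|k IH] I phi h.
  by split; [case: h|move=> i; exact: Cbd_continuous h].
have [h1 [h2 h3]] := h.
by split=> //; split=> // j; apply: IH; exact: h3.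
Qed.

Lemma Cbd_le k k' D I (phi : I -> 'rV[R]_n -> R) : (k' <= k)%N -> Cbd k D phi -> Cbd k' D phi.
Proof.
elim: k => [|k IH]; first by rewrite leqn0 => /eqP-> h; exact: h.
rewrite leq_eqVlt => /orP[/eqP-> h|]; first exact: h.
by rewrite ltnS => /IH h /CbdW h'; exact: h.
Qed.

Lemma Cbd_sub k D D' I (phi : I -> 'rV[R]_n -> R) : D' `<=` D -> Cbd k D phi -> Cbd k D' phi.
Proof.
move=> s; elim: k I phi => [|k IH] I phi [[M hM] h]; split; try by exists M => i x /s; exact: hM.
  exact: h.
by case: h => h1 h2; split=> // j; exact: (IH _ _ (h2 j)).
Qed.

Lemma Cbd_reindex k D I J (h : J -> I) (phi : I -> 'rV[R]_n -> R) :
  Cbd k D phi -> Cbd k D (fun j => phi (h j)).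
Proof.
elim: k I J h phi => [|k IH] I J h phi [[M hM] hp]; split; try by exists M => i x; exact: hM.
  by move=> j; exact: hp.
case: hp => h1 h2; split=> [j x|j]; first exact: h1.
by exact: (IH _ _ h _ (h2 j)).
Qed.

Lemma Cbd_smooth k D I (phi : I -> 'rV[R]_n -> R) i : Cbd k D phi ->
  Cbd k set0 (fun _ : unit => phi i).
Proof.
by move=> h; apply: (Cbd_sub (D := D)); [exact: sub0set|exact: (Cbd_reindex (fun=> i) h)].
Qed.

Lemma Cbd_const k D I (c : I -> R) (M : R) : (forall i, `|c i| <= M) ->
  Cbd k D (fun i _ => c i).
Proof.
elim: k I c M => [|k IH] I c M h; (split; first by exists M => i x _).
  by move=> i x; exact: cst_continuous.
split=> [i x|j]; first exact: differentiable_cst.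
have -> : (fun i => pd j (fun=> c i)) = fun=> fun=> 0.
  by apply/funext => i; apply/funext => x; rewrite /pd diff_const.
by apply: (IH _ _ 0) => _; rewrite normr0.
Qed.

Lemma Cbd_add k D I (phi psi : I -> 'rV[R]_n -> R) : Cbd k D phi -> Cbd k D psi ->
  Cbd k D (fun i x => phi i x + psi i x).
Proof.
elim: k I phi psi => [|k IH] I phi psi [[M hM] h] [[M' hM'] h'].
  split; first by exists (M + M') => i x Dx; rewrite (le_trans (ler_normD _ _)) // lerD ?hM ?hM'.
  by move=> i x; apply: continuousD; [exact: h|exact: h'].
split; first by exists (M + M') => i x Dx; rewrite (le_trans (ler_normD _ _)) // lerD ?hM ?hM'.
case: h h' => h1 h2 [h1' h2']; split=> [i x|j]; first exact: differentiable_add.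
have -> : (fun i => pd j (fun x => phi i x + psi i x)) =
    (fun i x => pd j (phi i) x + pd j (psi i) x).
  by apply/funext => i; apply/funext => x; exact: diff_add.
exact: (IH _ _ _ (h2 j) (h2' j)).
Qed.

Lemma Cbd_mul k D I (phi psi : I -> 'rV[R]_n -> R) : Cbd k D phi -> Cbd k D psi ->
  Cbd k D (fun i x => phi i x * psi i x).
Proof.
elim: k I phi psi => [|k IH] I phi psi hp hp'.
  have [[M hM] h] := hp; have [[M' hM'] h'] := hp'.
  split; first by exists (M * M') => i x Dx; rewrite normrM ler_pM ?hM ?hM'.
  by move=> i x; apply: continuousM; [exact: h|exact: h'].
have [[M hM] h] := hp; have [[M' hM'] h'] := hp'.
split; first by exists (M * M') => i x Dx; rewrite normrM ler_pM ?hM ?hM'.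
case: h h' => h1 h2 [h1' h2']; split=> [i x|j]; first exact: differentiable_mul.
have -> : (fun i => pd j (fun x => phi i x * psi i x)) =
    (fun i x => phi i x * pd j (psi i) x + psi i x * pd j (phi i) x).
  by apply/funext => i; apply/funext => x; exact: diff_mul.
apply: Cbd_add; apply: IH; first exact: CbdW.
- exact: (Cbd_pd _ hp').
- exact: CbdW.
exact: (Cbd_pd _ hp).
Qed.

Lemma Cbd_scale k D I c (phi : I -> 'rV[R]_n -> R) : Cbd k D phi ->
  Cbd k D (fun i x => c * phi i x).
Proof. by move=> h; apply: Cbd_mul => //; apply: (Cbd_const _ _ (M := `|c|)). Qed.

Lemma Cbd_sum k D I (J : Type) (s : seq J) (P : pred J) (phi : J -> I -> 'rV[R]_n -> R) :
  (forall j, Cbd k D (phi j)) -> Cbd k D (fun i x => \sum_(j <- s | P j) phi j i x).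
Proof.
move=> h; elim: s => [|j s IH].
  have -> : (fun (i : I) (x : 'rV[R]_n) => \sum_(j <- [::] | P j) phi j i x) = fun=> fun=> 0.
    by apply/funext => i; apply/funext => x; rewrite big_nil.
  by apply: (Cbd_const _ _ (M := 0)) => _; rewrite normr0.
have -> : (fun (i : I) (x : 'rV[R]_n) => \sum_(j <- j :: s | P j) phi j i x) =
   fun i x => if P j then phi j i x + \sum_(j <- s | P j) phi j i x
              else \sum_(j <- s | P j) phi j i x.
  by apply/funext => i; apply/funext => x; rewrite big_cons.
by case: (P j) => //; exact: Cbd_add.
Qed.

Lemma Cbd_diff_dir k D I (phi : I -> 'rV[R]_n -> R) (v : 'rV[R]_n) : Cbd k.+1 D phi ->
  Cbd k D (fun i x => 'd (phi i) x v).
Proof.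
move=> h.
have -> : (fun i x => 'd (phi i) x v) = fun i x => \sum_j v 0 j * pd j (phi i) x.
  by apply/funext => i; apply/funext => x; exact: diff_pd.
by apply: (@Cbd_sum k D I _ _ _ (fun j i x => v 0 j * pd j (phi i) x)) => j; apply: Cbd_scale; exact: Cbd_pd.
Qed.

End BoundedFamilies.

(** The derivative of L along e_j is the constant [c j], so each partial derivative of the composite
    is a fixed linear combination of composites of the same kind. *)
Lemma Cbd_comp_affine (R : realType) (n m k : nat) (D : set 'rV[R]_m) D' (I : Type)
    (phi : I -> 'rV[R]_n -> R)
    (L : 'rV[R]_m -> 'rV[R]_n) (c : 'I_m -> 'rV[R]_n) :
  (forall x, differentiable L x) -> (forall x j, 'd L x (delta_mx 0 j) = c j) ->
  (forall x, D x -> D' (L x)) -> Cbd k D' phi -> Cbd k D (fun i x => phi i (L x)).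
Proof.
move=> dL cL DL; elim: k I phi => [|k IH] I phi [[M hM] h].
  split; first by exists M => i x Dx; exact/hM/DL.
  move=> i x; apply: (@continuous_comp _ _ _ L (phi i)); last exact: h.
  by apply: differentiable_continuous; exact: dL.
split; first by exists M => i x Dx; exact/hM/DL.
case: h => h1 h2; split=> [i x|j].
  by apply: differentiable_chain => //; exact: dL.
have -> : (fun i => pd j (fun x => phi i (L x))) =
    (fun i x => \sum_l c j 0 l * pd l (phi i) (L x)).
  apply/funext => i; apply/funext => x.
  by rewrite /pd diff_chain ?cL ?diff_pd //; exact: dL.
apply: (@Cbd_sum _ _ k D I _ _ _ (fun l i x => c j 0 l * pd l (phi i) (L x))) => l.
by apply: Cbd_scale; exact: (IH _ _ (h2 l)).
Qed.

(** * The mean value theorem and the symmetry of second derivatives *)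

Section MeanValue.
Variables (R : realType) (n : nat).
Implicit Types (phi : 'rV[R]_n -> R) (x v : 'rV[R]_n).

Lemma line_is_derive phi x v (t : R) : differentiable phi (x + t *: v) ->
  is_derive t 1 (fun t : R => phi (x + t *: v)) ('d phi (x + t *: v) v).
Proof.
move=> h.
have [dS eS] := diff_scalel v t.
have [dL eL] := diff_addl_const x dS.
have dphi : differentiable (fun t : R => phi (x + t *: v)) t by exact: differentiable_chain.
apply: DeriveDef; first exact: diff_derivable.
by rewrite deriveE // diff_chain // eL eS scale1r.
Qed.

Lemma mvt_line phi x v : (forall y, differentiable phi y) ->
  exists2 c, 0 <= c <= 1 & phi (x + v) - phi x = 'd phi (x + c *: v) v.
Proof.
move=> h; pose g (t : R) := phi (x + t *: v).
have [|t _|t|c] := @MVT_segment R g (fun t => 'd phi (x + t *: v) v) 0 1.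
- exact: ler01.
- exact: line_is_derive.
- by apply: derivable_within_continuous => s _; apply: ex_derive; exact: line_is_derive.
rewrite in_itv /= => hc; rewrite /g scale1r scale0r addr0 subr0 mulr1 => e.
by exists c.
Qed.

Lemma diff_translate phi w y : (forall z, differentiable phi z) ->
  differentiable (fun z => phi (w + z)) y /\
  forall u, 'd (fun z => phi (w + z)) y u = 'd phi (w + y) u.
Proof.
move=> d1; have hid := is_diff_id y.
have [h1 h2] := diff_addl_const w (@ex_diff _ _ _ _ _ _ _ hid).
split; first exact: (differentiable_chain h1 (d1 _)).
move=> u; apply: (etrans (diff_chain u h1 (d1 _))).
have e3 := etrans (h2 u) (congr1 (@^~ u) (@diff_val _ _ _ _ _ _ _ hid)).
have e4 := congr1 ('d phi (w + y)) e3.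
exact e4.
Qed.

Lemma mvt_difference phi x v w : (forall y, differentiable phi y) ->
  exists2 c, 0 <= c <= 1 &
    (phi (w + (x + v)) - phi (x + v)) - (phi (w + x) - phi x)
    = 'd phi (w + (x + c *: v)) v - 'd phi (x + c *: v) v.
Proof.
move=> d1; have dw y := diff_translate w y d1.
have d2 y : differentiable (fun y => (-1) * phi y) y by exact: differentiable_scale.
have d3 y := differentiable_add (dw y).1 (d2 y).
have [c hc e] := mvt_line x v d3; exists c => //.
have e2 := diff_add v (dw (x + c *: v)).1 (d2 (x + c *: v)).
have e3 := diff_scale (-1) v (d1 (x + c *: v)).
move: (etrans e (etrans e2 (congr2 +%R ((dw (x + c *: v)).2 v) e3))).
by rewrite !mulN1r.
Qed.

(** The second difference over a square of side h is treated by the mean value theorem twice: in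
    direction j for the difference in direction i, then conversely. Exchanging i and j in this
    formula gives Schwarz's theorem as h tends to 0. *)
Lemma schwarz_increment phi i j x (h : R) :
  (forall y, differentiable phi y) -> (forall y, differentiable (pd i phi) y) ->
  exists a b : R, [/\ 0 <= a <= 1, 0 <= b <= 1 &
   (phi (x + h *: delta_mx 0 i + h *: delta_mx 0 j) - phi (x + h *: delta_mx 0 i))
   - (phi (x + h *: delta_mx 0 j) - phi x)
   = h * (h * pd j (pd i phi) (x + (a * h) *: delta_mx 0 i + (b * h) *: delta_mx 0 j))].
Proof.
move=> d1 d2.
have pdZ (f : 'rV[R]_n -> R) y k : 'd f y (h *: delta_mx 0 k) = h * pd k f y.
  exact: linearZ.
have [a ha ea] := mvt_difference x (h *: delta_mx 0 i) (h *: delta_mx 0 j) d1.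
have [b hb eb] := mvt_line (x + a *: (h *: delta_mx 0 i)) (h *: delta_mx 0 j) d2.
exists a, b; split=> //.
have ea' := etrans ea (congr2 (fun s t => s - t) (pdZ phi _ i) (pdZ phi _ i)).
have eb' := etrans eb (pdZ (pd i phi) _ j).
rewrite -!scalerA -eb' mulrBr [x + _ + h *: _]addrC [x + h *: delta_mx 0 j]addrC ea'.
by rewrite [_ + h *: delta_mx 0 j in RHS]addrC.
Qed.

Lemma schwarz phi i j x :
  (forall y, differentiable phi y) ->
  (forall y, differentiable (pd i phi) y) -> (forall y, differentiable (pd j phi) y) ->
  continuous (pd j (pd i phi)) -> continuous (pd i (pd j phi)) ->
  pd j (pd i phi) x = pd i (pd j phi) x.
Proof.
move=> d1 di dj cj ci; apply/eqP; rewrite -subr_eq0 -normr_le0; apply/ler_addgt0Pr => e e0.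
rewrite add0r.
have e2 : 0 < e / 2 by rewrite divr_gt0.
have /cvgrPdist_lt/(_ _ e2) := cj x; have /cvgrPdist_lt/(_ _ e2) := ci x.
move=> /nbhs_normP[r /= r0 hr] /nbhs_normP[r' /= r'0 hr'].
(* The intermediate points lie within 2 h of x, hence inside both balls. *)
pose h := Num.min r r' / 3.
have m0 : 0 < Num.min r r' by rewrite lt_min r0.
have h0 : 0 < h by rewrite divr_gt0.
have m1 : Num.min r r' <= r by rewrite ge_min lexx.
have m2 : Num.min r r' <= r' by rewrite ge_min lexx orbT.
have small (c : R) (k : 'I_n) : 0 <= c <= 1 -> `|(c * h) *: delta_mx 0 k : 'rV[R]_n| <= h.
  move=> /andP[c0 c1]; rewrite normrZ.
  apply: (le_trans (ler_wpM2l (normr_ge0 _) (norm_delta_mx _ _))).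
  rewrite mulr1 normrM (ger0_norm c0) (gtr0_norm h0).
  by apply: ler_piMl => //; exact: ltW.
have inball (k l : 'I_n) (a b : R) : 0 <= a <= 1 -> 0 <= b <= 1 ->
    `|x - (x + (a * h) *: delta_mx 0 k + (b * h) *: delta_mx 0 l)| < Num.min r r'.
  move=> ha hb.
  rewrite -addrA opprD addrA subrr sub0r normrN.
  apply: (@le_lt_trans _ _ (h + h)); last by rewrite /h; lra.
  by apply: (le_trans (ler_normD _ _)); apply: lerD; exact: small.
have [a [b [ha hb eab]]] := schwarz_increment j x h d1 di.
have [a' [b' [ha' hb' eab']]] := schwarz_increment i x h d1 dj.
have key : pd j (pd i phi) (x + (a * h) *: delta_mx 0 i + (b * h) *: delta_mx 0 j)
    = pd i (pd j phi) (x + (a' * h) *: delta_mx 0 j + (b' * h) *: delta_mx 0 i).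
  have hn0 : h != 0 by rewrite gt_eqF.
  apply: (mulfI hn0); apply: (mulfI hn0).
  rewrite -eab -eab' (addrAC x); ring.
have := hr' _ (lt_le_trans (inball i j a b ha hb) m2).
have := hr _ (lt_le_trans (inball j i a' b' ha' hb') m1).
rewrite key => h1 h2.
move: (pd i (pd j phi) _) (pd j (pd i phi) x) (pd i (pd j phi) x) h1 h2 => z a0 b0 h1 h2.
have -> : a0 - b0 = (a0 - z) - (b0 - z) by ring.
rewrite (le_trans (ler_normB _ _)) //.
by rewrite ltW // [e]splitr ltrD.
Qed.

End MeanValue.

(** * Higher differentials and Taylor expansion *)

Notation smooth k phi := (Cbd k set0 (fun _ : unit => phi)).

(* [Dr phi [:: v_1; ..; v_k] x] is D^k phi(x)(v_1, .., v_k) expanded in coordinates. *)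
Fixpoint Dr (R : realType) (n : nat) (phi : 'rV[R]_n -> R) (vs : seq 'rV[R]_n) :
    'rV[R]_n -> R :=
  if vs is v :: vs' then fun x => \sum_j v 0 j * Dr (pd j phi) vs' x else phi.

Section HigherDifferentials.
Variables (R : realType) (n : nat).
Implicit Types (phi : 'rV[R]_n -> R) (x v : 'rV[R]_n) (vs : seq 'rV[R]_n).

Lemma smooth_differentiable k phi x : smooth k.+1 phi -> differentiable phi x.
Proof. by move=> h; exact: (Cbd_differentiable tt x h). Qed.

Lemma smooth_pd k phi j : smooth k.+1 phi -> smooth k (pd j phi).
Proof. by move=> h; exact: (Cbd_pd j h). Qed.

Lemma smooth_continuous k phi : smooth k phi -> continuous phi.
Proof. by move=> h; exact: (@Cbd_continuous _ _ _ _ _ _ tt h). Qed.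

Lemma smooth_schwarz k phi i j : smooth k.+2 phi -> pd j (pd i phi) = pd i (pd j phi).
Proof.
move=> h; apply/funext => x; apply: schwarz => [y|y|y||].
- exact: smooth_differentiable h.
- exact: (smooth_differentiable y (smooth_pd i h)).
- exact: (smooth_differentiable y (smooth_pd j h)).
- exact: (smooth_continuous (smooth_pd j (smooth_pd i h))).
- exact: (smooth_continuous (smooth_pd i (smooth_pd j h))).
Qed.

Lemma Cbd_Dr k D I (phi : I -> 'rV[R]_n -> R) vs : Cbd (size vs + k) D phi ->
  Cbd k D (fun i => Dr (phi i) vs).
Proof.
elim: vs phi => [|v vs IH] phi //= h.
apply: (@Cbd_sum _ _ k D I _ _ _ (fun j i x => v 0 j * Dr (pd j (phi i)) vs x)) => j.
by apply: Cbd_scale; apply: (IH (fun i => pd j (phi i))); exact: (Cbd_pd j h).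
Qed.

Lemma smooth_Dr_differentiable phi vs x : smooth (size vs).+1 phi -> differentiable (Dr phi vs) x.
Proof.
move=> h; apply: (smooth_differentiable (k := 0)).
by apply: (Cbd_Dr (phi := fun _ : unit => phi)); rewrite addn1; exact: h.
Qed.

Lemma diff_Dr phi vs x v : smooth (size vs).+1 phi -> 'd (Dr phi vs) x v = Dr phi (v :: vs) x.
Proof.
elim: vs phi => [|u vs IH] phi h; first exact: diff_pd.
have hj j := smooth_pd j h.
have dj j : differentiable (Dr (pd j phi) vs) x by exact: smooth_Dr_differentiable.
pose F j y := u 0 j * Dr (pd j phi) vs y.
have dF j : differentiable (F j) x by exact: differentiable_scale.
apply: (etrans (@diff_bigsum _ _ _ _ xpredT F x v (fun j _ => dF j))).
apply: (@etrans _ _ (\sum_j u 0 j * \sum_l v 0 l * Dr (pd l (pd j phi)) vs x)).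
  apply: eq_bigr => j _; apply: (etrans (diff_scale _ v (dj j))).
  by congr (_ * _); exact: (IH _ (hj j)).
under eq_bigr do rewrite mulr_sumr.
rewrite exchange_big /=; apply: eq_bigr => l _; rewrite mulr_sumr.
by apply: eq_bigr => j _; rewrite mulrCA (smooth_schwarz j l h).
Qed.

Lemma Dr_Dk phi vs x : smooth (size vs) phi -> Dk phi vs x = Dr phi vs x.
Proof.
elim: vs x => [|v vs IH] x h //.
have e : Dk phi vs = Dr phi vs.
  by apply/funext => y; apply: IH; exact: CbdW.
have e' : Dk phi (v :: vs) x = 'd (Dr phi vs) x v by rewrite /= e.
exact: (etrans e' (diff_Dr x v h)).
Qed.

Lemma Dr_swap k phi u v vs : smooth k.+2 phi -> Dr phi (u :: v :: vs) = Dr phi (v :: u :: vs).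
Proof.
move=> h; apply/funext => x /=.
under eq_bigr do rewrite mulr_sumr.
rewrite exchange_big /=; apply: eq_bigr => l _; rewrite mulr_sumr.
by apply: eq_bigr => j _; rewrite mulrCA (smooth_schwarz j l h).
Qed.

Lemma Dr_front phi us1 u us2 : smooth (size us1 + size us2).+1 phi ->
  Dr phi (us1 ++ u :: us2) = Dr phi (u :: us1 ++ us2).
Proof.
elim: us1 phi => [|v us1 IH] phi h //.
rewrite -[RHS]/(Dr phi (u :: v :: us1 ++ us2)) (Dr_swap (k := size us1 + size us2)) //.
apply/funext => x /=; apply: eq_bigr => j _; congr (_ * _).
by rewrite IH //; exact: (smooth_pd j h).
Qed.

Lemma Dr_scale_head phi c v vs x : Dr phi (c *: v :: vs) x = c * Dr phi (v :: vs) x.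
Proof. by rewrite /= mulr_sumr; apply: eq_bigr => j _; rewrite mxE mulrA. Qed.

Lemma Dr_sum_head phi (I : Type) (s : seq I) (P : pred I) (F : I -> 'rV[R]_n) vs x :
  Dr phi (\sum_(i <- s | P i) F i :: vs) x = \sum_(i <- s | P i) Dr phi (F i :: vs) x.
Proof.
rewrite /= exchange_big /=; apply: eq_bigr => j _.
by rewrite summxE mulr_suml.
Qed.

Lemma Dr_multilinear phi k (I : finType) (P : pred I) (c : I -> R) (F : I -> 'rV[R]_n) x :
  Dr phi (nseq k (\sum_(i | P i) c i *: F i)) x
  = \sum_(t : k.-tuple I | all P t) (\prod_(i <- t) c i) * Dr phi [seq F i | i <- t] x.
Proof.
elim: k phi => [|k IH] phi.
  rewrite (bigD1 [tuple]) //= big_nil mul1r big1 ?addr0 // => t /andP[_].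
  by rewrite tuple0.
rewrite [LHS]Dr_sum_head.
under eq_bigr => i _.
  rewrite Dr_scale_head /=.
  under eq_bigr do rewrite IH mulr_sumr.
  rewrite exchange_big mulr_sumr /=.
  over.
rewrite pair_big_dep /=.
rewrite (reindex (fun t : k.+1.-tuple I => (thead t, [tuple of behead t]))) /=; last first.
  exists (fun p : I * k.-tuple I => [tuple of p.1 :: p.2]) => [t _|[i t] _] /=.
    by rewrite [RHS]tuple_eta; apply: val_inj.
  by congr (_, _); apply: val_inj.
apply: eq_big => [t|t _]; first by rewrite [in RHS](tuple_eta t).
rewrite [in RHS](tuple_eta t) /= big_cons.
rewrite -mulrA; congr (_ * _); rewrite mulr_sumr; apply: eq_bigr => j _.
by rewrite mulrCA.
Qed.

(** The direction joins the index of the family, which is what an induction bounding all D^k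
    phi(v_1, .., v_k) at once needs; partial derivatives are commuted by Schwarz's theorem. *)
Lemma Cbd_pd_uniform k D I (phi : I -> 'rV[R]_n -> R) : Cbd k.+1 D phi ->
  Cbd k D (fun p : I * 'I_n => pd p.2 (phi p.1)).
Proof.
have bd m J (psi : J -> 'rV[R]_n -> R) : Cbd m.+1 D psi ->
    exists M, forall p x, D x -> `|pd p.2 (psi p.1) x| <= M.
  move=> h; have /choice[M hM] : forall j, exists M, forall i x, D x -> `|pd j (psi i) x| <= M.
    by move=> j; have [M [_ hM]] := Cbd_bounded (Cbd_pd j h); exists M.
  exists (\sum_j `|M j|) => -[i j] x Dx /=.
  rewrite (bigD1 j) //= (le_trans (hM j i x Dx)) // (le_trans (ler_norm _)) // lerDl.
  exact: sumr_ge0.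
elim: k I phi => [|k IH] I phi h; (split; first exact: (bd _ _ _ h)).
  by move=> [i j]; exact: (@Cbd_continuous _ _ _ _ _ _ i (Cbd_pd j h)).
split; first by move=> [i j] x; exact: (Cbd_differentiable i x (Cbd_pd j h)).
move=> l.
have -> : (fun p : I * 'I_n => pd l (pd p.2 (phi p.1))) = (fun p => pd p.2 (pd l (phi p.1))).
  by apply/funext => -[i j] /=; apply: (smooth_schwarz (k := k)); exact: (Cbd_smooth i h).
exact: (IH _ (fun i => pd l (phi i)) (Cbd_pd l h)).
Qed.

Lemma Dr_bound (D : set 'rV[R]_n) k I (phi : I -> 'rV[R]_n -> R) : Cbd k D phi ->
  exists M, 0 <= M /\ forall i vs x, (size vs <= k)%N -> D x ->
    `|Dr (phi i) vs x| <= M * \prod_(v <- vs) `|v|.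
Proof.
elim: k I phi => [|k IH] I phi h.
  have [M [M0 hM]] := Cbd_bounded h; exists M; split=> // i [|//] x _ Dx.
  by rewrite big_nil mulr1; exact: hM.
have [M0 [M00 hM0]] := Cbd_bounded h.
have [M1 [M10 hM1]] := IH _ _ (Cbd_pd_uniform h).
exists (M0 + n%:R * M1); split; first by rewrite addr_ge0 // mulr_ge0.
move=> i [|v vs] x hs Dx.
  by rewrite big_nil mulr1 (le_trans (hM0 _ _ Dx)) // lerDl mulr_ge0.
rewrite big_cons /= (le_trans (ler_norm_sum _ _ _)) //.
have p0 : 0 <= \prod_(v <- vs) `|v| by apply: prodr_ge0.
apply: (@le_trans _ _ (\sum_(j < n) `|v| * (M1 * \prod_(v <- vs) `|v|))).
  apply: ler_sum => j _; rewrite normrM ler_pM ?norm_coord_le //.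
  exact: (hM1 (i, j) vs x).
rewrite sumr_const card_ord -[leLHS]mulr_natl.
have -> : n%:R * (`|v| * (M1 * \prod_(v0 <- vs) `|v0|)) =
   n%:R * M1 * (`|v| * \prod_(v0 <- vs) `|v0|) by ring.
by rewrite [leRHS]mulrDl lerDr !mulr_ge0.
Qed.

(** The remainder of order m + 1 vanishes at 0 and its derivative is the remainder of order m of
    [g 1], so the mean value theorem carries the bound along. The constant is K instead of K/m!,
    which is enough here. *)
Lemma taylor_1d m (g : nat -> R -> R) (K : R) :
  (forall k (t : R), (k < m)%N -> is_derive t 1 (g k) (g k.+1 t)) ->
  (forall t, 0 <= t <= 1 -> `|g m t| <= K) ->
  forall t, 0 <= t <= 1 ->
    `|g 0%N t - (\poly_(k < m) (g k 0 / k`!%:R)).[t]| <= K.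
Proof.
elim: m g => [|m IH] g hg hK t ht.
  by rewrite poly_def big_ord0 horner0 subr0 hK.
pose p := \poly_(k < m.+1) (g k 0 / k`!%:R).
have dp : p^`()%R = \poly_(k < m) (g k.+1 0 / k`!%:R).
  apply/polyP => k; rewrite coef_deriv !coef_poly ltnS; case: ltnP => _; last by rewrite mul0rn.
  rewrite -[LHS]mulr_natr factS natrM invfM.
  have kn : k.+1%:R != 0 :> R by rewrite pnatr_eq0.
  move: (k.+1%:R) kn (k`!%:R^-1) (g k.+1 0) => a an b c.
  by rewrite -mulrA mulrAC mulVf ?mul1r.
have IH' := IH (fun k => g k.+1) (fun k t hk => hg k.+1 t hk) hK.
pose r (s : R) := g 0%N s - p.[s].
have dr (s : R) : is_derive s 1 r (g 1%N s - (p^`()%R).[s]).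
  by apply: is_deriveB; exact: hg.
case/andP: ht => t0 t1.
have cr : {within `[0, t], continuous r}.
  by apply: derivable_within_continuous => u _; apply: ex_derive; exact: dr.
have [c] := @MVT_segment R r _ 0 t t0 (fun s _ => dr s) cr.
rewrite in_itv /= subr0 => /andP[c0 ct] e.
have r0 : r 0 = 0.
  by rewrite /r horner_coef0 coef_poly /= fact0 divr1 subrr.
rewrite -/(r t); move: e; rewrite r0 subr0 => ->.
rewrite normrM (ger0_norm t0) dp.
have hc : 0 <= c <= 1 by rewrite c0 (le_trans ct).
by rewrite (le_trans _ (IH' c hc)) // ler_piMr.
Qed.

Lemma taylor m phi x v K : smooth m phi ->
  (forall t, 0 <= t <= 1 -> `|Dr phi (nseq m v) (x + t *: v)| <= K) ->
  `|phi (x + v) - \sum_(k < m) (k`!%:R)^-1 * Dr phi (nseq k v) x| <= K.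
Proof.
move=> h hK.
have hg k (t : R) : (k < m)%N -> is_derive t 1 (fun t : R => Dr phi (nseq k v) (x + t *: v))
    (Dr phi (nseq k.+1 v) (x + t *: v)).
  move=> hk; have hs : smooth (size (nseq k v)).+1 phi by rewrite size_nseq; exact: Cbd_le h.
  have hd := smooth_Dr_differentiable (x + t *: v) hs.
  by rewrite -[X in is_derive _ _ _ X](diff_Dr _ _ hs); exact: (line_is_derive hd).
have := @taylor_1d m (fun k t => Dr phi (nseq k v) (x + t *: v)) K hg hK 1.
rewrite /= scale1r horner_poly ler01 lexx => /(_ isT).
by rewrite (eq_bigr (fun k : 'I_m => (k`!%:R)^-1 * Dr phi (nseq k v) x)) // => k _;
  rewrite expr1n mulr1 scale0r addr0 mulrC.
Qed.

End HigherDifferentials.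

(** * The operators Gamma_w *)

Notation coordf j := (fun y => y 0 j).

(* The coefficient F_w of the Euler scheme, as a vector of scalar iterated
   derivatives of the coordinate functions. *)
Definition Fvec (R : realType) (d n : nat) (f : 'I_d -> 'rV[R]_n -> 'rV[R]_n) (w : word d)
  (x : 'rV[R]_n) : 'rV[R]_n := \row_j Gamma f w (coordf j : 'rV[R]_n -> R) x.

Notation Cbdv k D F := (forall j, Cbd k D (fun i x => F i x 0 j)).

Lemma blocks_size (A : eqType) (w : seq A) P : P \in blocks w ->
  (size P <= size w)%N /\ (forall u, u \in P -> (size u <= size w)%N).
Proof.
elim: w P => [|i w IH] P; first by rewrite inE => /eqP ->.
move=> /flatten_mapP[Q /IH {IH}[h1 h2]]; rewrite inE => /orP[/eqP->|].
  split=> // u; rewrite inE => /orP[/eqP->//|/h2 h]; exact: leqW.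
move=> hP; have e1 : size P = size Q.
  elim: Q P hP {h1 h2} => [|v Q IH] P //=; rewrite inE => /orP[/eqP->//|/mapP[Q' /IH e ->]].
  by rewrite /= e.
have e2 u : u \in P -> exists2 v, v \in Q & (size u <= (size v).+1)%N.
  elim: Q P hP {h1 h2 e1} => [|v Q IH] P //=; rewrite inE => /orP[/eqP->|/mapP[Q' /IH e ->]].
    rewrite inE => /orP[/eqP->|hu]; first by exists v; rewrite ?mem_head.
    by exists u; rewrite ?inE ?hu ?orbT.
  rewrite inE => /orP[/eqP->|/e[u' hu' s]]; first by exists v; rewrite ?mem_head.
  by exists u'; rewrite ?inE ?hu' ?orbT.
split; first by rewrite e1; exact: leqW.
by move=> u /e2[v /h2 hv] /leq_trans; apply.
Qed.

Section GammaCalculus.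
Variables (R : realType) (d n : nat) (f : 'I_d -> 'rV[R]_n -> 'rV[R]_n).
Implicit Types (phi : 'rV[R]_n -> R) (x v : 'rV[R]_n) (w : word d).

Lemma Gamma_cons i w phi x :
  Gamma f (i :: w) phi x = \sum_j f i x 0 j * pd j (Gamma f w phi) x.
Proof. exact: diff_pd. Qed.

Lemma Gamma_cat (U : normedModType R) u w (phi : 'rV[R]_n -> U) :
  Gamma f (u ++ w) phi = Gamma f u (Gamma f w phi).
Proof. by rewrite /Gamma foldr_cat. Qed.

Lemma Gamma1_coord i j : Gamma f [:: i] (coordf j : 'rV[R]_n -> R) = fun x => f i x 0 j.
Proof. by apply/funext => x; exact: diff_rV_coord. Qed.

Lemma Gamma_rcons_coord w i j :
  Gamma f (rcons w i) (coordf j : 'rV[R]_n -> R) = Gamma f w (fun x => f i x 0 j).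
Proof. by rewrite -cats1 Gamma_cat Gamma1_coord. Qed.

Lemma Cbd_Gamma K k D I (phi : I -> 'rV[R]_n -> R) w : Cbdv K D f ->
  (size w + k <= K.+1)%N -> Cbd (size w + k) D phi -> Cbd k D (fun i => Gamma f w (phi i)).
Proof.
move=> hf; elim: w k => [|i w IH] k //= hk h.
have -> : (fun l => Gamma f (i :: w) (phi l)) =
   (fun l x => \sum_j f i x 0 j * pd j (Gamma f w (phi l)) x).
  by apply/funext => l; apply/funext => x; rewrite Gamma_cons.
have hw : Cbd k.+1 D (fun l => Gamma f w (phi l)).
  by apply: IH; rewrite addnS.
apply: (@Cbd_sum _ _ k D I _ _ _ (fun j l x => f i x 0 j * pd j (Gamma f w (phi l)) x)) => j.
apply: Cbd_mul; last exact: (Cbd_pd j hw).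
apply: (Cbd_reindex (fun _ : I => i) (phi := fun i x => f i x 0 j)).
by apply: (Cbd_le (k := K)) => //; lia.
Qed.

Lemma smooth_coord k j : smooth k (coordf j : 'rV[R]_n -> R).
Proof.
have D0 (phi : 'rV[R]_n -> R) : exists M, forall (i : unit) x,
    (set0 : set 'rV[R]_n) x -> `|phi x| <= M by exists 0.
case: k => [|k]; split=> //.
  by move=> _ x; apply: differentiable_continuous; exact: differentiable_rV_coord.
split=> [_ x|l]; first exact: differentiable_rV_coord.
have -> : (fun _ : unit => pd l (coordf j : 'rV[R]_n -> R)) =
   (fun=> fun=> (delta_mx 0 l : 'rV[R]_n) 0 j).
  by apply/funext => t; apply/funext => x; exact: diff_rV_coord.
exact: (Cbd_const _ _ (M := `|(delta_mx 0 l : 'rV[R]_n) 0 j|)).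
Qed.

Lemma Cbdv_smooth K D : Cbdv K D f -> Cbdv K set0 f.
Proof. by move=> h j; apply: (Cbd_sub (D := D)). Qed.

Lemma Cbd_Fvec K k D w j : Cbdv K D f -> w != [::] -> (size w + k <= K.+1)%N ->
  Cbd k D (fun _ : unit => fun x => Fvec f w x 0 j).
Proof.
move=> hf; case/lastP: w => // w i _; rewrite size_rcons addSn ltnS => hk.
have -> : (fun x => Fvec f (rcons w i) x 0 j) = Gamma f w (fun x => f i x 0 j).
  by apply/funext => x; rewrite mxE Gamma_rcons_coord.
apply: (Cbd_Gamma (K := K) (phi := fun _ : unit => fun x => f i x 0 j)) => //.
  exact: leqW.
apply: (Cbd_le hk).
exact: (Cbd_reindex (fun _ : unit => i) (hf j)).
Qed.

Lemma smooth_Fvec K k w j : Cbdv K set0 f -> (size w + k <= K.+1)%N ->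
  smooth k (fun x => Fvec f w x 0 j).
Proof.
case: (eqVneq w [::]) => [-> _ _|ne h hk]; last exact: Cbd_Fvec hk.
have -> : (fun x => Fvec f [::] x 0 j) = coordf j by apply/funext => x; rewrite mxE.
exact: smooth_coord.
Qed.

Lemma Fvec_differentiable K w x : Cbdv K set0 f -> (size w <= K)%N ->
  differentiable (Fvec f w) x.
Proof.
move=> h hw; apply: differentiable_coords => j.
by apply: (smooth_differentiable (k := 0)); apply: (smooth_Fvec (K := K)) => //; lia.
Qed.

Lemma Fvec_nil x : Fvec f [::] x = x.
Proof. by apply/rowP => j; rewrite mxE. Qed.

Lemma Fvec1 i x : Fvec f [:: i] x = f i x.
Proof. by apply/rowP => j; rewrite mxE Gamma1_coord. Qed.

Lemma Fvec_coord w j : (fun x => Fvec f w x 0 j) = Gamma f w (coordf j : 'rV[R]_n -> R).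
Proof. by apply/funext => x; rewrite mxE. Qed.

Lemma diff_Fvec K i w x : Cbdv K set0 f -> (size w <= K)%N ->
  'd (Fvec f w) x (f i x) = Fvec f (i :: w) x.
Proof.
move=> h hw; apply/rowP => j; apply: (etrans (diff_coord _ _ (Fvec_differentiable x h hw))).
by rewrite Fvec_coord mxE.
Qed.

(** Leibniz rule along f_i for D^k phi(F_u1, .., F_uk). The derivative falls either on phi, which
    creates the block [[:: i]] because F_i = f_i, or on some F_u, which becomes F_(iu): this is
    exactly the recursion that defines [blocks]. *)
Lemma diff_Dr_Fvec K phi (P : seq (word d)) i x : Cbdv K set0 f ->
  smooth (size P).+1 phi -> (forall u, u \in P -> (size u <= K)%N) ->
  differentiable (fun y => Dr phi [seq Fvec f u y | u <- P] y) x /\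
  'd (fun y => Dr phi [seq Fvec f u y | u <- P] y) x (f i x)
  = \sum_(Q <- ([:: i] :: P) :: head_extensions i P) Dr phi [seq Fvec f u x | u <- Q] x.
Proof.
move=> hf; elim: P phi => [|u P IH] phi hphi hP.
  rewrite big_seq1; split; first exact: smooth_differentiable hphi.
  apply: (etrans (diff_pd _ _ _)); apply: eq_bigr => j _.
  by rewrite Fvec1.
have hu : (size u <= K)%N by apply: hP; rewrite mem_head.
have hP' u0 : u0 \in P -> (size u0 <= K)%N by move=> h; apply: hP; rewrite inE h orbT.
have {}IH j := IH (pd j phi) (smooth_pd j hphi) hP'.
pose H j y := Dr (pd j phi) [seq Fvec f u y | u <- P] y.
have dF j : differentiable (fun y => Fvec f u y 0 j) x.
  by apply: differentiable_coordE; exact: Fvec_differentiable hu.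
have dH j : differentiable (fun y => Fvec f u y 0 j * H j y) x.
  by apply: differentiable_mul => //; exact: (IH j).1.
split; first by apply: (@differentiable_bigsum _ _ _ _ _ (fun j y => Fvec f u y 0 j * H j y)).
apply: (etrans (@diff_bigsum _ _ _ _ xpredT (fun j y => Fvec f u y 0 j * H j y) x _ (fun j _ => dH j))).
rewrite 2!big_cons /= big_map.
rewrite -/(Dr phi (Fvec f [:: i] x :: Fvec f u x :: [seq Fvec f u0 x | u0 <- P]) x).
rewrite (Dr_swap (k := size P)) /=; last exact: hphi.
rewrite addrCA exchange_big /= -!big_split /=; apply: eq_bigr => j _.
apply: (etrans (diff_mul _ (dF j) (IH j).1)).
rewrite (IH j).2 big_cons [LHS]addrC mulrDr.
congr (_ + (_ + _)); last exact: mulr_sumr.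
rewrite mulrC; congr (_ * _).
by rewrite -(diff_Fvec _ _ hf hu); apply/esym; apply: diff_coord; exact: Fvec_differentiable hu.
Qed.

(** Faa di Bruno's formula for iterated derivatives along vector fields, obtained by applying the
    Leibniz rule one letter at a time. *)
Lemma Gamma_blocks K w phi x : Cbdv K set0 f -> (size w <= K.+1)%N -> smooth (size w) phi ->
  Gamma f w phi x = \sum_(P <- blocks w) Dr phi [seq Fvec f u x | u <- P] x.
Proof.
move=> hf; elim: w x => [|i w IH] x hw hphi; first by rewrite /= big_seq1.
have e : Gamma f w phi = fun y => \sum_(P <- blocks w | P \in blocks w)
    Dr phi [seq Fvec f u y | u <- P] y.
  by apply/funext => y; rewrite IH -?big_seq //; [exact: ltnW|exact: CbdW].
have step P : P \in blocks w -> differentiable (fun y => Dr phi [seq Fvec f u y | u <- P] y) x /\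
  'd (fun y => Dr phi [seq Fvec f u y | u <- P] y) x (f i x)
  = \sum_(Q <- ([:: i] :: P) :: head_extensions i P) Dr phi [seq Fvec f u x | u <- Q] x.
  move=> /blocks_size[h1 h2]; apply: (diff_Dr_Fvec _ _ hf).
    by apply: (Cbd_le _ hphi); rewrite ltnS.
  by move=> u /h2 /leq_trans; apply.
rewrite /= sum_flatten_map big_seq e.
apply: (etrans (@diff_bigsum _ _ _ _ (fun P => P \in blocks w)
  (fun P y => Dr phi [seq Fvec f u y | u <- P] y) x _ (fun P hP => (step P hP).1))).
by apply: eq_bigr => P hP; rewrite (step P hP).2.
Qed.

Lemma Gamma_coord K w (phi : 'rV[R]_n -> 'rV[R]_n) x j : Cbdv K set0 f -> (size w <= K.+1)%N ->
  (forall l, smooth (size w) (fun y => phi y 0 l)) ->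
  Gamma f w phi x 0 j = Gamma f w (fun y => phi y 0 j) x.
Proof.
move=> hf; elim: w x j => [|i w IH] x j hw hphi //.
have hphi' l : smooth (size w) (fun y => phi y 0 l) by exact: CbdW.
have e l : (fun y => Gamma f w phi y 0 l) = Gamma f w (fun y => phi y 0 l).
  by apply/funext => y; apply: IH => //; exact: ltnW.
have dG : differentiable (Gamma f w phi) x.
  apply: differentiable_coords => l; rewrite e.
  apply: (smooth_differentiable (k := 0)).
  by apply: (Cbd_Gamma (K := K) (phi := fun _ : unit => fun y => phi y 0 l)) => //; rewrite addn1.
by apply: (etrans (diff_coord _ _ dG)); rewrite e.
Qed.

Lemma Fvf_Fvec K w x : Cbdv K set0 f -> (size w <= K.+1)%N -> Fvf f w x = Fvec f w x.
Proof.
move=> hf hw; apply/rowP => j; rewrite mxE /Fvf (Gamma_coord (K := K)) // => l.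
exact: smooth_coord.
Qed.

End GammaCalculus.

(** * The composition formula as an iterated derivative *)

Section LiftFormula.
Variables (R : realType) (d n : nat) (f : 'I_d -> 'rV[R]_n -> 'rV[R]_n).

Lemma Dk_coord (phi : 'rV[R]_n -> 'rV[R]_n) vs x j :
  (forall l, smooth (size vs) (fun y => phi y 0 l)) ->
  Dk phi vs x 0 j = Dr (fun y => phi y 0 j) vs x.
Proof.
elim: vs x j => [|v vs IH] x j h //.
have h' l : smooth (size vs) (fun y => phi y 0 l) by exact: CbdW.
have e l : (fun y => Dk phi vs y 0 l) = Dr (fun y => phi y 0 l) vs.
  by apply/funext => y; apply: IH.
have dG : differentiable (Dk phi vs) x.
  by apply: differentiable_coords => l; rewrite e; exact: smooth_Dr_differentiable.
by apply: (etrans (diff_coord _ _ dG)); rewrite e; exact: diff_Dr.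
Qed.

(** On a path whose coefficients are F_u(x), the composition formula is Faa di Bruno's formula with
    ordered blocks and weights 1/k!. *)
Lemma lift_Gamma K N (phi : 'rV[R]_n -> 'rV[R]_n) (X : word d -> 'rV[R]_n) w x :
  Cbdv K set0 f -> (size w <= K.+1)%N -> (size w < N)%N ->
  (forall l, smooth (size w) (fun y => phi y 0 l)) ->
  (forall u, (size u <= size w)%N -> X u = Fvec f u x) ->
  lift N phi X w = Gamma f w phi x.
Proof.
move=> hf hwK hwN hphi hX; rewrite /lift leqNgt hwN /=.
have X0 : X [::] = x by rewrite hX // Fvec_nil.
case: eqP => [->|/eqP wne]; first by rewrite X0.
apply/rowP => j; rewrite (Gamma_coord _ _ hf) // (Gamma_blocks _ hf) //.
rewrite summxE X0.
pose phij y := phi y 0 j.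
(* The cut-off makes G symmetric: only |w| derivatives of [phi] are available, and beyond that order
   D^k phi is not known to be symmetric. *)
pose G (us : seq (word d)) := if (size us <= size w)%N
  then Dr phij [seq X u | u <- us] x else 0.
have hG : front_invariant G.
  move=> us1 u us2; rewrite /G /= !size_cat /= addnS; case: ifP => // hs.
  rewrite map_cat /= Dr_front ?size_map ?map_cat //.
  exact: (Cbd_le hs (hphi j)).
rewrite (eq_big_seq (fun P => G P)); last first.
  move=> P /blocks_size[h1 h2]; rewrite /G h1; congr (Dr _ _ _).
  by apply/eq_in_map => u /h2 /hX.
rewrite -(sum_shuffle_coefs (leqnn _) (leqnn _) hG) -(big_mkord xpredT (fun k => (k`!%:R)^-1 *
     (\sum_(u : k.-tuple ((size w).-bseq 'I_d) | [::] \notin [seq bseqval v | v <- tval u])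
       (count_mem w (shuffles [seq bseqval v | v <- tval u]))%:R
         * G [seq bseqval v | v <- tval u]))).
(* [lift] starts at k = 1; the term k = 0 vanishes because the empty product of words does not
   contain the nonempty w. *)
rewrite [RHS]big_ltn // [X in _ = _ * X + _]big1 ?mulr0 ?add0r; last first.
  move=> u _; rewrite tuple0 /= addn0 eq_sym (negbTE wne) mul0r //.
apply: eq_big_nat => k /andP[k0 kw]; rewrite !mxE; congr (_ * _).
rewrite summxE; apply: eq_bigr => u _; rewrite !mxE; congr (_ * _).
rewrite /G size_map size_tuple -ltnS kw -map_comp Dk_coord // => l.
by rewrite size_map size_tuple; apply: (Cbd_le _ (hphi l)); rewrite -ltnS.
Qed.

End LiftFormula.

(** * Bounded subsets of C^k_b as uniformly bounded families *)

Section CkFamilies.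
Variables (R : realType) (n : nat).

Lemma Dk_rcons (U : normedModType R) (phi : 'rV[R]_n -> U) vs v :
  Dk phi (rcons vs v) = Dk (fun x => 'd phi x v) vs.
Proof. by elim: vs => [|u vs IH]; [|rewrite rcons_cons /= IH]. Qed.

Lemma Ck_Cbd k M I (phi : I -> 'rV[R]_n -> R) :
  (forall i, Ck k (phi i) /\ derivatives_le k M (phi i)) -> Cbd k setT phi.
Proof.
elim: k I phi => [|k IH] I phi h.
  split; first by exists M => i x _; exact: ((h i).2 [::] x).
  by move=> i; exact: (h i).1.
split; first by exists M => i x _; exact: ((h i).2 [::] x).
split=> [i x|j]; first exact: (h i).1.1.
apply: IH => i; split; first exact: (h i).1.2.
move=> vs x hs hv; rewrite -Dk_rcons; apply: (h i).2; first by rewrite size_rcons.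
by rewrite all_rcons hv norm_delta_mx.
Qed.

Lemma smooth_Ck k (phi : 'rV[R]_n -> R) : smooth k phi -> Ck k phi.
Proof.
elim: k phi => [|k IH] phi h; first exact: smooth_continuous h.
split=> [x|v]; first exact: smooth_differentiable h.
exact: IH (Cbd_diff_dir v h).
Qed.

Lemma Cbd_derivatives_le k I (phi : I -> 'rV[R]_n -> R) : Cbd k setT phi ->
  exists M, forall i, Ck k (phi i) /\ derivatives_le k M (phi i).
Proof.
move=> h; have [M [M0 hM]] := Dr_bound h; exists M => i.
have hi := Cbd_smooth i h.
split; first exact: smooth_Ck.
move=> vs x hs /allP hv; rewrite Dr_Dk; last exact: (Cbd_le hs hi).
apply: (le_trans (hM i vs x hs Logic.I)); apply: ler_piMr => //.
suff /andP[] : 0 <= \prod_(v <- vs) `|v| <= 1 by [].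
rewrite big_seq; elim/big_ind: _ => [|a b /andP[a0 a1] /andP[b0 b1]|v /hv v1].
- by rewrite ler01 lexx.
- by rewrite mulr_ge0 // mulr_ile1.
by rewrite normr_ge0.
Qed.

Lemma Ckb_coord k (F : 'rV[R]_n -> 'rV[R]_n) j : Ckb k F -> Ckb k (fun x => F x 0 j).
Proof.
move=> [h1 [M h2]]; suff [hC hD] : Ck k (fun x => F x 0 j) /\
    forall vs x, (size vs <= k)%N -> Dk (fun x => F x 0 j) vs x = Dk F vs x 0 j.
  split=> //; exists M => vs x hs hv; rewrite hD //.
  by rewrite (le_trans (norm_coord_le _ _)) // h2.
elim: k F h1 {h2} => [|k IH] F h1.
  split=> [x|[]//]; apply: (@continuous_comp _ _ _ F (fun y : 'rV[R]_n => y 0 j)); first exact: h1.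
  exact: coord_continuous.
have [d1 hv] := h1.
have e v : (fun x => 'd (fun x => F x 0 j) x v) = fun x => 'd F x v 0 j.
  by apply/funext => x; apply/esym; apply: diff_coord.
split.
  split=> [x|v]; first exact: differentiable_coordE.
  by rewrite e; exact: (IH _ (hv v)).1.
move=> vs; case/lastP: vs => [//|vs v] x; rewrite size_rcons ltnS => hs.
by rewrite !Dk_rcons e; exact: (IH _ (hv v)).2.
Qed.

Lemma Ckb_Cbd k (phi : 'rV[R]_n -> R) : Ckb k phi -> Cbd k setT (fun _ : unit => phi).
Proof. by move=> [h [M hM]]; apply: (Ck_Cbd (M := M)). Qed.

Lemma Ckb_Cbdv d k (f : 'I_d -> 'rV[R]_n -> 'rV[R]_n) : (forall i, Ckb k (f i)) -> Cbdv k setT f.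
Proof.
move=> h j.
have /choice[M hM] : forall i, exists M, Ck k (fun x => f i x 0 j) /\ derivatives_le k M (fun x => f i x 0 j).
  by move=> i; have [h1 [M hM]] := Ckb_coord j (h i); exists M.
apply: (Ck_Cbd (M := \sum_i `|M i|)) => i; split; first exact: (hM i).1.
move=> vs x hs hv; apply: (le_trans ((hM i).2 vs x hs hv)).
rewrite (le_trans (ler_norm _)) // (bigD1 i) //= lerDl; exact: sumr_ge0.
Qed.

End CkFamilies.

(** * Expansion along the Euler maps *)

(** What the Euler scheme uses of the increments of W, at ordered times. The bounds are written as
    integer powers of (t - s)^gamma so that homogeneity is counted in natural numbers, and the same
    record serves the tangent systems. *)
Record rough_increments (R : realType) (d N : nat) (T gamma C : R)
    (w : R -> R -> word d -> R) : Prop := RoughIncrements {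
  ri_ge0 : 0 <= C;
  ri_nil : forall s t, 0 <= s -> s <= t -> t <= T -> w s t [::] = 1;
  ri_refl : forall s v, 0 <= s <= T -> w s s v = (v == [::])%:R;
  ri_chen : forall s t u v, 0 <= s -> s <= t -> t <= u -> u <= T -> (size v <= N)%N ->
     w s u v = \sum_(p <- dec v) w s t p.1 * w t u p.2;
  ri_shuffle : forall s t u v, 0 <= s -> s <= t -> t <= T -> (size u + size v <= N)%N ->
     \sum_(x <- shuffle u v) w s t x = w s t u * w s t v;
  ri_bound : forall s t v, 0 <= s -> s <= t -> t <= T -> (size v <= N)%N ->
     `|w s t v| <= C * ((t - s) `^ gamma) ^+ size v }.

Lemma fin_bound (R : realType) (X : Type) (I : finType) (P : pred I) (D : set X) (g : I -> X -> R) :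
  (forall i, P i -> exists M, forall x, D x -> `|g i x| <= M) ->
  exists M, 0 <= M /\ forall i x, P i -> D x -> `|g i x| <= M.
Proof.
move=> h; have /choice[M hM] : forall i, exists M, P i -> forall x, D x -> `|g i x| <= M.
  move=> i; case: (boolP (P i)) => hi; last by exists 0.
  by have [M hM] := h i hi; exists M.
exists (\sum_i `|M i|); split; first exact: sumr_ge0.
move=> i x hi Dx; rewrite (le_trans (hM i hi x Dx)) // (le_trans (ler_norm _)) //.
by rewrite (bigD1 i) //= lerDl; exact: sumr_ge0.
Qed.

Definition euler (R : realType) (d n N : nat) (f : 'I_d -> 'rV[R]_n -> 'rV[R]_n)
    (w : R -> R -> word d -> R) (s t : R) (x : 'rV[R]_n) : 'rV[R]_n :=
  \sum_(v : N.-bseq 'I_d) w s t v *: Fvec f v x.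

Lemma prod_seq_le (R : realType) (I : Type) (s : seq I) (F : I -> R) (b : R) : 0 <= b ->
  (forall i, 0 <= F i) -> all (fun i => F i <= b) s -> \prod_(i <- s) F i <= b ^+ size s.
Proof.
move=> b0 F0; elim: s => [|i s IH] /=; first by rewrite big_nil.
by move=> /andP[h1 h2]; rewrite big_cons exprS ler_pM // ?prodr_ge0 // IH.
Qed.

Section Euler.
Variables (R : realType) (d n N : nat) (T gamma Cw : R).
Variables (w : R -> R -> word d -> R) (f : 'I_d -> 'rV[R]_n -> 'rV[R]_n).
Hypothesis hw : rough_increments N T gamma Cw w.
Local Notation y := (euler N f w).
Local Notation q s t := ((t - s) `^ gamma).

Lemma shuffles_size (us : seq (word d)) v : v \in shuffles us ->
  size v = sumn [seq size u | u <- us].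
Proof.
elim: us v => [|u us IH] v; first by rewrite inE => /eqP->.
by move=> /flatten_mapP[v' /IH e /size_shuffle ->]; rewrite e.
Qed.

(** The shuffle relations linearise products of coordinates of W_st; this is how powers of y_st(x) -
    x in a Taylor expansion become linear in W_st. *)
Lemma prod_shuffles s t (us : seq (word d)) : 0 <= s -> s <= t -> t <= T ->
  (sumn [seq size u | u <- us] <= N)%N ->
  \prod_(u <- us) w s t u = \sum_(x <- shuffles us) w s t x.
Proof.
move=> s0 st tT; elim: us => [|u us IH] /= hN.
  by rewrite big_nil big_seq1 (ri_nil hw).
rewrite sum_shuffles_cons big_cons IH ?mulr_sumr; last by apply: leq_trans hN; rewrite leq_addl.
apply: eq_big_seq => v hv; rewrite (ri_shuffle hw) //.
by rewrite (shuffles_size hv).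
Qed.

Lemma euler_split s t x : 0 <= s -> s <= t -> t <= T ->
  y s t x = x + \sum_(v : N.-bseq 'I_d | v != [::] :> word d) w s t v *: Fvec f v x.
Proof.
move=> s0 st tT.
by rewrite /euler (sum_bseq_nil _ (fun v => w s t v *: Fvec f v x)) (ri_nil hw) // scale1r Fvec_nil.
Qed.

Lemma euler_refl s x : 0 <= s <= T -> y s s x = x.
Proof.
move=> /[dup] hs /andP[s0 sT]; rewrite euler_split // big1 ?addr0 // => v hv.
by rewrite (ri_refl hw) // (negbTE hv) scale0r.
Qed.

Lemma euler_coord s t x j : y s t x 0 j = \sum_(v : N.-bseq 'I_d) w s t v * Fvec f v x 0 j.
Proof. by rewrite summxE; apply: eq_bigr => v _; rewrite mxE. Qed.

Lemma q_le1 s t : 0 <= gamma -> s <= t -> t - s <= 1 -> 0 <= q s t <= 1.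
Proof.
move=> g0 st h; rewrite powR_ge0 /=.
apply: (@le_trans _ _ (1 `^ gamma)); last by rewrite powR1.
by apply: ge0_ler_powR; rewrite ?nnegrE ?subr_ge0 // ler01.
Qed.

Variable D : set 'rV[R]_n.
Hypothesis gamma_ge0 : 0 <= gamma.
Hypothesis hf : Cbdv N D f.

Lemma Fvec_bound : exists B, 0 <= B /\
  forall v x, v != [::] -> (size v <= N)%N -> D x -> `|Fvec f v x| <= B.
Proof.
have [B [B0 hB]] : exists B, 0 <= B /\ forall (p : N.-bseq 'I_d * 'I_n) x,
    p.1 != [::] :> word d -> D x -> `|Fvec f p.1 x 0 p.2| <= B.
  apply: (fin_bound (P := fun p : N.-bseq 'I_d * 'I_n => p.1 != [::] :> word d)
     (g := fun p x => Fvec f p.1 x 0 p.2)) => -[v j] /= hv.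
  have [M [_ hM]] := Cbd_bounded (Cbd_Fvec (k := 0) j hf hv (leqW (etrans (congr2 leq (addn0 _) erefl) (size_bseq v)))).
  by exists M => x; exact: (hM tt).
exists B; split=> // v x hv hs Dx; apply: norm_rV_le => // j.
exact: (hB (Bseq hs, j) x).
Qed.

Lemma euler_move : exists C, 0 <= C /\ forall s t x, 0 <= s -> s <= t -> t <= T -> t - s <= 1 ->
  D x -> `|y s t x - x| <= C * q s t.
Proof.
have [B [B0 hB]] := Fvec_bound; have C0 := ri_ge0 hw.
exists (\sum_(v : N.-bseq 'I_d) Cw * B); split; first by apply: sumr_ge0 => v _; exact: mulr_ge0.
move=> s t x s0 st tT ts Dx; rewrite euler_split // addrC addKr.
have /andP[q0 q1] := q_le1 gamma_ge0 st ts.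
rewrite (le_trans (ler_norm_sum _ _ _)) // mulr_suml [leRHS](bigID (fun v : N.-bseq 'I_d => v != [::] :> word d)) /=.
rewrite -[leLHS]addr0 lerD ?sumr_ge0 // => [|v _]; last by rewrite !mulr_ge0.
apply: ler_sum => v hv; rewrite normrZ mulrAC ler_pM ?hB ?size_bseq //.
apply: (le_trans (ri_bound hw s0 st tT (size_bseq v))); apply: ler_wpM2l => //.
case: (bseqval v) hv => // a v' _; rewrite exprS; apply: ler_piMr => //.
exact: exprn_ile1.
Qed.

(** In the Taylor polynomial at x, the tuples of words of total length at most M reassemble into the
    sum of the Gamma_v by Faa di Bruno's formula; the remaining ones have total length above M and
    are O(q^(M + 1)). The set D1 contains the unit neighbourhood of D, hence the segment from x to
    y_st(x). An order M below N is needed for expanding F_v or Gamma_v phi with v nonempty. *)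
Lemma euler_expansion (D1 : set 'rV[R]_n) I (g : I -> 'rV[R]_n -> R) M :
  (M <= N)%N -> (forall x v, D x -> `|v| <= 1 -> D1 (x + v)) ->
  Cbd M.+1 D1 g ->
  exists C, 0 <= C /\ forall i s t x, 0 <= s -> s <= t -> t <= T -> t - s <= 1 -> D x ->
    `|y s t x - x| <= 1 ->
    `|g i (y s t x) - \sum_(v : M.-bseq 'I_d) w s t v * Gamma f v (g i) x|
    <= C * q s t ^+ M.+1.
Proof.
move=> MN DD1 hg.
have [B [B0 hB]] := Fvec_bound; have C0 := ri_ge0 hw.
have [Cd [Cd0 hCd]] := euler_move.
have [Mg [Mg0 hMg]] := Dr_bound hg.
exists (Mg * Cd ^+ M.+1 + \sum_(k < M.+1) \sum_(u : k.-tuple (N.-bseq 'I_d)) Cw ^+ k * (Mg * B ^+ k)).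
split.
  rewrite addr_ge0 ?mulr_ge0 ?exprn_ge0 //.
  by do 2!(apply: sumr_ge0 => ? _); rewrite !mulr_ge0 ?exprn_ge0.
move=> i s t x s0 st tT ts Dx hy1.
have /andP[q0 q1] := q_le1 gamma_ge0 st ts.
set Dx0 := y s t x - x in hy1 *.
have -> : y s t x = x + Dx0 by rewrite /Dx0 addrC subrK.
have sg : smooth M.+1 (g i) by exact: Cbd_smooth hg.
have D1x : D1 x by rewrite -[x]addr0; apply: DD1; rewrite ?normr0.
have tay : `|g i (x + Dx0) - \sum_(k < M.+1) (k`!%:R)^-1 * Dr (g i) (nseq k Dx0) x|
    <= Mg * Cd ^+ M.+1 * q s t ^+ M.+1.
  apply: (taylor sg) => a /andP[a0 a1].
  have D1a : D1 (x + a *: Dx0).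
    by apply: DD1 => //; rewrite normrZ ger0_norm // mulr_ile1.
  apply: (le_trans (hMg i _ _ _ D1a)); rewrite ?size_nseq //.
  rewrite -mulrA; apply: ler_wpM2l => //; rewrite -exprMn.
  have := prod_seq_le (s := nseq M.+1 Dx0) (F := fun v => `|v|) (b := Cd * q s t).
  rewrite size_nseq; apply=> //; first exact: mulr_ge0.
  by apply/allP => v /nseqP[-> _]; exact: hCd.
(* The Taylor polynomial minus the expected expansion is carried by the tuples of total length
   greater than M. *)
have key : \sum_(k < M.+1) (k`!%:R)^-1 * Dr (g i) (nseq k Dx0) x -
   \sum_(v : M.-bseq 'I_d) w s t v * Gamma f v (g i) x =
   \sum_(k < M.+1) (k`!%:R)^-1 * \sum_(u : k.-tuple (N.-bseq 'I_d) |
       ([::] \notin [seq bseqval v | v <- tval u]) && (M < sumn [seq size (bseqval v) | v <- tval u])%N)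
     (\prod_(v <- u) w s t v) * Dr (g i) [seq Fvec f (bseqval v) x | v <- u] x.
  pose G (us : seq (word d)) := if (size us <= M)%N
    then Dr (g i) [seq Fvec f u x | u <- us] x else 0.
  have hG : front_invariant G.
    move=> us1 u us2; rewrite /G /= !size_cat /= addnS; case: ifP => // hs.
    rewrite map_cat /= Dr_front ?size_map ?map_cat //.
    by apply: (Cbd_le _ sg); apply: leqW.
  (* Each Gamma_v is written with shuffle coefficients; after exchanging the sums, a tuple collects
     the coordinates of W_st over all shuffles of its words. *)
  have e2 : \sum_(v : M.-bseq 'I_d) w s t v * Gamma f v (g i) x =
     \sum_(k < M.+1) (k`!%:R)^-1 * \sum_(u : k.-tuple (N.-bseq 'I_d) |
       [::] \notin [seq bseqval v | v <- tval u])
       (\sum_(z <- shuffles [seq bseqval v | v <- tval u] | (size z <= M)%N) w s t z)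
       * G [seq bseqval v | v <- tval u].
    under [RHS]eq_bigr => k _.
      under eq_bigr do rewrite sum_seq_words mulr_suml.
      rewrite exchange_big /= mulr_sumr.
      over.
    rewrite [RHS]exchange_big /=; apply: eq_bigr => v _.
    have hv := size_bseq v.
    rewrite (Gamma_blocks _ (Cbdv_smooth hf)); last 2 first.
    - by rewrite (leq_trans hv) // leqW.
    - by apply: (Cbd_le _ sg); exact: leqW.
    rewrite (eq_big_seq (fun P => G P)); last first.
      by move=> P /blocks_size[h1 h2]; rewrite /G (leq_trans h1).
    rewrite -(sum_shuffle_coefs (leq_trans hv MN) hv hG) mulr_sumr.
    apply: eq_bigr => k _; rewrite mulrCA; congr (_ * _); rewrite mulr_sumr.
    by apply: eq_bigr => u _; rewrite mulrA [w s t v * _]mulrC.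
  rewrite e2 -sumrB; apply: eq_bigr => k _; rewrite -mulrBr; congr (_ * _).
  have eD : Dx0 = \sum_(v : N.-bseq 'I_d | v != [::] :> word d) w s t v *: Fvec f v x.
    by rewrite /Dx0 euler_split // addrC addKr.
  rewrite eD Dr_multilinear.
  under eq_bigl => u.
    have -> : all (fun v : N.-bseq 'I_d => v != [::] :> word d) u =
       ([::] \notin [seq bseqval v | v <- tval u]).
      by rewrite -has_pred1 has_map -all_predC.
    over.
  rewrite -sumrB [RHS]big_mkcondr /=; apply: eq_bigr => u hu.
  have hk : (size [seq bseqval v | v <- tval u] <= M)%N.
    by rewrite size_map size_tuple -ltnS.
  rewrite /G hk -map_comp /=.
  have -> : \sum_(z <- shuffles [seq bseqval v | v <- tval u] | (size z <= M)%N) w s t z =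
     if (sumn [seq size (bseqval v) | v <- tval u] <= M)%N then \prod_(v <- u) w s t v else 0.
    case: ifPn => hs.
      rewrite big_seq_cond (eq_bigl (fun z => z \in shuffles [seq bseqval v | v <- tval u])).
        rewrite -big_seq -prod_shuffles ?big_map // -map_comp.
        exact: leq_trans hs MN.
      move=> z; apply/andb_idr => /shuffles_size ->; by rewrite -map_comp.
    rewrite big_seq_cond big_pred0 // => z; apply/negbTE; apply: contra hs => /andP[/shuffles_size].
    by rewrite -map_comp => ->.
  rewrite ltnNge; case: ifP => _ /=; first by rewrite subrr.
  by rewrite mul0r subr0.
have -> : g i (x + Dx0) - \sum_(v : M.-bseq 'I_d) w s t v * Gamma f v (g i) x =
   (g i (x + Dx0) - \sum_(k < M.+1) (k`!%:R)^-1 * Dr (g i) (nseq k Dx0) x) +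
   (\sum_(k < M.+1) (k`!%:R)^-1 * Dr (g i) (nseq k Dx0) x -
   \sum_(v : M.-bseq 'I_d) w s t v * Gamma f v (g i) x) by rewrite subrKA.
rewrite (le_trans (ler_normD _ _)) // mulrDl lerD // key.
rewrite (le_trans (ler_norm_sum _ _ _)) // mulr_suml; apply: ler_sum => k _.
rewrite normrM ger0_norm ?invr_ge0 //.
apply: (@le_trans _ _ (1 * `|\sum_(u : k.-tuple (N.-bseq 'I_d) |
       ([::] \notin [seq bseqval v | v <- tval u]) && (M < sumn [seq size (bseqval v) | v <- tval u])%N)
     (\prod_(v <- u) w s t v) * Dr (g i) [seq Fvec f (bseqval v) x | v <- u] x|)).
  apply: ler_wpM2r => //; rewrite invf_le1 ?ltr0n ?fact_gt0 //.
  by rewrite ler1n fact_gt0.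
rewrite mul1r (le_trans (ler_norm_sum _ _ _)) // mulr_suml.
rewrite [leRHS](bigID (fun u : k.-tuple (N.-bseq 'I_d) => ([::] \notin [seq bseqval v | v <- tval u]) && (M < sumn [seq size (bseqval v) | v <- tval u])%N)) /=.
rewrite -[leLHS]addr0 lerD //; last first.
  by apply: sumr_ge0 => u _; rewrite !mulr_ge0 ?exprn_ge0.
apply: ler_sum => u /andP[hne hM]; rewrite normrM mulrAC ler_pM //.
  rewrite normr_prod.
  apply: (@le_trans _ _ (Cw ^+ k * q s t ^+ sumn [seq size (bseqval v) | v <- tval u])).
    rewrite -{2}(size_tuple u); elim: (tval u) => [|v vs IH]; first by rewrite big_nil mulr1.
    rewrite big_cons /= exprS exprD mulrACA ler_pM ?prodr_ge0 //.
    exact: (ri_bound hw s0 st tT (size_bseq v)).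
  apply: ler_wpM2l; first exact: exprn_ge0.
  exact: ler_wiXn2l.
apply: (le_trans (hMg i _ x _ D1x)).
  by rewrite size_map size_tuple ltnW.
apply: ler_wpM2l => //.
have := prod_seq_le (s := [seq Fvec f (bseqval v) x | v <- u]) (F := fun v => `|v|) B0.
rewrite size_map size_tuple; apply=> //; apply/allP => z /mapP[v hv ->].
apply: hB => //; last exact: size_bseq.
by apply: contraNneq hne => <-; apply/mapP; exists v.
Qed.

End Euler.

(** * Compositions of Euler maps *)

Section Partitions.
Variable R : realType.
Implicit Types (s t c : R) (p : seq R).

Lemma path_le_last s p : path <%R s p -> s <= last s p.
Proof.
elim: p s => [|a p IH] s //= /andP[sa /IH]; apply: le_trans; exact: ltW.
Qed.

Lemma path_split s p c : path <%R s p -> s <= c -> c < last s p ->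
  exists p1 r p2, p = p1 ++ r :: p2 /\ [/\ last s p1 <= c, c < r,
    path <%R s p1, last s p1 < r & path <%R r p2].
Proof.
elim: p s => [|a p IH] s /=; first by move=> _ sc; rewrite ltNge sc.
move=> /andP[sa hp] sc hc; case: (leP a c) => [ac|ca]; last first.
  by exists [::], a, p.
have [p1 [r [p2 [e [h1 h2 h3 h4 h5]]]]] := IH a hp ac hc.
by exists (a :: p1), r, p2; rewrite /= e sa.
Qed.

End Partitions.

Section Schemes.
Variables (R : realType) (E : Type) (y : R -> R -> E -> E).

Fixpoint scheme (s : R) (p : seq R) (x : E) : E :=
  if p is t :: p' then scheme t p' (y s t x) else x.

Fixpoint stays (D : set E) (s : R) (p : seq R) (x : E) : Prop :=
  D x /\ (if p is t :: p' then stays D t p' (y s t x) else True).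

Lemma scheme_cat s p1 p2 x :
  scheme s (p1 ++ p2) x = scheme (last s p1) p2 (scheme s p1 x).
Proof. by elim: p1 s x => //= a p1 IH s x; exact: IH. Qed.

Lemma stays_start D s p x : stays D s p x -> D x.
Proof. by case: p => [|a p] []. Qed.

Lemma stays_cat D s p1 p2 x : stays D s (p1 ++ p2) x <->
  stays D s p1 x /\ stays D (last s p1) p2 (scheme s p1 x).
Proof.
elim: p1 s x => [|a p1 IH] s x /=.
  by split=> [h|[]//]; split=> //; split=> //; exact: stays_start h.
by split=> [[h /IH[h1 h2]]|[[h h1] h2]]; split=> //; apply/IH.
Qed.

Lemma stays_end D s p x : stays D s p x -> D (scheme s p x).
Proof. by elim: p s x => [|a p IH] s x /= [] // _; exact: IH. Qed.

Lemma stays_setT s p x : stays setT s p x.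
Proof. by elim: p s x => [|a p IH] s x. Qed.

End Schemes.

(* Davie's argument: splitting a partition at the interval containing its
   midpoint, the local errors om(h) contract by the factor kappa < 1/2. *)
Lemma scheme_one_step (R : realType) (E : normedModType R) (y : R -> R -> E -> E)
    (om : R -> R) (T delta kappa eps C L : R) (D K : set E) :
  0 <= eps -> 0 <= C -> 0 <= L ->
  (forall h h', 0 <= h -> h <= h' -> h' <= delta -> 0 <= om h <= om h') ->
  (forall h, 0 <= h -> h <= delta -> om (h / 2) <= kappa * om h) ->
  (forall s x, 0 <= s <= T -> y s s x = x) ->
  (forall s t x x', 0 <= s -> s <= t -> t <= T -> t - s <= delta -> K x -> K x' ->
     `|y s t x - y s t x'| <= (1 + eps) * `|x - x'|) ->
  D `<=` K ->
  (forall s t x, 0 <= s -> s <= t -> t <= T -> t - s <= delta -> D x -> K (y s t x)) ->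
  (forall s t u x, 0 <= s -> s <= t -> t <= u -> u <= T -> u - s <= delta -> D x ->
     `|y t u (y s t x) - y s u x| <= C * om (u - s)) ->
  L * (1 + (1 + eps) ^+ 2) * kappa + C * (2 + eps) <= L ->
  forall s p x, 0 <= s -> path <%R s p -> last s p <= T -> last s p - s <= delta ->
    stays y D s p x ->
    `|scheme y s p x - y s (last s p) x| <= L * om (last s p - s).
Proof.
move=> eps0 C0 L0 om_mono om_half yss ylip DK yK ydef hL s p x.
have [m] := ubnP (size p); elim: m s p x => // m IH s p x hm s0 hp hT hd hst.
case: p hm hp hT hd hst => [|a p] hm hp hT hd hst.
  rewrite /= in hT hd *; rewrite yss ?s0 // subrr normr0.
  have h00 : 0 <= s - s by rewrite subrr.
  by apply: mulr_ge0 => //; have /andP[] := om_mono _ _ h00 (lexx _) hd.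
set t := last s (a :: p) in hT hd *.
have st : s < t.
  move: hp; rewrite /= => /andP[sa /path_le_last]; exact: lt_le_trans.
set h := t - s in hd *.
have h0 : 0 < h by rewrite subr_gt0.
have sc : s <= s + h / 2 by rewrite lerDl divr_ge0 // ltW.
have ct : s + h / 2 < t by rewrite /h; lra.
have [p1 [r [p2 [e [m_le r_gt hp1 m_r hp2]]]]] := path_split hp sc ct.
have et : t = last r p2 by rewrite /t e last_cat.
have rt : r <= t by rewrite et; exact: path_le_last.
have sm := path_le_last hp1; set mm := last s p1 in m_le m_r sm.
have hst' : stays y D s p1 x /\ stays y D mm (r :: p2) (scheme y s p1 x).
  by apply/stays_cat; rewrite -e.
have [st1 [Dz1 st2]] := hst'.
set z1 := scheme y s p1 x in st2 Dz1; set z2 := y mm r z1 in st2.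
have sz : (size p1 < m)%N /\ (size p2 < m)%N.
  by move: hm; rewrite e size_cat /= ltnS => hm; split; apply: leq_trans hm; rewrite addnS ltnS ?leq_addr ?leq_addl.
have Dx := stays_start st1; have Dz2 := stays_start st2.
have omh : 0 <= om h by have /andP[] := om_mono h h (ltW h0) (lexx _) hd.
have small u v : u <= v -> v - u <= h / 2 -> L * om (v - u) <= L * (kappa * om h).
  move=> uv hv; apply: ler_wpM2l => //.
  apply: (le_trans _ (om_half h (ltW h0) hd)).
  have uv0 : 0 <= v - u by rewrite subr_ge0.
  have h2 : h / 2 <= delta by apply: (le_trans _ hd); lra.
  by have /andP[] := om_mono _ _ uv0 hv h2.
have big_ u v : u <= v -> v - u <= h -> C * om (v - u) <= C * om h.
  move=> uv hv; apply: ler_wpM2l => //.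
  have uv0 : 0 <= v - u by rewrite subr_ge0.
  by have /andP[] := om_mono _ _ uv0 hv hd.
have mT : mm <= T by rewrite (le_trans _ hT) // (le_trans (ltW m_r)).
have rT : r <= T := le_trans rt hT.
have r0 : 0 <= r by rewrite (le_trans s0) // (le_trans sm) // ltW.
have m0 : 0 <= mm := le_trans s0 sm.
have sr : s <= r := le_trans sm (ltW m_r).
have d1 : mm - s <= h / 2 by rewrite lerBlDl.
have d2 : t - r <= h / 2 by move: r_gt; rewrite /h; lra.
have hd2 : h / 2 <= delta by apply: (le_trans _ hd); lra.
have dmr : r - mm <= delta by apply: (le_trans _ hd); rewrite /h; lra.
have dsr : r - s <= h by rewrite /h; lra.
have E1 : `|z1 - y s mm x| <= L * (kappa * om h).
  apply: (le_trans (IH s p1 x sz.1 s0 hp1 mT (le_trans d1 hd2) st1)).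
  exact: small.
have Ky1 : K (y s mm x) by apply: yK => //; exact: le_trans hd2.
have E2 : `|z2 - y s r x| <= (1 + eps) * (L * (kappa * om h)) + C * om h.
  rewrite -(subrKA (y mm r (y s mm x))) (le_trans (ler_normD _ _)) // lerD //.
    apply: (le_trans (ylip mm r z1 (y s mm x) m0 (ltW m_r) rT dmr (DK _ Dz1) Ky1)).
    by apply: ler_wpM2l => //; rewrite addr_ge0.
  apply: le_trans (big_ s r sr dsr).
  by apply: ydef => //; [exact: ltW|exact: le_trans hd].
have Kyr : K (y s r x) by apply: yK => //; exact: le_trans hd.
have E3 : `|scheme y r p2 z2 - y r t z2| <= L * (kappa * om h).
  apply: (@le_trans _ _ (L * om (t - r))); last exact: small.
  have := IH r p2 z2 sz.2 r0 hp2; rewrite -et; apply=> //.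
  exact: le_trans hd2.
have E4 : `|y r t z2 - y r t (y s r x)| <=
    (1 + eps) * ((1 + eps) * (L * (kappa * om h)) + C * om h).
  apply: (le_trans (ylip r t z2 (y s r x) r0 rt hT (le_trans d2 hd2) (DK _ Dz2) Kyr)).
  by apply: ler_wpM2l => //; rewrite addr_ge0.
have E5 : `|y r t (y s r x) - y s t x| <= C * om h by exact: ydef.
have -> : scheme y s (a :: p) x = scheme y r p2 z2 by rewrite e scheme_cat.
(* [E3], [E4] and [E5] add up to (L (1 + (1 + eps)^2) kappa + C (2 + eps)) om h, which the
   hypothesis on L bounds by L om h. *)
rewrite -(subrKA (y r t z2)) -[y r t z2 - _](subrKA (y r t (y s r x))).
apply: (le_trans (ler_normD _ _)); apply: (le_trans (lerD E3 (ler_normD _ _))).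
apply: (le_trans (lerD (lexx _) (lerD E4 E5))).
apply: (le_trans _ (ler_wpM2r omh hL)).
by rewrite le_eqVlt; apply/orP; left; apply/eqP; ring.
Qed.

Definition convex_domain (R : realType) (n : nat) (D : set 'rV[R]_n) :=
  forall x x' c, D x -> D x' -> 0 <= c <= 1 -> D (x + c *: (x' - x)).

(* Exhaustions of R^n on which the fields are bounded; trivial for the original
   fields, and with bounded fibres for the fields on the tangent bundle. *)
Record good_domain (R : realType) (n : nat) (D : R -> set 'rV[R]_n) : Prop := GoodDomain {
  gd_mono : forall r r', r <= r' -> D r `<=` D r';
  gd_ball : forall r x v, D r x -> `|v| <= 1 -> D (r + 1) (x + v);
  gd_conv : forall r, convex_domain (D r) }.

Lemma Cbd_lipschitz (R : realType) (n k : nat) (D : set 'rV[R]_n) I (phi : I -> 'rV[R]_n -> R) :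
  convex_domain D -> Cbd k.+1 D phi ->
  exists M, 0 <= M /\ forall i x x', D x -> D x' -> `|phi i x - phi i x'| <= M * `|x - x'|.
Proof.
move=> cD h; have [M [M0 hM]] := Dr_bound h; exists M; split=> // i x x' Dx Dx'.
have [c hc] := mvt_line x' (x - x') (fun z => Cbd_differentiable i z h).
rewrite [x' + _]addrC subrK => ->.
rewrite (diff_pd _ _ _) -/(Dr (phi i) [:: x - x'] _).
have := hM i [:: x - x'] (x' + c *: (x - x')) _ (cD _ _ _ Dx' Dx hc).
by rewrite big_seq1; apply.
Qed.

Lemma powR_small (R : realType) (gamma eta : R) : 0 < gamma -> 0 < eta ->
  exists delta, 0 < delta <= 1 /\ forall h, 0 <= h -> h <= delta -> h `^ gamma <= eta.
Proof.
move=> g0 e0; pose e := Num.min 1 eta.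
have e_gt0 : 0 < e by rewrite lt_min ltr01.
have e1 : e <= 1 by rewrite ge_min lexx.
have g0' : 0 <= gamma^-1 by rewrite invr_ge0 ltW.
exists (e `^ gamma^-1); split.
  rewrite powR_gt0 //=; apply: (@le_trans _ _ (1 `^ gamma^-1)); last by rewrite powR1.
  by apply: ge0_ler_powR; rewrite ?nnegrE // ltW.
move=> h h0 hd; apply: (@le_trans _ _ ((e `^ gamma^-1) `^ gamma)).
  by apply: ge0_ler_powR; rewrite ?nnegrE ?powR_ge0 // ltW.
by rewrite -powRrM mulVf ?gt_eqF // (powRr1 (ltW e_gt0)) /e ge_min lexx orbT.
Qed.

(** * Local estimates for compositions of Euler maps *)

Section EulerLocal.
Variables (R : realType) (d n N : nat) (T gamma Cw : R).
Variables (w : R -> R -> word d -> R) (f : 'I_d -> 'rV[R]_n -> 'rV[R]_n).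
Hypothesis hw : rough_increments N T gamma Cw w.
Local Notation y := (euler N f w).
Local Notation q s t := ((t - s) `^ gamma).
Hypothesis gamma_gt0 : 0 < gamma.
Let gamma_ge0 := ltW gamma_gt0.

Lemma q_mono s t s' t' : s' <= s -> s <= t -> t <= t' -> q s t <= q s' t'.
Proof.
move=> h1 h2 h3; have h0 : 0 <= t - s by rewrite subr_ge0.
have h4 : t - s <= t' - s' by rewrite lerB.
by apply: ge0_ler_powR; rewrite ?nnegrE // (le_trans h0).
Qed.

Lemma euler_lipschitz (D : set 'rV[R]_n) : convex_domain D -> Cbdv N D f ->
  exists C, 0 <= C /\ forall s t x x', 0 <= s -> s <= t -> t <= T -> t - s <= 1 ->
    D x -> D x' -> `|y s t x - y s t x'| <= (1 + C * q s t) * `|x - x'|.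
Proof.
move=> cD hf; have C0 := ri_ge0 hw.
have /choice[B hB] : forall v : N.-bseq 'I_d, exists B, 0 <= B /\ (v != [::] :> word d ->
    forall x x', D x -> D x' -> `|Fvec f v x - Fvec f v x'| <= B * `|x - x'|).
  move=> v; case: (boolP (v != [::] :> word d)) => hv; last by exists 0.
  have hs : (size v + 1 <= N.+1)%N by rewrite addn1 ltnS size_bseq.
  have /choice[B hB] : forall j, exists B, 0 <= B /\ forall x x', D x -> D x' ->
      `|Fvec f v x 0 j - Fvec f v x' 0 j| <= B * `|x - x'|.
    move=> j; have [B [B0 hB]] := Cbd_lipschitz cD (Cbd_Fvec j hf hv hs).
    by exists B; split=> //; exact: (hB tt).
  exists (\sum_j B j); split; first by apply: sumr_ge0 => j _; exact: (hB j).1.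
  move=> _ x x' Dx Dx'; apply: norm_rV_le => [|j].
    by rewrite mulr_ge0 // sumr_ge0 // => j _; exact: (hB j).1.
  have -> : (Fvec f v x - Fvec f v x') 0 j = Fvec f v x 0 j - Fvec f v x' 0 j by rewrite !mxE.
  apply: (le_trans ((hB j).2 x x' Dx Dx')); apply: ler_wpM2r => //.
  by rewrite (bigD1 j) //= lerDl sumr_ge0 // => l _; exact: (hB l).1.
exists (\sum_(v : N.-bseq 'I_d) Cw * B v); split.
  by apply: sumr_ge0 => v _; apply: mulr_ge0 => //; exact: (hB v).1.
move=> s t x x' s0 st tT ts Dx Dx'.
have /andP[q0 q1] := q_le1 gamma_ge0 st ts.
rewrite !(euler_split f hw) // opprD addrACA -sumrB.
rewrite (le_trans (ler_normD _ _)) // mulrDl mul1r lerD //.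
rewrite (le_trans (ler_norm_sum _ _ _)) // !mulr_suml.
rewrite [leRHS](bigID (fun v : N.-bseq 'I_d => v != [::] :> word d)) /=.
rewrite -[leLHS]addr0 lerD ?sumr_ge0 // => [|v _]; last first.
  by rewrite !mulr_ge0 //; exact: (hB v).1.
apply: ler_sum => v hv; rewrite -scalerBr normrZ.
have -> : Cw * B v * q s t * `|x - x'| = (Cw * q s t) * (B v * `|x - x'|) by ring.
apply: ler_pM => //; last exact: (hB v).2.
apply: (le_trans (ri_bound hw s0 st tT (size_bseq v))); apply: ler_wpM2l => //.
case: (bseqval v) hv => // a v' _; rewrite exprS; apply: ler_piMr => //.
exact: exprn_ile1.
Qed.

Variable D : R -> set 'rV[R]_n.
Hypothesis gD : good_domain D.
Hypothesis hf : forall r, Cbdv N (D r) f.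

Lemma gd_le1 r : D r `<=` D (r + 1).
Proof. by apply: (gd_mono gD); rewrite lerDl. Qed.

(** By Chen's relation the defect is the sum over v of w_tu(v) times the error in the expansion of
    F_v along y_st. Expanding F_v to order N - |v| makes every product of order |v| + (N - |v| + 1)
    = N + 1. *)
Lemma euler_defect r : exists C, 0 <= C /\ forall s t u x,
  0 <= s -> s <= t -> t <= u -> u <= T -> u - s <= 1 -> D r x -> `|y s t x - x| <= 1 ->
  `|y t u (y s t x) - y s u x| <= C * q s u ^+ N.+1.
Proof.
have C0 := ri_ge0 hw.
have /choice[C hC] : forall v : N.-bseq 'I_d, exists C, 0 <= C /\ (v != [::] :> word d ->
   forall j s t x, 0 <= s -> s <= t -> t <= T -> t - s <= 1 -> D r x ->
    `|y s t x - x| <= 1 ->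
    `|Fvec f v (y s t x) 0 j - \sum_(u : (N - size v).-bseq 'I_d) w s t u * Fvec f (u ++ v) x 0 j|
    <= C * q s t ^+ (N - size v).+1).
  move=> v; case: (boolP (v != [::] :> word d)) => hv; last by exists 0.
  have hs : (size v + (N - size v).+1 <= N.+1)%N by rewrite addnS subnKC ?size_bseq.
  have /choice[C hC] : forall j, exists C, 0 <= C /\ forall s t x,
      0 <= s -> s <= t -> t <= T -> t - s <= 1 -> D r x -> `|y s t x - x| <= 1 ->
    `|Fvec f v (y s t x) 0 j - \sum_(u : (N - size v).-bseq 'I_d) w s t u * Fvec f (u ++ v) x 0 j|
    <= C * q s t ^+ (N - size v).+1.
    move=> j; have hg := Cbd_Fvec (k := (N - size v).+1) j (hf (r + 1)) hv hs.
    have [C [hC0 hC]] := euler_expansion hw gamma_ge0 (hf r) (leq_subr (size v) N)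
      (@gd_ball _ _ _ gD r) hg.
    exists C; split=> // s t x s0 st tT ts Dx hy.
    have := hC tt s t x s0 st tT ts Dx hy; congr (`|_ - _| <= _); apply: eq_bigr => u _.
    by congr (_ * _); rewrite mxE Gamma_cat -Fvec_coord.
  exists (\sum_j C j); split; first by apply: sumr_ge0 => j _; exact: (hC j).1.
  move=> _ j s t x s0 st tT ts Dx hy; apply: (le_trans ((hC j).2 s t x s0 st tT ts Dx hy)).
  have /andP[q0 q1] := q_le1 gamma_ge0 st ts.
  apply: ler_wpM2r; first exact: exprn_ge0.
  by rewrite (bigD1 j) //= lerDl sumr_ge0 // => l _; exact: (hC l).1.
exists (\sum_(v : N.-bseq 'I_d) Cw * C v); split.
  by apply: sumr_ge0 => v _; apply: mulr_ge0 => //; exact: (hC v).1.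
move=> s t u x s0 st tu uT us Dx hy.
have su := le_trans st tu; have t0 := le_trans s0 st; have tT := le_trans tu uT.
have ts : t - s <= 1 by apply: le_trans us; rewrite lerB.
have /andP[q0 q1] := q_le1 gamma_ge0 su us.
apply: norm_rV_le => [|j].
  by rewrite mulr_ge0 ?exprn_ge0 // sumr_ge0 // => v _; apply: mulr_ge0 => //; exact: (hC v).1.
have -> : (y t u (y s t x) - y s u x) 0 j = \sum_(v : N.-bseq 'I_d) w t u v *
   (Fvec f v (y s t x) 0 j - \sum_(u' : (N - size v).-bseq 'I_d) w s t u' * Fvec f (u' ++ v) x 0 j).
  rewrite !mxE !euler_coord.
  have -> : \sum_(v : N.-bseq 'I_d) w s u v * Fvec f v x 0 j =
      \sum_(v : N.-bseq 'I_d) \sum_(p <- dec v) (w s t p.1 * w t u p.2) * Fvec f (p.1 ++ p.2) x 0 j.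
    apply: eq_bigr => v _; rewrite (ri_chen hw s0 st tu uT (size_bseq v)) mulr_suml.
    by apply: sum_dec_eq => v1 v2 e /=; rewrite -e.
  rewrite (sum_bseq_dec N (fun v1 v2 => (w s t v1 * w t u v2) * Fvec f (v1 ++ v2) x 0 j)).
  rewrite -sumrB; apply: eq_bigr => v _; rewrite mulrBr; congr (_ - _).
  by rewrite mulr_sumr; apply: eq_bigr => u' _; rewrite mulrCA mulrA.
rewrite (le_trans (ler_norm_sum _ _ _)) // mulr_suml; apply: ler_sum => v _.
have Cv0 := (hC v).1.
case: (boolP (v != [::] :> word d)) => hv; last first.
  (* For v empty, F_v is the identity, which is unbounded; but its expansion is the definition of
     y_st, hence exact. *)
  move: hv; rewrite negbK => /eqP ->; rewrite Fvec_nil euler_coord /= subn0.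
  rewrite [X in _ - X](eq_bigr (fun u' : N.-bseq 'I_d => w s t u' * Fvec f u' x 0 j)) => [|u' _]; last by rewrite cats0.
  by rewrite subrr mulr0 normr0 !mulr_ge0 ?exprn_ge0.
rewrite normrM.
have hN : N.+1 = (size v + (N - size v).+1)%N by rewrite addnS subnKC ?size_bseq.
rewrite [in leRHS]hN exprD mulrACA; apply: ler_pM => //.
  apply: (le_trans (ri_bound hw t0 tu uT (size_bseq v))); apply: ler_wpM2l => //.
  by apply: lerXn2r; rewrite ?nnegrE ?powR_ge0 //; exact: q_mono.
apply: (le_trans ((hC v).2 hv j s t x s0 st tT ts Dx hy)); apply: ler_wpM2l => //.
by apply: lerXn2r; rewrite ?nnegrE ?powR_ge0 //; exact: q_mono.
Qed.

Hypothesis gammaN : (2^-1 `^ gamma) ^+ N.+1 < 2^-1.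

(** A bootstrap on the number of steps. The one-step estimate presupposes that the scheme stays in
    [D (r + 1)]; the estimate for a partition without its last point keeps the scheme close enough
    to x for the last step to stay there as well. *)
Lemma euler_local r : exists delta L, [/\ 0 < delta <= 1, 0 <= L &
  forall s p x, 0 <= s -> path <%R s p -> last s p <= T -> last s p - s <= delta -> D r x ->
   [/\ stays y (D (r + 1)) s p x, `|scheme y s p x - x| <= 1 &
    `|scheme y s p x - y s (last s p) x| <= L * q s (last s p) ^+ N.+1]].
Proof.
have := gammaN; set kappa := (2^-1 `^ gamma) ^+ N.+1 => hk.
have k0 : 0 <= kappa by rewrite exprn_ge0 ?powR_ge0.
(* With 3 eps = 1 - 2 kappa and eps <= 1, the contraction factor (1 + (1 + eps)^2) kappa is at most
   (1 + 2 kappa)/2 < 1. *)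
pose eps := (1 - 2 * kappa) / 3.
have [Cl [Cl0 hCl]] := euler_lipschitz (@gd_conv _ _ _ gD (r + 1 + 1)) (hf (r + 1 + 1)).
have [Cm [Cm0 hCm]] := euler_move hw gamma_ge0 (hf (r + 1)).
have [Cd [Cd0 hCd]] := euler_defect (r + 1).
have eps0 : 0 < eps by rewrite /eps; lra.
have rho : (1 + (1 + eps) ^+ 2) * kappa <= (1 + 2 * kappa) / 2.
  have e1 : eps <= 1 by rewrite /eps; lra.
  have e2 : eps ^+ 2 <= eps by rewrite expr2 ler_piMl // ltW.
  have : (1 + (1 + eps) ^+ 2) <= 2 + 3 * eps by rewrite (_ : (1 + eps) ^+ 2 = 1 + 2 * eps + eps ^+ 2); [move: (eps ^+ 2) e2 => z e2; lra|ring].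
  move=> /(ler_wpM2r k0)/le_trans; apply.
  have : 3 * eps * kappa <= 3 * eps * 2^-1.
    by apply: ler_wpM2l; [rewrite mulr_ge0 // ltW|exact: ltW hk].
  have he : 3 * eps = 1 - 2 * kappa by rewrite /eps; lra.
  move=> hz; have -> : (2 + 3 * eps) * kappa = 2 * kappa + 3 * eps * kappa by ring.
  by rewrite he in hz *; move: ((1 - 2 * kappa) * kappa) hz => z hz; lra.
(* The solution of L rho + Cd (2 + eps) = L for the contraction factor rho = (1 + 2 kappa)/2. *)
pose L := Cd * (2 + eps) / (1 - (1 + 2 * kappa) / 2).
have L0 : 0 <= L.
  apply: divr_ge0; last by lra.
  by apply: mulr_ge0 => //; apply: addr_ge0 => //; exact: ltW.
have hL : L * (1 + (1 + eps) ^+ 2) * kappa + Cd * (2 + eps) <= L.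
  rewrite -mulrA; apply: (@le_trans _ _ (L * ((1 + 2 * kappa) / 2) + Cd * (2 + eps))).
    by rewrite lerD2r; apply: ler_wpM2l.
  have -> : Cd * (2 + eps) = L * (1 - (1 + 2 * kappa) / 2).
    by rewrite /L mulfVK //; apply/eqP; lra.
  by rewrite -mulrDr; rewrite addrC subrK mulr1.
(* The first bound brings the Lipschitz constant of a step below 1 + eps. The other two make an
   Euler move and the error of the scheme at most 1/4 each, so that a scheme followed by one more
   step stays within 3/4 of its start. *)
pose eta := Num.min (eps / (Cl + 1)) (Num.min (4 * (Cm + 1))^-1 (4 * (L + 1))^-1).
have pos (c : R) : 0 <= c -> 0 < c + 1 by move=> h; rewrite (le_lt_trans h) // ltrDl.
have eta0 : 0 < eta by rewrite !lt_min divr_gt0 ?pos // !invr_gt0 !mulr_gt0 ?pos.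
have [delta [/andP[d0 d1] hdelta]] := powR_small gamma_gt0 eta0.
exists delta, L; split=> //; first by rewrite d0.
have hq s t : s <= t -> t - s <= delta -> [/\ Cl * q s t <= eps, Cm * q s t <= 4^-1,
    L * q s t <= 4^-1 & 0 <= q s t <= 1].
  move=> st ts; have := hdelta _ (etrans (subr_ge0 _ _) st) ts.
  rewrite !le_min => /and3P[h1 h2 h3]; split; last exact: q_le1 (le_trans ts d1).
  - apply: (le_trans (ler_wpM2l Cl0 h1)); rewrite mulrCA ler_piMr ?(ltW eps0) //.
    by rewrite ler_pdivrMr ?pos // mul1r lerDl.
  - apply: (le_trans (ler_wpM2l Cm0 h2)); rewrite invfM mulrCA ler_piMr //.
    by rewrite ler_pdivrMr ?pos // mul1r lerDl.
  apply: (le_trans (ler_wpM2l L0 h3)); rewrite invfM mulrCA ler_piMr //.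
  by rewrite ler_pdivrMr ?pos // mul1r lerDl.
pose om h := (h `^ gamma) ^+ N.+1.
have one_step := @scheme_one_step R _ y om T delta kappa eps Cd L (D (r + 1)) (D (r + 1 + 1))
  (ltW eps0) Cd0 L0.
have {}one_step s p x : 0 <= s -> path <%R s p -> last s p <= T -> last s p - s <= delta ->
    stays y (D (r + 1)) s p x ->
    `|scheme y s p x - y s (last s p) x| <= L * om (last s p - s).
  apply: one_step => //.
  - move=> h h' h0 hh' hd'; rewrite exprn_ge0 ?powR_ge0 //=.
    apply: lerXn2r; rewrite ?nnegrE ?powR_ge0 //.
    by apply: ge0_ler_powR; rewrite ?nnegrE // (le_trans h0).
  - move=> h h0 _; rewrite /om /kappa -exprMn mulrC powRM //.
  - by move=> s' x' hs'; exact: (euler_refl f hw).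
  - move=> s' t x1 x2 s0 st tT ts K1 K2.
    apply: (le_trans (hCl s' t x1 x2 s0 st tT (le_trans ts d1) K1 K2)).
    by apply: ler_wpM2r => //; rewrite lerD2l; have [] := hq _ _ st ts.
  - exact: gd_le1.
  - move=> s' t x1 s0 st tT ts D1; have := gd_ball gD (v := y s' t x1 - x1) D1.
    rewrite [x1 + _]addrC subrK; apply; apply: (le_trans (hCm s' t x1 s0 st tT (le_trans ts d1) D1)).
    have [_ h _ _] := hq _ _ st ts; apply: (le_trans h); lra.
  - move=> s' t u x1 s0 st tu uT us D1; apply: hCd => //; first exact: le_trans d1.
    have ts : t - s' <= delta by apply: le_trans us; rewrite lerB.
    have tT := le_trans tu uT.
    apply: (le_trans (hCm s' t x1 s0 st tT (le_trans ts d1) D1)).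
    have [_ h _ _] := hq _ _ st ts; apply: (le_trans h); lra.
move=> s p x s0; elim/last_ind: p => [|p t IH] hp hT hd Dx.
  split.
  - by split=> //; exact: gd_le1.
  - by rewrite subrr normr0.
  rewrite /= (euler_refl f hw) ?s0 // subrr normr0 mulr_ge0 ?exprn_ge0 ?powR_ge0 //.
move: hp hT hd; rewrite rcons_path last_rcons => /andP[hp pt] tT td.
set m := last s p in pt.
have sm : s <= m := path_le_last hp.
have mT : m <= T by rewrite (le_trans (ltW pt)).
have md : m - s <= delta by apply: le_trans td; rewrite lerB // ltW.
have [st1 h1 h2] := IH hp mT md Dx.
have Dz := stays_end st1; set z := scheme y s p x in h1 h2 Dz.
have m0 : 0 <= m := le_trans s0 sm.
have st : s <= t := le_trans sm (ltW pt).
have tm : t - m <= delta by apply: le_trans td; rewrite lerB.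
have hzx : `|z - x| <= 4^-1 + 4^-1.
  rewrite -(subrKA (y s m x)) (le_trans (ler_normD _ _)) // lerD //.
    apply: (le_trans h2); have [_ _ h /andP[q0 q1]] := hq _ _ sm md.
    apply: (le_trans _ h); apply: ler_wpM2l => //.
    by rewrite exprS; apply: ler_piMr => //; exact: exprn_ile1.
  apply: (le_trans (hCm s m x s0 sm mT (le_trans md d1) (gd_le1 Dx))).
  by have [] := hq _ _ sm md.
have hyz : `|y m t z - z| <= 4^-1.
  apply: (le_trans (hCm m t z m0 (ltW pt) tT (le_trans tm d1) Dz)).
  by have [] := hq _ _ (ltW pt) tm.
have hyx : `|y m t z - x| <= 1.
  rewrite -(subrKA z) (le_trans (ler_normD _ _)) // (le_trans (lerD hyz hzx)) //; lra.
have st2 : stays y (D (r + 1)) s (rcons p t) x.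
  rewrite -cats1; apply/stays_cat; split=> //; split=> //; split=> //=.
  by have := gd_ball gD (v := y m t z - x) Dx hyx; rewrite [x + _]addrC subrK.
have es : scheme y s (rcons p t) x = y m t z by rewrite -cats1 scheme_cat.
split=> //; first by rewrite es.
have := one_step s (rcons p t) x s0; rewrite rcons_path last_rcons hp pt; exact.
Qed.

End EulerLocal.

(** * The tangent system *)

Section TangentFunctions.
Variables (R : realType) (n : nat).
Implicit Types (phi : 'rV[R]_n -> R) (z : 'rV[R]_(n + n)).

Definition tangent phi z : R := \sum_l rsubmx z 0 l * pd l phi (lsubmx z).

Lemma tangentE phi z : tangent phi z = 'd phi (lsubmx z) (rsubmx z).
Proof. by apply/esym; exact: diff_pd. Qed.

Lemma diff_lsubmx z v : differentiable (@lsubmx R 1 n n) z /\ 'd (@lsubmx R 1 n n) z v = lsubmx v.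
Proof.
have lF : linear (@lsubmx R 1 n n) by move=> a u x; exact: linearP.
have cF : continuous (@lsubmx R 1 n n).
  by move=> x; apply: differentiable_continuous; exact: differentiable_lsubmx.
have [h1 h2] := diff_linear_fun z lF cF; split; [exact: h1|exact: h2].
Qed.

Lemma Cbd_coordf m k (D : set 'rV[R]_m) (j : 'I_m) (M : R) : (forall u, D u -> `|u 0 j| <= M) ->
  Cbd k D (fun _ : unit => fun u => u 0 j).
Proof.
move=> h; case: k => [|k]; (split; first by exists M => _ u; exact: h).
  by move=> _; exact: coord_continuous.
split=> [_ u|l]; first exact: differentiable_rV_coord.
have -> : (fun _ : unit => pd l (fun u : 'rV[R]_m => u 0 j)) =
   (fun=> fun=> (delta_mx 0 l : 'rV[R]_m) 0 j).
  by apply/funext => t; apply/funext => x; exact: diff_rV_coord.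
exact: (Cbd_const _ _ (M := `|(delta_mx 0 l : 'rV[R]_m) 0 j|)).
Qed.

Definition tangent_domain (D : R -> set 'rV[R]_n) (r : R) : set 'rV[R]_(n + n) :=
  [set z | D r (lsubmx z) /\ `|rsubmx z| <= r].

Lemma norm_lsubmx z : `|lsubmx z| <= `|z|.
Proof. by apply: norm_rV_le => // j; rewrite mxE norm_coord_le. Qed.

Lemma norm_rsubmx z : `|rsubmx z| <= `|z|.
Proof. by apply: norm_rV_le => // j; rewrite mxE norm_coord_le. Qed.

Lemma tangent_good_domain D : good_domain D -> good_domain (tangent_domain D).
Proof.
move=> gD; split=> [r r' rr' z [Dz hz]|r z v [Dz hz] hv|r z z' c [Dz hz] [Dz' hz'] hc].
- by split; [exact: (gd_mono gD rr')|exact: le_trans rr'].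
- split; rewrite linearD /=.
    by apply: (gd_ball gD) => //; exact: le_trans (norm_lsubmx v) hv.
  by rewrite (le_trans (ler_normD _ _)) // lerD // (le_trans (norm_rsubmx v)).
split; rewrite linearD linearZ linearB /=; first exact: (gd_conv gD).
move: (rsubmx z) (rsubmx z') hz hz' => h h' hz hz'.
have -> : h + c *: (h' - h) = (1 - c) *: h + c *: h'.
  by rewrite scalerBr scalerBl scale1r addrA addrAC.
case/andP: hc => c0 c1; rewrite (le_trans (ler_normD _ _)) // !normrZ.
rewrite (ger0_norm c0) ger0_norm ?subr_ge0 //.
have -> : r = (1 - c) * r + c * r by rewrite -mulrDl subrK mul1r.
by rewrite lerD // ler_wpM2l // subr_ge0.
Qed.

Lemma Cbd_lsubmx k D r I (phi : I -> 'rV[R]_n -> R) : Cbd k (D r) phi ->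
  Cbd k (tangent_domain D r) (fun i z => phi i (lsubmx z)).
Proof.
apply: (Cbd_comp_affine (c := fun j => lsubmx (delta_mx 0 j))).
- by move=> z; have [] := diff_lsubmx z 0.
- by move=> z j; have [] := diff_lsubmx z (delta_mx 0 j).
- by move=> z [].
Qed.

Lemma Cbd_tangent k D r I (phi : I -> 'rV[R]_n -> R) : Cbd k.+1 (D r) phi ->
  Cbd k (tangent_domain D r) (fun i => tangent (phi i)).
Proof.
move=> h; apply: (@Cbd_sum _ _ k _ I _ _ _ (fun l i z => rsubmx z 0 l * pd l (phi i) (lsubmx z))) => l.
apply: Cbd_mul; last exact: (Cbd_lsubmx (Cbd_pd l h)).
apply: (Cbd_reindex (fun _ : I => tt) (phi := fun _ : unit => fun z : 'rV[R]_(n + n) => rsubmx z 0 l)).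
have -> : (fun _ : unit => fun z : 'rV[R]_(n + n) => rsubmx z 0 l) =
  (fun=> fun z => z 0 (rshift n l)).
  by apply/funext => t; apply/funext => z; rewrite mxE.
apply: (@Cbd_coordf _ _ _ _ r) => z [_ hz].
by apply: le_trans hz; have := norm_coord_le (rsubmx z) l; rewrite mxE.
Qed.

End TangentFunctions.

Section TangentSystem.
Variables (R : realType) (d n : nat) (f : 'I_d -> 'rV[R]_n -> 'rV[R]_n).
Implicit Types (phi : 'rV[R]_n -> R) (z : 'rV[R]_(n + n)) (v : word d).

Definition tangent_field (i : 'I_d) z : 'rV[R]_(n + n) :=
  row_mx (f i (lsubmx z)) (\row_j tangent (fun x => f i x 0 j) z).
Local Notation Tf := tangent_field.

Lemma lsub_tangent_field i z : lsubmx (Tf i z) = f i (lsubmx z).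
Proof. exact: row_mxKl. Qed.

Lemma rsub_tangent_field i z j : rsubmx (Tf i z) 0 j = tangent (fun x => f i x 0 j) z.
Proof. by rewrite row_mxKr mxE. Qed.

Lemma Cbdv_tangent k (D : R -> set 'rV[R]_n) r : Cbdv k.+1 (D r) f ->
  Cbdv k (tangent_domain D r) Tf.
Proof.
move=> h j; case: (splitP j) => l hl.
  have -> : (fun i z => Tf i z 0 j) = (fun i z => f i (lsubmx z) 0 l).
    have -> : j = lshift n l by apply: val_inj.
    by apply/funext => i; apply/funext => z; rewrite /tangent_field row_mxEl.
  by apply: (Cbd_lsubmx (phi := fun i x => f i x 0 l)); exact: CbdW.
have -> : (fun i z => Tf i z 0 j) = (fun i => tangent (fun x => f i x 0 l)).
  have -> : j = rshift n l by apply: val_inj.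
  by apply/funext => i; apply/funext => z; rewrite /tangent_field row_mxEr mxE.
exact: (Cbd_tangent (phi := fun i x => f i x 0 l)).
Qed.

Lemma Gamma_lsubmx K v phi : Cbdv K set0 f -> (size v <= K.+1)%N -> smooth (size v) phi ->
  Gamma Tf v (fun z => phi (lsubmx z)) = fun z => Gamma f v phi (lsubmx z).
Proof.
move=> hf; elim: v => [|i v IH] // hv hphi; apply/funext => z.
have dG x : differentiable (Gamma f v phi) x.
  apply: (smooth_differentiable (k := 0)).
  by apply: (Cbd_Gamma (K := K) (phi := fun _ : unit => phi)) => //; rewrite addn1.
rewrite [LHS]/= IH //; [|exact: ltnW|exact: CbdW].
apply: (etrans (diff_chain _ (diff_lsubmx z 0).1 (dG _))).
have e := (diff_lsubmx z (Tf i z)).2; rewrite lsub_tangent_field in e.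
have e' := congr1 ('d (Gamma f v phi) (lsubmx z)) e.
exact: e'.
Qed.

(** Differentiation along f_i commutes with the tangent lift. The two sides differ by the order of
    the second derivatives of phi and by an exchange of sums; the terms with Df_i come from the
    second component of the tangent field. *)
Lemma diff_tangent i phi z : Cbdv 1 set0 f -> smooth 2 phi ->
  'd (tangent phi) z (Tf i z) = tangent (Gamma f [:: i] phi) z.
Proof.
move=> hf hphi; set x := lsubmx z; set h := rsubmx z.
have d1 l : differentiable (fun z : 'rV[R]_(n + n) => rsubmx z 0 l) z.
  apply: (differentiable_coordE (F := @rsubmx R 1 n n)); exact: differentiable_rsubmx.
have dp l y : differentiable (pd l phi) y by exact: (smooth_differentiable y (smooth_pd l hphi)).
have d2 l : differentiable (fun z : 'rV[R]_(n + n) => pd l phi (lsubmx z)) z.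
  by apply: differentiable_chain; [exact: (diff_lsubmx z 0).1|exact: dp].
have df j y : differentiable (fun x => f i x 0 j) y.
  by apply: (smooth_differentiable (k := 0)); exact: (Cbd_reindex (fun _ : unit => i) (hf j)).
apply: (etrans (@diff_bigsum _ _ _ _ xpredT _ z _ (fun l _ => differentiable_mul (d1 l) (d2 l)))).
have step l : 'd (fun z : 'rV[R]_(n + n) => rsubmx z 0 l * pd l phi (lsubmx z)) z (Tf i z) =
   h 0 l * (\sum_j f i x 0 j * pd j (pd l phi) x) +
   pd l phi x * \sum_j h 0 j * pd j (fun x => f i x 0 l) x.
  apply: (etrans (diff_mul _ (d1 l) (d2 l))); congr (_ * _ + _ * _).
    apply: (etrans (diff_chain _ (diff_lsubmx z 0).1 (dp l _))).
    have e := (diff_lsubmx z (Tf i z)).2; rewrite lsub_tangent_field in e.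
    have e' := congr1 ('d (pd l phi) (lsubmx z)) e.
    exact: (etrans e' (diff_pd _ _ _)).
  have -> : (fun z : 'rV[R]_(n + n) => rsubmx z 0 l) = (fun z => z 0 (rshift n l)).
    by apply/funext => u; rewrite mxE.
  apply: (etrans (diff_rV_coord _ _ _)).
  by have := rsub_tangent_field i z l; rewrite mxE.
rewrite (eq_bigr _ (fun l _ => step l)).
have e3 l : pd l (Gamma f [:: i] phi) x =
    \sum_j (f i x 0 j * pd l (pd j phi) x + pd j phi x * pd l (fun x => f i x 0 j) x).
  have -> : Gamma f [:: i] phi = fun y => \sum_j f i y 0 j * pd j phi y.
    by apply/funext => y; exact: diff_pd.
  apply: (etrans (@diff_bigsum _ _ _ _ xpredT _ x _ (fun j _ => differentiable_mul (df j x) (dp j x)))).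
  by apply: eq_bigr => j _; exact: diff_mul.
have -> : tangent (Gamma f [:: i] phi) z = \sum_l h 0 l *
    \sum_j (f i x 0 j * pd l (pd j phi) x + pd j phi x * pd l (fun x => f i x 0 j) x).
  by apply: eq_bigr => l _; congr (_ * _); exact: e3.
rewrite big_split /=.
under [RHS]eq_bigr do rewrite big_split mulrDr /=.
rewrite big_split /=; congr (_ + _).
  apply: eq_bigr => l _; congr (_ * _); apply: eq_bigr => j _.
  by rewrite (smooth_schwarz l j hphi).
under eq_bigr do rewrite mulr_sumr.
under [RHS]eq_bigr do rewrite mulr_sumr.
rewrite exchange_big /=; apply: eq_bigr => l _; apply: eq_bigr => j _.
by rewrite mulrCA.
Qed.

Lemma Gamma_tangent K v phi : Cbdv K.+1 set0 f -> (size v <= K.+1)%N -> smooth (size v).+1 phi ->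
  Gamma Tf v (tangent phi) = tangent (Gamma f v phi).
Proof.
move=> hf; elim: v => [|i v IH] // hv hphi; apply/funext => z.
have hG : smooth 2 (Gamma f v phi).
  apply: (Cbd_Gamma (K := K.+1) (phi := fun _ : unit => phi)) => //; first by rewrite addn2.
  by rewrite addn2.
rewrite [LHS]/= IH //; [|exact: ltnW|exact: CbdW].
apply: (etrans (diff_tangent i z _ hG)) => //.
by move=> j; apply: Cbd_le (hf j).
Qed.

(** The coordinates of R^(2n) are the base coordinates and their tangent lifts, and both kinds
    commute with the iterated derivatives. *)
Lemma Fvec_tangent K v z : Cbdv K.+1 set0 f -> (size v <= K.+1)%N ->
  Fvec Tf v z = row_mx (Fvec f v (lsubmx z)) (\row_j tangent (Gamma f v (fun x => x 0 j)) z).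
Proof.
move=> hf hv; apply/rowP => j; rewrite mxE; case: (splitP j) => l hl.
  have -> : j = lshift n l by apply: val_inj.
  rewrite row_mxEl mxE.
  have -> : Gamma Tf v (fun z : 'rV[R]_(n + n) => z 0 (lshift n l)) =
      fun z => Gamma f v (fun x => x 0 l) (lsubmx z).
    have -> : (fun z : 'rV[R]_(n + n) => z 0 (lshift n l)) = fun z => lsubmx z 0 l.
      by apply/funext => u; rewrite mxE.
    apply: (Gamma_lsubmx (K := K.+1) (phi := fun x => x 0 l) hf); first exact: leqW.
    exact: smooth_coord.
  by [].
have -> : j = rshift n l by apply: val_inj.
rewrite row_mxEr mxE.
have -> : (fun z : 'rV[R]_(n + n) => z 0 (rshift n l)) = tangent (fun x : 'rV[R]_n => x 0 l).
  apply/funext => u; rewrite tangentE; apply/esym.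
  by apply: (etrans (diff_rV_coord _ _ _)); rewrite mxE.
by rewrite (Gamma_tangent hf) //; exact: smooth_coord.
Qed.

Variables (N : nat) (w : R -> R -> word d -> R).
Local Notation y := (euler N f w).

Lemma Gamma_coordf_differentiable (v : N.-bseq 'I_d) j x : Cbdv N set0 f ->
  differentiable (Gamma f v (fun x : 'rV[R]_n => x 0 j)) x.
Proof.
move=> hf; apply: (smooth_differentiable (k := 0)).
apply: (Cbd_Gamma (K := N) (phi := fun _ : unit => fun x : 'rV[R]_n => x 0 j)) => //.
  by rewrite addn1 ltnS size_bseq.
exact: smooth_coord.
Qed.

Lemma euler_coordE s t j : (fun x => y s t x 0 j) =
  fun x => \sum_(v : N.-bseq 'I_d) w s t v * Gamma f v (fun x : 'rV[R]_n => x 0 j) x.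
Proof. by apply/funext => x; rewrite euler_coord; apply: eq_bigr => v _; rewrite mxE. Qed.

Lemma euler_differentiable s t x : Cbdv N set0 f -> differentiable (y s t) x.
Proof.
move=> hf; apply: differentiable_coords => j; rewrite euler_coordE.
apply: (@differentiable_bigsum _ _ _ _ _ (fun v : N.-bseq 'I_d => fun x => w s t v * Gamma f v (fun x : 'rV[R]_n => x 0 j) x)) => v _.
by apply: differentiable_scale; exact: Gamma_coordf_differentiable.
Qed.

Lemma scheme_continuous s p : Cbdv N set0 f -> continuous (scheme y s p).
Proof.
move=> hf; elim: p s => [|t p IH] s x; first exact: cvg_id.
apply: (@continuous_comp _ _ _ (y s t) (scheme y t p)); last exact: IH.
by apply: differentiable_continuous; exact: euler_differentiable.
Qed.

Hypothesis hf : Cbdv N.+1 set0 f.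
Let hf' : Cbdv N set0 f := fun j => CbdW (hf j).

Lemma euler_tangent s t x h :
  euler N Tf w s t (row_mx x h) = row_mx (y s t x) ('d (y s t) x h).
Proof.
have -> : row_mx (y s t x) ('d (y s t) x h) = \sum_(v : N.-bseq 'I_d)
    w s t v *: row_mx (Fvec f v x) (\row_j tangent (Gamma f v (fun x => x 0 j)) (row_mx x h)).
  apply/rowP => j; rewrite summxE; case: (splitP j) => l hl.
    have -> : j = lshift n l by apply: val_inj.
    rewrite row_mxEl euler_coord; apply: eq_bigr => v _.
    by rewrite [RHS]mxE row_mxEl.
  have -> : j = rshift n l by apply: val_inj.
  rewrite row_mxEr; apply: (etrans (diff_coord _ _ (euler_differentiable s t x hf'))).
  rewrite euler_coordE.
  apply: (etrans (@diff_bigsum _ _ _ _ xpredT _ x _ (fun (v : N.-bseq 'I_d) _ =>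
     differentiable_scale (w s t v) (Gamma_coordf_differentiable v l x hf')))).
  apply: eq_bigr => v _; rewrite mxE row_mxEr mxE tangentE row_mxKl row_mxKr.
  exact: (diff_scale _ _ (Gamma_coordf_differentiable v l x hf')).
apply: eq_bigr => v _; congr (_ *: _).
by rewrite (Fvec_tangent _ hf) ?row_mxKl // leqW ?size_bseq.
Qed.

Lemma scheme_tangent s p x h :
  differentiable (scheme y s p) x /\
  scheme (euler N Tf w) s p (row_mx x h) = row_mx (scheme y s p x) ('d (scheme y s p) x h).
Proof.
elim: p s x h => [|t p IH] s x h.
  have hid := is_diff_id x; split; first exact: (@ex_diff _ _ _ _ _ _ _ hid).
  by congr row_mx; exact: (esym (congr1 (@^~ h) (@diff_val _ _ _ _ _ _ _ hid))).
have [h1 h2] := IH t (y s t x) ('d (y s t) x h).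
have d1 := euler_differentiable s t x hf'.
split; first exact: (differentiable_comp d1 h1).
rewrite /= euler_tangent h2; congr row_mx.
exact: (esym (congr1 (@^~ h) (diff_comp d1 h1))).
Qed.

End TangentSystem.

(** * Derivatives of schemes, uniformly in the partition *)

Section NoExplosion.
Variables (R : realType) (d N : nat) (T gamma Cw : R) (w : R -> R -> word d -> R).
Hypothesis hw : rough_increments N T gamma Cw w.
Hypothesis T0 : 0 < T.
Hypothesis gamma_gt0 : 0 < gamma.
Hypothesis gammaN : (2^-1 `^ gamma) ^+ N.+1 < 2^-1 :> R.

Definition fine_path (delta s : R) (p : seq R) :=
  [/\ 0 <= s, path <%R s p, last s p <= T & path (fun a b => b - a <= delta) s p].

Lemma fine_path_cat delta s p1 p2 : fine_path delta s (p1 ++ p2) ->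
  fine_path delta s p1 /\ fine_path delta (last s p1) p2.
Proof.
move=> [s0]; rewrite !cat_path last_cat => /andP[h1 h2] hT /andP[h3 h4].
split; split=> //.
  by rewrite (le_trans _ hT) // path_le_last.
by rewrite (le_trans s0) // path_le_last.
Qed.

Lemma fine_path_le delta delta' s p : delta <= delta' -> fine_path delta s p -> fine_path delta' s p.
Proof.
move=> dd [h1 h2 h3 h4]; split=> //; apply: sub_path h4 => a b /le_trans; exact.
Qed.

Lemma stays_prefix (E : Type) (y : R -> R -> E -> E) (D : set E) s p x :
  (forall p1 p2, p = p1 ++ p2 -> D (scheme y s p1 x)) -> stays y D s p x.
Proof.
elim: p s x => [|t p IH] s x h; first by split=> //; exact: (h [::] [::]).
split; first exact: (h [::] (t :: p)).
by apply: IH => p1 p2 e; apply: (h (t :: p1) p2); rewrite e.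
Qed.

(** Whereas [euler_local] concerns short intervals, here only the mesh is small, and r' serves all
    fine partitions within [0, T]. *)
Definition no_explosion n (f : 'I_d -> 'rV[R]_n -> 'rV[R]_n) (D : R -> set 'rV[R]_n) :=
  forall r, exists r' delta, 0 < delta /\ forall s p x, fine_path delta s p -> D r x ->
    stays (euler N f w) (D r') s p x.

(** Linearity in h replaces the missing global bound. On a short interval [euler_local] bounds the
    differential of a scheme on unit vectors by a constant A, hence on every h by A |h|, with A
    uniform over base points in [D r1]; over [0, T] this is iterated a fixed number m of times and
    gives A^m |h|. *)
Lemma tangent_no_explosion n (f : 'I_d -> 'rV[R]_n -> 'rV[R]_n) D : good_domain D ->
  (forall r, Cbdv N.+1 (D r) f) -> no_explosion f D ->
  no_explosion (tangent_field f) (tangent_domain D).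
Proof.
move=> gD hf hne r.
have hf0 := Cbdv_smooth (hf 0).
have [r1 [delta1 [d10 h1]]] := hne r.
(* A radius of at least 1 puts the unit vectors of the fibre into the tangent domain. *)
pose R1 := Num.max r1 1.
have [delta2 [L [/andP[d20 _] _ h2]]] := euler_local hw gamma_gt0
  (tangent_good_domain gD) (fun r => Cbdv_tangent (D := D) (r := r) (hf r)) gammaN R1.
pose A := R1 + 1.
have R11 : 1 <= R1 by rewrite le_max lexx orbT.
have A1 : 1 <= A by rewrite /A (le_trans R11) // lerDl.
have A0 : 0 <= A := le_trans ler01 A1.
pose y := euler N f w.
have lin s p x h : 0 <= s -> path <%R s p -> last s p <= T -> last s p - s <= delta2 ->
    D r1 x -> `|'d (scheme y s p) x h| <= A * `|h|.
  move=> s0 hp hT hd Dx.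
  have Dx' : D R1 x by apply: (gd_mono gD _ Dx); rewrite le_max lexx.
  have [->|hn0] := eqVneq h 0; first by rewrite linear0 !normr0 mulr0.
  have hh : 0 < `|h| by rewrite normr_gt0.
  have eh : h = `|h| *: (`|h|^-1 *: h) by rewrite scalerA mulfV ?scale1r // gt_eqF.
  rewrite {1}eh linearZ normrZ normr_id mulrC ler_pM2r //.
  have hz : tangent_domain D R1 (row_mx x (`|h|^-1 *: h)).
    split; rewrite ?row_mxKl ?row_mxKr // normrZ normfV normr_id mulVf ?gt_eqF //.
  have [st _ _] := h2 s p _ s0 hp hT hd hz.
  have := stays_end st; rewrite (scheme_tangent w hf0 _ _ _ _).2 => -[_].
  by rewrite row_mxKr.
(* A chunk ends at the last partition point within [delta2] of its start. As the mesh is at most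
   [delta2 / 2], it is longer than [delta2 / 2] unless it is the final one, so m chunks suffice. *)
have chunks m s p x h : fine_path (delta2 / 2) s p -> last s p - s <= m%:R * (delta2 / 2) ->
    stays y (D r1) s p x -> `|'d (scheme y s p) x h| <= A ^+ m * `|h|.
  elim: m s p x h => [|m IH] s p x h hfp hm st.
    case: p hfp hm {st} => [|t p] [_ hp _ _] hm.
      have hid := is_diff_id x; rewrite expr0 mul1r.
      by rewrite (congr1 (@^~ h) (@diff_val _ _ _ _ _ _ _ hid)).
    move: hp hm; rewrite mul0r subr_le0 /= => /andP[st /path_le_last].
    by move=> /(lt_le_trans st); rewrite ltNge => /negbTE ->.
  have [s0 hp hT hfi] := hfp.
  case: (leP (last s p) (s + delta2)) => hd.
    apply: (le_trans (lin s p x h s0 hp hT _ (stays_start st))); first by rewrite lerBlDl.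
    by rewrite exprS -mulrA ler_wpM2l // ler_peMl // exprn_ege1.
  have sc : s <= s + delta2 by rewrite lerDl ltW.
  have [p1 [u [p2 [e [m_le r_gt hp1 m_r hp2]]]]] := path_split hp sc hd.
  move: hfp hm st; rewrite e => /fine_path_cat[hf1 hf2] hm /stays_cat[st1 st2].
  have d1 := (scheme_tangent w hf0 s p1 x h).1.
  have d2 := (scheme_tangent w hf0 (last s p1) (u :: p2) (scheme y s p1 x) h).1.
  have -> : scheme y s (p1 ++ u :: p2) = scheme y (last s p1) (u :: p2) \o scheme y s p1.
    by apply/funext => z; rewrite /= scheme_cat.
  have [_ _ mT1 _] := hf1.
  rewrite (congr1 (@^~ h) (diff_comp d1 d2)).
  have hm2 : last (last s p1) (u :: p2) - last s p1 <= m%:R * (delta2 / 2).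
    have [_ _ _ /= /andP[um _]] := hf2.
    move: hm; rewrite last_cat -natr1 mulrDl mul1r => hm.
    lra.
  apply: (le_trans (IH _ _ _ _ hf2 hm2 st2)).
  rewrite exprSr -mulrA ler_wpM2l ?exprn_ge0 //.
  by apply: lin => //; [rewrite lerBlDl|exact: stays_start st1].
have [m hm] : exists m, T <= m%:R * (delta2 / 2).
  have d22 : 0 < delta2 / 2 by rewrite divr_gt0.
  exists (Num.truncn (T / (delta2 / 2))).+1.
  by rewrite -ler_pdivrMr // ltW // truncnS_gt.
exists (Num.max R1 (A ^+ m * r)), (Num.min delta1 (delta2 / 2)); split.
  by rewrite lt_min d10 divr_gt0.
move=> s p z hfp [Dx hh].
have hf1 : fine_path delta1 s p by apply: fine_path_le hfp; rewrite ge_min lexx.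
have hf2 : fine_path (delta2 / 2) s p by apply: fine_path_le hfp; rewrite ge_min lexx orbT.
have st := h1 s p _ hf1 Dx.
apply: stays_prefix => p1 p2 e.
move: hf2 st; rewrite e => /fine_path_cat[hfp1 _] /stays_cat[st1 _].
have ez : z = row_mx (lsubmx z) (rsubmx z) by rewrite hsubmxK.
rewrite ez (scheme_tangent w hf0 _ _ _ _).2; split; rewrite ?row_mxKl ?row_mxKr.
  apply: (gd_mono gD _ (stays_end st1)).
  by rewrite !le_max lexx.
rewrite le_max; apply/orP; right.
have hm1 : last s p1 - s <= m%:R * (delta2 / 2).
  have [s0 _ hT _] := hfp1; apply: le_trans hm; apply: le_trans hT.
  by rewrite lerBlDl lerDr.
apply: (le_trans (chunks m s p1 _ _ hfp1 hm1 st1)).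
by rewrite ler_wpM2l ?exprn_ge0.
Qed.

Lemma diff_row_mx n (v : 'rV[R]_n) (x : 'rV[R]_n) :
  differentiable (fun x : 'rV[R]_n => row_mx x v) x /\
  forall h, 'd (fun x : 'rV[R]_n => row_mx x v) x h = row_mx h 0.
Proof.
have dc j : differentiable (fun x : 'rV[R]_n => row_mx x v 0 j) x /\
    forall h, 'd (fun x : 'rV[R]_n => row_mx x v 0 j) x h = row_mx h (0 : 'rV[R]_n) 0 j.
  case: (splitP j) => l hl.
    have -> : j = lshift n l by apply: val_inj.
    have -> : (fun x : 'rV[R]_n => row_mx x v 0 (lshift n l)) = fun x => x 0 l.
      by apply/funext => u; rewrite row_mxEl.
    split; first exact: differentiable_rV_coord.
    by move=> h; rewrite row_mxEl; exact: diff_rV_coord.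
  have -> : j = rshift n l by apply: val_inj.
  have -> : (fun x : 'rV[R]_n => row_mx x v 0 (rshift n l)) = fun x => v 0 l.
    by apply/funext => u; rewrite row_mxEr.
  split; first exact: differentiable_cst.
  by move=> h; rewrite row_mxEr mxE; exact: diff_const.
have dd : differentiable (fun x : 'rV[R]_n => row_mx x v) x.
  by apply: differentiable_coords => j; exact: (dc j).1.
split=> // h; apply/rowP => j.
exact: (etrans (diff_coord _ _ dd) ((dc j).2 h)).
Qed.

(** Induction on k, for all dimensions at once: the j-th partial derivative of phi o scheme at x is
    [tangent phi] along the tangent scheme started at (x, e_j). Each passage spends one derivative
    of f and one of phi, and N derivatives of the last fields remain for the Euler estimates; hence
    N + k. *)
Lemma scheme_Cbd k n (f : 'I_d -> 'rV[R]_n -> 'rV[R]_n) D (phi : 'rV[R]_n -> R) :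
  good_domain D -> (forall r, Cbdv (N + k) (D r) f) -> no_explosion f D ->
  (forall r, Cbd k (D r) (fun _ : unit => phi)) ->
  forall r, exists delta, 0 < delta /\
    Cbd k (D r) (fun (a : {a : R * seq R | fine_path delta a.1 a.2}) x =>
      phi (scheme (euler N f w) (sval a).1 (sval a).2 x)).
Proof.
elim: k n f D phi => [|k IH] n f D phi gD hf hne hphi r.
  have [r' [delta [d0 hst]]] := hne r.
  exists delta; split=> //.
  have [M [_ hM]] := Cbd_bounded (hphi r'); split.
    exists M => -[[s p] /= hp] x Dx; apply: (hM tt).
    exact: stays_end (hst s p x hp Dx).
  move=> [[s p] hp] /=.
  have cphi : continuous phi := @Cbd_continuous _ _ _ _ _ _ tt (hphi r).
  move=> x; apply: (@continuous_comp _ _ _ (scheme (euler N f w) s p) phi); last exact: cphi.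
  by apply: scheme_continuous; have := Cbdv_smooth (hf 0); rewrite addn0.
have hf1 r' : Cbdv N.+1 (D r') f by move=> j; apply: Cbd_le (hf r' j); rewrite addnS ltnS leq_addr.
have hf0 := Cbdv_smooth (hf1 0).
have hfT r' : Cbdv (N + k) (tangent_domain D r') (tangent_field f).
  by apply: Cbdv_tangent => j; have := hf r' j; rewrite addnS.
(* The radius [Num.max r 1] admits the starting points (x, e_j). *)
have [delta1 [d10 h1]] := IH _ _ _ (tangent phi) (tangent_good_domain gD) hfT
  (tangent_no_explosion gD hf1 hne) (fun r => Cbd_tangent (hphi r)) (Num.max r 1).
have [r' [delta0 [d00 hst]]] := hne r.
exists (Num.min delta0 delta1); split; first by rewrite lt_min d00.
have [M [_ hM]] := Cbd_bounded (hphi r'); split.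
  exists M => -[[s p] /= hp] x Dx; apply: (hM tt).
  apply: stays_end (hst s p x _ Dx).
  by apply: fine_path_le hp; rewrite ge_min lexx.
have dphi x : differentiable phi x := Cbd_differentiable tt x (hphi r).
split=> [[[s p] /= hp] x|j].
  exact: (differentiable_chain (scheme_tangent w hf0 s p x 0).1 (dphi _)).
pose red (a : {a : R * seq R | fine_path (Num.min delta0 delta1) a.1 a.2}) :
    {a : R * seq R | fine_path delta1 a.1 a.2} :=
  exist (fun a => fine_path delta1 a.1 a.2) (sval a)
    (fine_path_le (etrans (ge_min _ _ _) (etrans (congr1 (orb _) (lexx _)) (orbT _))) (svalP a)).
have -> : (fun a : {a : R * seq R | fine_path (Num.min delta0 delta1) a.1 a.2} =>
    pd j (fun x => phi (scheme (euler N f w) (sval a).1 (sval a).2 x))) =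
  (fun a x => tangent phi (scheme (euler N (tangent_field f) w) (sval (red a)).1 (sval (red a)).2
      (row_mx x (delta_mx 0 j)))).
  apply/funext => -[[s p] hp]; apply/funext => x /=.
  have [ds es] := scheme_tangent w hf0 s p x (delta_mx 0 j).
  rewrite es tangentE row_mxKl row_mxKr.
  exact: diff_chain ds (dphi _).
apply: (Cbd_comp_affine (L := fun x => row_mx x (delta_mx 0 j))
   (c := fun l => row_mx (delta_mx 0 l) 0) (D' := tangent_domain D (Num.max r 1))
   (phi := fun a z => tangent phi (scheme (euler N (tangent_field f) w) (sval (red a)).1 (sval (red a)).2 z))).
- by move=> x; exact: (diff_row_mx _ x).1.
- by move=> x l; exact: (diff_row_mx _ x).2.
- move=> x Dx; split; rewrite ?row_mxKl ?row_mxKr.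
    by apply: (gd_mono gD _ Dx); rewrite le_max lexx.
  by rewrite (le_trans (norm_delta_mx _ _)) // le_max lexx orbT.
exact: (Cbd_reindex red h1).
Qed.

End NoExplosion.

(** * Sewing *)

Section FinePartitions.
Variable R : realType.
Implicit Types (s t : R) (p q : seq R).

Lemma path_steps_le (delta s : R) p : path <%R s p -> last s p - s <= delta ->
  path (fun a b => b - a <= delta) s p.
Proof.
elim: p s => [|t p IH] s //= /andP[st hp] hd.
have tl := path_le_last hp; apply/andP; split.
  by apply: le_trans hd; rewrite lerB.
by apply: IH => //; apply: le_trans hd; rewrite lerB // ltW.
Qed.

Lemma fine_partition_ex s t (eta : R) : s <= t -> 0 < eta ->
  exists p, [/\ path <%R s p, last s p = t & path (fun a b => b - a <= eta) s p].
Proof.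
move=> st eta0.
have [m hm] : exists m, t - s <= m%:R * eta.
  exists (Num.truncn ((t - s) / eta)).+1.
  by rewrite -ler_pdivrMr // ltW // truncnS_gt.
elim: m s st hm => [|m IH] s st hm.
  exists [::]; split=> //=; apply/eqP; rewrite eq_le st /=.
  by move: hm; rewrite mul0r subr_le0.
case: (leP (t - s) eta) => h.
  move: st; rewrite le_eqVlt => /orP[/eqP<-|st]; first by exists [::].
  by exists [:: t]; rewrite /= st h.
have [||p [h1 h2 h3]] := IH (s + eta).
- by rewrite -lerBrDl ltW.
- by rewrite opprD addrA lerBlDr; move: hm; rewrite -natr1 mulrDl mul1r.
exists ((s + eta) :: p); split=> //=; first by rewrite ltrDl eta0.
by rewrite addrC addKr lexx.
Qed.

Lemma common_refinement s p p' : path <%R s p -> path <%R s p' -> last s p = last s p' ->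
  exists q, [/\ path <%R s q, last s q = last s p, {subset p <= q} & {subset p' <= q}].
Proof.
move=> hp hp' e.
have lt_tr : transitive (<%R : rel R) by exact: lt_trans.
pose q := sort <=%R (undup (p ++ p')).
have mq x : (x \in q) = (x \in p) || (x \in p').
  by rewrite mem_sort mem_undup mem_cat.
have sq : sorted <%R q.
  rewrite lt_sorted_uniq_le sort_uniq undup_uniq /=.
  exact: sort_le_sorted.
have hall x : x \in q -> s < x.
  rewrite mq => /orP[] hx.
    by move: hp; rewrite path_sortedE // => /andP[/allP/(_ _ hx)].
  by move: hp'; rewrite path_sortedE // => /andP[/allP/(_ _ hx)].
have hq : path <%R s q by rewrite path_sortedE // sq andbT; apply/allP.
have le_last r x : path <%R s r -> x \in r -> x <= last s r.
  move=> hr hx; case/splitPr: hx hr => r1 r2; rewrite cat_path last_cat /= => /and3P[_ _].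
  exact: path_le_last.
clearbody q; exists q; split=> // [|x hx|x hx]; [|by rewrite mq hx|by rewrite mq hx orbT].
apply/eqP; rewrite eq_le; apply/andP; split.
  case: (lastP q) hq mq => [|r x] hq mq; first exact: path_le_last.
  rewrite last_rcons; have := mq x; rewrite mem_rcons mem_head => /esym/orP[/(le_last _ _ hp)//|].
  by rewrite e; exact: le_last.
case/lastP: p hp e mq => [|r x] hp e mq; first exact: path_le_last.
rewrite last_rcons; by apply: le_last => //; rewrite mq mem_rcons mem_head.
Qed.

End FinePartitions.

Section FlowSewing.
Variables (R : realType) (n : nat) (y : R -> R -> 'rV[R]_n -> 'rV[R]_n).
Variables (T delta theta L Lam : R).
Hypothesis delta0 : 0 < delta.
Hypothesis theta0 : 0 < theta.
Hypothesis L0 : 0 <= L.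
Hypothesis Lam0 : 0 <= Lam.
Local Notation om h := (h `^ (1 + theta)).
Hypothesis y_local : forall s p x, fine_path T delta s p -> last s p - s <= delta ->
  `|scheme y s p x - y s (last s p) x| <= L * om (last s p - s).
Hypothesis y_lip : forall s p x x', fine_path T delta s p ->
  `|scheme y s p x - scheme y s p x'| <= Lam * `|x - x'|.

(** Trades the exponent above 1 for the mesh: summed over steps of length at most eta, the local
    errors amount to the total length times eta^theta. *)
Lemma om_le (h eta : R) : 0 <= h -> h <= eta -> om h <= h * eta `^ theta.
Proof.
move=> h0 he; have [->|hn0] := eqVneq h 0.
  by rewrite mul0r powR0 // gt_eqF // addr_gt0.
rewrite powRD ?hn0 ?implybT // powRr1 // ler_wpM2l //.
by apply: ge0_ler_powR; rewrite ?nnegrE ?(ltW theta0) // (le_trans h0).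
Qed.

Lemma fine_path_cons eta s t p : fine_path T eta s (t :: p) ->
  [/\ 0 <= s, s < t, t <= T, t - s <= eta & fine_path T eta t p].
Proof.
move=> [s0 /= /andP[st hp] hT /andP[h1 h2]].
have tT := le_trans (path_le_last hp) hT.
by split=> //; split=> //; rewrite (le_trans s0) // ltW.
Qed.

(** Telescoping: the error made by Z on one step is carried to the end by the rest of the scheme,
    which costs the factor Lam. *)
Lemma davie_path_scheme (Z : R -> 'rV[R]_n) C eta s p : 0 <= C -> eta <= delta ->
  (forall a b, 0 <= a -> a < b -> b <= T -> b - a <= delta -> `|Z b - y a b (Z a)| <= C * om (b - a)) ->
  fine_path T eta s p ->
  `|Z (last s p) - scheme y s p (Z s)| <= Lam * C * (last s p - s) * eta `^ theta + C * (last s p - s) * eta `^ theta.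
Proof.
move=> C0 ed hZ; elim: p s => [|t p IH] s hp /=.
  by rewrite !subrr normr0 !mulr0 !mul0r addr0.
have [s0 st tT ts htp] := fine_path_cons hp.
have tl : t <= last t p by case: htp => _ /path_le_last.
have hst : `|Z t - y s t (Z s)| <= C * ((t - s) * eta `^ theta).
  apply: (le_trans (hZ s t s0 st tT (le_trans ts ed))); apply: ler_wpM2l => //.
  by apply: om_le => //; rewrite subr_ge0 ltW.
rewrite -(subrKA (scheme y t p (Z t))) (le_trans (ler_normD _ _)) //.
have h1 := IH t htp.
have h2 := y_lip (Z t) (y s t (Z s)) (fine_path_le ed htp).
have h3 := ler_wpM2l Lam0 hst.
apply: (le_trans (lerD h1 (le_trans h2 h3))).
have e1 : 0 <= C * ((t - s) * eta `^ theta) by rewrite !mulr_ge0 ?powR_ge0 // subr_ge0 ltW.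
have -> : Lam * C * (last t p - s) * eta `^ theta + C * (last t p - s) * eta `^ theta =
  Lam * C * (last t p - t) * eta `^ theta + C * (last t p - t) * eta `^ theta +
  (Lam * (C * ((t - s) * eta `^ theta)) + C * ((t - s) * eta `^ theta)) by ring.
by rewrite lerD2l lerDl.
Qed.

(** Step by step, the part of the refinement inside one interval of p is compared with a single
    Euler map by [y_local], and the difference is carried to the end by [y_lip]. *)
Lemma scheme_refinement eta s p q x : eta <= delta -> fine_path T eta s p ->
  path <%R s q -> last s q = last s p -> {subset p <= q} ->
  fine_path T eta s q /\
  `|scheme y s q x - scheme y s p x| <= Lam * L * (last s p - s) * eta `^ theta.
Proof.
move=> ed; elim: p s q x => [|t p IH] s q x hp hq hl sq.
  case: q hq hl sq => [|u q] hq hl sq; first by rewrite /= subrr normr0 subrr !(mulr0, mul0r).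
  move: hq => /= /andP[su /path_le_last]; rewrite -[last u q]/(last s (u :: q)) hl /=.
  by move=> /(lt_le_trans su); rewrite ltxx.
have [s0 st tT ts htp] := fine_path_cons hp.
have tl : t <= last t p by case: htp => _ /path_le_last.
have tq : t \in q by apply: sq; rewrite mem_head.
case/splitPr: tq hq hl sq => q1 q2 hq hl sq.
have hq1 : path <%R s (rcons q1 t).
  by move: hq; rewrite -cat_rcons cat_path => /andP[].
have hq2 : path <%R t q2.
  by move: hq; rewrite -cat_rcons cat_path last_rcons => /andP[].
have hl2 : last t q2 = last t p by move: hl; rewrite last_cat.
have sub2 : {subset p <= q2}.
  move=> u hu; have := sq u; rewrite inE hu orbT => /(_ isT).
  have tu : t < u.
    have [_ hp' _ _] := htp; move: hp'; rewrite path_sortedE; last exact: lt_trans.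
    by move=> /andP[/allP/(_ _ hu)].
  rewrite -cat_rcons mem_cat => /orP[hu1|//].
  have : u <= last s (rcons q1 t).
    case/splitPr: hu1 hq1 => r1 r2; rewrite cat_path last_cat /= => /and3P[_ _].
    exact: path_le_last.
  by rewrite last_rcons leNgt tu.
have [hf2 h2] := IH t q2 (scheme y s (rcons q1 t) x) htp hq2 hl2 sub2.
have hs1 : path (fun a b => b - a <= eta) s (rcons q1 t).
  by apply: path_steps_le => //; rewrite last_rcons.
have hf1 : fine_path T eta s (rcons q1 t) by split=> //; rewrite last_rcons.
split.
  split=> //; first by rewrite hl; case: hp.
  rewrite -cat_rcons cat_path hs1 last_rcons /=; by case: hf2.
rewrite -cat_rcons scheme_cat last_rcons /=.
rewrite -(subrKA (scheme y t p (scheme y s (rcons q1 t) x))) (le_trans (ler_normD _ _)) //.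
have h3 := y_lip (scheme y s (rcons q1 t) x) (y s t x) (fine_path_le ed htp).
have := @y_local s (rcons q1 t) x (fine_path_le ed hf1); rewrite last_rcons => h4.
have h5 := om_le (etrans (subr_ge0 _ _) (ltW st)) ts.
have h6 := ler_wpM2l Lam0 (le_trans (h4 (le_trans ts ed)) (ler_wpM2l L0 h5)).
apply: (le_trans (lerD h2 (le_trans h3 h6))).
by rewrite le_eqVlt; apply/orP; left; apply/eqP; ring.
Qed.

Lemma scheme_cauchy eta eta' s p p' x : eta <= delta -> eta' <= delta ->
  fine_path T eta s p -> fine_path T eta' s p' -> last s p = last s p' ->
  `|scheme y s p x - scheme y s p' x|
  <= Lam * L * (last s p - s) * (eta `^ theta + eta' `^ theta).
Proof.
move=> ed ed' hp hp' e.
have [_ h1 _ _] := hp; have [_ h1' _ _] := hp'.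
have [q [hq hl sub1 sub2]] := common_refinement h1 h1' e.
have [_ b1] := scheme_refinement x ed hp hq hl sub1.
have [_ b2] := scheme_refinement x ed' hp' hq (etrans hl e) sub2.
rewrite -(subrKA (scheme y s q x)) (le_trans (ler_normD _ _)) // mulrDr lerD //.
  by rewrite distrC.
by rewrite e.
Qed.

(** The rate holds for every partition of mesh eta and not only along the chosen sequence; the
    properties of the flow are all read off from it. *)
Lemma flow_limit x t : 0 <= t <= T -> exists X, forall eta p, 0 < eta -> eta <= delta ->
  fine_path T eta 0 p -> last 0 p = t ->
  `|X - scheme y 0 p x| <= Lam * L * t * eta `^ theta.
Proof.
move=> /andP[t0 tT].
have etam m : 0 < delta / m.+1%:R by rewrite divr_gt0 // ltr0n.
have etad m : delta / m.+1%:R <= delta.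
  by rewrite ler_pdivrMr ?ltr0n // ler_peMr ?(ltW delta0) // ler1n.
have /choice[P hP] : forall m, exists p, fine_path T (delta / m.+1%:R) 0 p /\ last 0 p = t.
  move=> m; have [p [h1 h2 h3]] := fine_partition_ex t0 (etam m).
  by exists p; split=> //; split=> //; rewrite h2.
pose u m := scheme y 0 (P m) x.
have key m eta p : eta <= delta -> fine_path T eta 0 p -> last 0 p = t ->
    `|u m - scheme y 0 p x| <= Lam * L * t * ((delta / m.+1%:R) `^ theta + eta `^ theta).
  move=> ed hp hl; have [hPm lPm] := hP m.
  by have := scheme_cauchy x (etad m) ed hPm hp (etrans lPm (esym hl)); rewrite lPm subr0.
have K0 : 0 <= Lam * L * t by rewrite !mulr_ge0.
have small e : 0 < e -> exists M, forall m, (M <= m)%N ->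
    Lam * L * t * (delta / m.+1%:R) `^ theta <= e.
  move=> e0; have e1 : 0 < e / (Lam * L * t + 1) by rewrite divr_gt0 // ltr_pwDr.
  have [eta [/andP[eta0 _] heta]] := powR_small theta0 e1.
  exists (Num.truncn (delta / eta)).+1 => m hm.
  have hme : delta / m.+1%:R <= eta.
    rewrite ler_pdivrMr ?ltr0n // mulrC -ler_pdivrMr //.
    apply: (le_trans (ltW (truncnS_gt _))); rewrite ler_nat; exact: leqW.
  apply: (le_trans (ler_wpM2l K0 (heta _ (ltW (etam m)) hme))).
  by rewrite mulrCA ler_piMr ?(ltW e0) // ler_pdivrMr ?mul1r ?lerDl // ltr_pwDr.
have cu : cauchy (u @ \oo).
  apply: cauchy_exP => e e0.
  have e4 : 0 < e / 4 by rewrite divr_gt0.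
  have [M hM] := small (e / 4) e4.
  exists (u M); exists M => // m /= h; rewrite -ball_normE /=.
  have [hPm lPm] := hP m.
  apply: (le_lt_trans (key M _ _ (etad m) hPm lPm)).
  rewrite mulrDr (le_lt_trans (lerD (hM M (leqnn _)) (hM m h))) //; lra.
have /cvg_ex[X hX] : cvg (u @ \oo) by exact: cauchy_cvg.
exists X => eta p eta0 ed hp hl.
apply/ler_addgt0Pr => e e0.
have e2 : 0 < e / 2 by rewrite divr_gt0.
have [M hM] := small (e / 2) e2.
have /cvgrPdist_lt/(_ _ e2)[M' _ hM'] := hX.
pose m := maxn M M'.
have h1 : `|X - u m| < e / 2 by apply: hM'; rewrite /= leq_maxr.
have h2 := key m eta p ed hp hl.
have h3 := hM m (leq_maxl _ _).
rewrite -(subrKA (u m)) (le_trans (ler_normD _ _)) //.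
apply: (le_trans (lerD (ltW h1) h2)).
rewrite mulrDr addrA addrC lerD2l.
by rewrite (le_trans (lerD (lexx _) h3)) // -splitr.
Qed.

Lemma fine_zero_limit (a b : R) : 0 <= b ->
  (forall eta, 0 < eta -> eta <= delta -> a <= b * eta `^ theta) -> a <= 0.
Proof.
move=> b0 h; apply/ler_addgt0Pr => e e0; rewrite add0r.
have b1 : 0 < b + 1 by rewrite ltr_pwDr.
have e1 : 0 < e / (b + 1) by rewrite divr_gt0.
have [eta [/andP[eta0 _] heta]] := powR_small theta0 e1.
pose m := Num.min eta delta.
have m0 : 0 < m by rewrite lt_min eta0.
apply: (le_trans (h m m0 _)); first by rewrite ge_min lexx orbT.
have hm : m <= eta by rewrite ge_min lexx.
apply: (le_trans (ler_wpM2l b0 (heta _ (ltW m0) hm))).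
by rewrite mulrCA ler_piMr ?(ltW e0) // ler_pdivrMr // mul1r lerDl.
Qed.

Definition davie_path (C : R) (Z : R -> 'rV[R]_n) :=
  forall a b, 0 <= a -> a < b -> b <= T -> b - a <= delta -> `|Z b - y a b (Z a)| <= C * om (b - a).

(** Both paths are within O(eta^theta) of one and the same scheme issued from the common starting
    point. *)
Lemma davie_path_unique C C' Z Z' : 0 <= C -> 0 <= C' -> davie_path C Z -> davie_path C' Z' ->
  Z 0 = Z' 0 -> forall t, 0 <= t <= T -> Z t = Z' t.
Proof.
move=> C0 C0' hZ hZ' e t /andP[t0 tT].
apply/eqP; rewrite -subr_eq0 -normr_le0.
apply: (@fine_zero_limit _ (Lam * C * t + C * t + (Lam * C' * t + C' * t))).
  by rewrite !addr_ge0 // !mulr_ge0.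
move=> eta eta0 ed.
have [p [h1 h2 h3]] := fine_partition_ex t0 eta0.
have hp : fine_path T eta 0 p by split=> //; rewrite h2.
have b1 := davie_path_scheme C0 ed hZ hp; have b2 := davie_path_scheme C0' ed hZ' hp.
rewrite h2 subr0 in b1; rewrite h2 subr0 -e in b2.
rewrite -(subrKA (scheme y 0 p (Z 0))) (le_trans (ler_normD _ _)) // !mulrDl.
by rewrite lerD // distrC.
Qed.

Lemma flow_sewing : exists X : 'rV[R]_n -> R -> 'rV[R]_n,
  [/\ forall x, X x 0 = x, forall x, davie_path L (X x) &
    (forall x x' t, 0 <= t <= T -> `|X x t - X x' t| <= Lam * `|x - x'|)].
Proof.
have /choice[X hX] : forall a : 'rV[R]_n * R, exists X, 0 <= a.2 <= T ->
   forall eta p, 0 < eta -> eta <= delta ->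
  fine_path T eta 0 p -> last 0 p = a.2 ->
  `|X - scheme y 0 p a.1| <= Lam * L * a.2 * eta `^ theta.
  move=> [x t] /=; case: (boolP (0 <= t <= T)) => h; last by exists 0.
  by have [X hX] := flow_limit x h; exists X.
have LL0 : 0 <= Lam * L by rewrite mulr_ge0.
exists (fun x t => if 0 <= t <= T then X (x, t) else x).
split=> [x|x s t s0 st tT ts|x x' t ht].
- case: ifP => // /andP[h0 hT]; have := hX (x, 0); rewrite /= h0 hT => /(_ isT delta [::] delta0 (lexx _)).
  by rewrite /= mulr0 mul0r normr_le0 subr_eq0 => h; apply/eqP/h.
- have t0 : 0 <= t by rewrite (le_trans s0) // ltW.
  have sT : s <= T by rewrite (le_trans _ tT) // ltW.
  rewrite s0 t0 sT tT /= -subr_le0.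
  apply: (@fine_zero_limit _ (Lam * L * t + Lam * (Lam * L * s))).
    by rewrite addr_ge0 // !mulr_ge0.
  move=> eta eta0 ed.
  (* [0, s] and [s, t] are partitioned separately, so that the scheme up to t passes through the
     scheme up to s. *)
  have [p1 [h1 h2 h3]] := fine_partition_ex s0 eta0.
  have [p2 [h1' h2' h3']] := fine_partition_ex (ltW st) eta0.
  have hp1 : fine_path T eta 0 p1 by split=> //; rewrite h2.
  have hp2 : fine_path T eta s p2 by split=> //; rewrite h2'.
  have hp : fine_path T eta 0 (p1 ++ p2).
    by split=> //; rewrite ?cat_path ?last_cat h2 ?h2' ?h1 ?h3.
  have b1 := hX (x, s); rewrite /= s0 sT in b1; have {}b1 := b1 isT eta p1 eta0 ed hp1 h2.
  have b2 := hX (x, t); rewrite /= t0 tT in b2.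
  have {}b2 := b2 isT eta _ eta0 ed hp; rewrite last_cat h2 scheme_cat h2 in b2.
  have {}b2 := b2 h2'; set z := scheme y 0 p1 x in b1 b2.
  have b3 := @y_local s p2 z (fine_path_le ed hp2); rewrite h2' in b3; have {}b3 := b3 ts.
  have hst : fine_path T delta s [:: t] by split=> //=; rewrite ?st ?ts.
  have b4 := y_lip (X (x, s)) z hst; rewrite /= distrC in b4.
  have -> : X (x, t) - y s t (X (x, s)) = (X (x, t) - scheme y s p2 z) +
     ((scheme y s p2 z - y s t z) + (y s t z - y s t (X (x, s)))).
    by rewrite !subrKA.
  rewrite lerBlDr (le_trans (ler_normD _ _)) // (le_trans (lerD b2 (ler_normD _ _))) //.
  rewrite (le_trans (lerD (lexx _) (lerD b3 (le_trans b4 (ler_wpM2l Lam0 b1))))) //.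
  by rewrite le_eqVlt; apply/orP; left; apply/eqP; ring.
rewrite ht -subr_le0; have /andP[t0 tT] := ht.
apply: (@fine_zero_limit _ (Lam * L * t + Lam * L * t)); first by rewrite addr_ge0 // !mulr_ge0.
move=> eta eta0 ed.
have [p [h1 h2 h3]] := fine_partition_ex t0 eta0.
have hp : fine_path T eta 0 p by split=> //; rewrite h2.
have b1 := hX (x, t) ht eta p eta0 ed hp h2.
have b2 := hX (x', t) ht eta p eta0 ed hp h2.
have b3 := y_lip x x' (fine_path_le ed hp).
rewrite /= in b1 b2; rewrite distrC in b2.
have -> : X (x, t) - X (x', t) = (X (x, t) - scheme y 0 p x) +
  ((scheme y 0 p x - scheme y 0 p x') + (scheme y 0 p x' - X (x', t))) by rewrite !subrKA.
rewrite lerBlDr (le_trans (ler_normD _ _)) // (le_trans (lerD b1 (ler_normD _ _))) //.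
rewrite (le_trans (lerD (lexx _) (lerD b3 b2))) //.
by rewrite le_eqVlt; apply/orP; left; apply/eqP; ring.
Qed.

End FlowSewing.

(** * The flow of the rough differential equation *)

Section Exponents.
Variables (R : realType) (gamma : R).
Hypothesis hgamma : 0 < gamma < 1.

Definition excess : R := (Ngamma gamma).+1%:R * gamma - 1.

Lemma Ngamma_gt0 : (0 < Ngamma gamma)%N.
Proof.
have /andP[g0 g1] := hgamma; rewrite /Ngamma lt0n; apply/negP => /eqP e.
have := truncnS_gt gamma^-1; rewrite e ltNge => /negP; apply.
by rewrite invf_ge1 // ltW.
Qed.

Lemma excess_gt0 : 0 < excess.
Proof.
have /andP[g0 g1] := hgamma; rewrite /excess subr_gt0 -ltr_pdivrMr // mul1r.
exact: truncnS_gt.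
Qed.

Lemma powR_natmul (h : R) k : (h `^ gamma) ^+ k = h `^ (k%:R * gamma).
Proof. by rewrite mulrC powRrM powR_mulrn // powR_ge0. Qed.

Lemma powR_excess (h : R) : (h `^ gamma) ^+ (Ngamma gamma).+1 = h `^ (1 + excess).
Proof. by rewrite powR_natmul /excess addrC subrK. Qed.

Lemma half_excess : (2^-1 `^ gamma) ^+ (Ngamma gamma).+1 < 2^-1 :> R.
Proof.
rewrite powR_excess powRD; last by rewrite invr_eq0 pnatr_eq0 implybT.
rewrite powRr1 ?invr_ge0 // gtr_pMr ?invr_gt0 //.
apply: (@lt_le_trans _ _ (1 `^ excess)); last by rewrite powR1.
by apply: gt0_ltr_powR; rewrite ?nnegrE ?excess_gt0 //; lra.
Qed.

End Exponents.

Section RoughPathIncrements.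
Variables (R : realType) (d : nat) (T gamma : R) (W : R -> word d -> R).
Hypothesis hW : geometric_rough_path T gamma W.

Lemma rough_path_increments : exists C, rough_increments (Ngamma gamma) T gamma C (increment gamma W).
Proof.
have itv s t : 0 <= s -> s <= t -> t <= T -> (0 <= s <= T) * (0 <= t <= T).
  by move=> s0 st tT; rewrite s0 tT (le_trans st) // (le_trans s0).
have hnil s t : 0 <= s -> s <= t -> t <= T -> increment gamma W s t [::] = 1.
  by move=> s0 st tT; have [h1 h2] := itv _ _ s0 st tT; have [_ ->] := increment_in_group hW h1 h2.
have /choice[C hC] : forall v : (Ngamma gamma).-bseq 'I_d, exists C : R, forall s t,
    0 <= s -> s <= t -> t <= T -> `|increment gamma W s t v| <= C * ((t - s) `^ gamma) ^+ size v.
  move=> v; have [_ /(_ v (size_bseq v))[C hC]] := hW.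
  (* The Hoelder bound is given for s != t only; at s = t the empty word has coordinate 1 and
     requires a constant of at least 1. *)
  exists (Num.max C 1) => s t s0 st tT.
  have [h1 h2] := itv _ _ s0 st tT.
  move: st; rewrite le_eqVlt => /orP[/eqP est|st].
    rewrite -est subrr (increment_refl hW h1) /star_one.
    case: (eqVneq (bseqval v) [::]) => [->|nv]; rewrite ?eqxx ?(negbTE nv) /=.
      by rewrite normr1 expr0 mulr1 le_max lexx orbT.
    by rewrite normr0 mulr_ge0 ?exprn_ge0 ?powR_ge0 // le_max ler01 orbT.
  apply: (le_trans (hC s t h1 h2 _)); first by rewrite lt_eqF.
  rewrite gtr0_norm ?subr_gt0 // powR_natmul ler_wpM2r ?powR_ge0 //.
  by rewrite le_max lexx.
have S0 : 0 <= \sum_v `|C v| by exact: sumr_ge0.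
exists (\sum_v `|C v|); split=> //.
- by move=> s v hs; rewrite (increment_refl hW hs).
- move=> s t u v s0 st tu uT hv.
  have [h1 h2] := itv _ _ s0 st (le_trans tu uT).
  have [_ h3] := itv _ _ (le_trans s0 st) tu uT.
  by rewrite (increment_chen hW h1 h2 h3) starE.
- move=> s t u v s0 st tT huv; have [h1 h2] := itv _ _ s0 st tT.
  by have [_ _] := increment_in_group hW h1 h2; exact.
move=> s t v s0 st tT hv; apply: (le_trans (hC (Bseq hv) s t s0 st tT)).
apply: ler_wpM2r; first by rewrite exprn_ge0 ?powR_ge0.
by rewrite (le_trans (ler_norm _)) // (bigD1 (Bseq hv)) //= lerDl sumr_ge0.
Qed.

End RoughPathIncrements.

Lemma setT_good_domain (R : realType) n : good_domain (fun _ : R => [set: 'rV[R]_n]).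
Proof. by split. Qed.

Section EulerFlow.
Variables (R : realType) (d n : nat) (T gamma Cw : R) (w : R -> R -> word d -> R).
Variable f : 'I_d -> 'rV[R]_n -> 'rV[R]_n.
Hypothesis hgamma : 0 < gamma < 1.
Local Notation N := (Ngamma gamma).
Hypothesis hw : rough_increments N T gamma Cw w.
Hypothesis hf : Cbdv N.+1 setT f.
Local Notation y := (euler N f w).
Local Notation theta := (excess gamma).

Lemma setT_no_explosion : no_explosion N T w f (fun=> setT).
Proof. by move=> r; exists r, 1; split=> // s p x _ _; exact: stays_setT. Qed.

Lemma euler_flow : exists delta L Lam, [/\ 0 < delta <= 1, 0 <= L, 0 <= Lam,
  (forall s p x, fine_path T delta s p -> last s p - s <= delta ->
     `|scheme y s p x - y s (last s p) x| <= L * (last s p - s) `^ (1 + theta)) &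
  (forall s p x x', fine_path T delta s p ->
     `|scheme y s p x - scheme y s p x'| <= Lam * `|x - x'|)].
Proof.
have /andP[g0 _] := hgamma.
have hfN r : Cbdv N ((fun _ : R => [set: 'rV[R]_n]) r) f by move=> j; exact: CbdW.
have [delta [L [/andP[d0 d1] L0 h1]]] := euler_local hw g0 (setT_good_domain R n) hfN (half_excess hgamma) 0.
have [r' [delta' [d0' h2]]] := tangent_no_explosion hw g0 (half_excess hgamma)
  (setT_good_domain R n) (fun=> hf) setT_no_explosion 1.
exists (Num.min delta delta'), L, `|r'|; split=> //.
- by rewrite lt_min d0 d0' /= ge_min d1.
- move=> s p x [s0 hp hT _] hd.
  have hd' : last s p - s <= delta by apply: le_trans hd _; rewrite ge_min lexx.
  by have [_ _] := h1 s p x s0 hp hT hd' Logic.I; rewrite powR_excess.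
move=> s p x x' hp.
have hf0 : Cbdv N.+1 set0 f by exact: (Cbdv_smooth (D := setT)).
have hp' : fine_path T delta' s p by apply: fine_path_le hp; rewrite ge_min lexx orbT.
have bd z v : `|'d (scheme y s p) z v| <= `|r'| * `|v|.
  have [->|vn0] := eqVneq v 0; first by rewrite linear0 !normr0 mulr0.
  have hh : 0 < `|v| by rewrite normr_gt0.
  have eh : v = `|v| *: (`|v|^-1 *: v) by rewrite scalerA mulfV ?scale1r // gt_eqF.
  rewrite {1}eh linearZ normrZ normr_id mulrC ler_pM2r //.
  have hz : tangent_domain (fun=> setT) 1 (row_mx z (`|v|^-1 *: v)).
    by split=> //; rewrite row_mxKr normrZ normfV normr_id mulVf ?gt_eqF.
  have := stays_end (h2 s p _ hp' hz); rewrite (scheme_tangent w hf0 _ _ _ _).2 => -[_].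
  by rewrite row_mxKr => h; rewrite (le_trans h) // ler_norm.
have ds z : differentiable (scheme y s p) z := (scheme_tangent w hf0 s p z 0).1.
apply: norm_rV_le => [|j]; first by rewrite mulr_ge0.
have dsj z : differentiable (fun u => scheme y s p u 0 j) z by exact: differentiable_coordE.
have [c _ e] := mvt_line x' (x - x') dsj.
rewrite [x' + _]addrC subrK in e.
have -> : (scheme y s p x - scheme y s p x') 0 j = scheme y s p x 0 j - scheme y s p x' 0 j.
  by rewrite !mxE.
rewrite e -(diff_coord _ _ (ds _)).
exact: le_trans (norm_coord_le _ _) (bd _ _).
Qed.

End EulerFlow.

(** * Sewing of additive germs *)

Section AdditiveSewing.
Variables (R : realType) (n : nat) (T theta C : R) (Xi : R -> R -> 'rV[R]_n).
Hypothesis theta0 : 0 < theta.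
Hypothesis C0 : 0 <= C.
Local Notation om h := (h `^ (1 + theta)).
Hypothesis Xi0 : forall s, 0 <= s <= T -> Xi s s = 0.
Variable delta : R.
Hypothesis delta0 : 0 < delta.
Hypothesis Xi_defect : forall s t u, 0 <= s -> s <= t -> t <= u -> u <= T -> u - s <= delta ->
  `|Xi s u - Xi s t - Xi t u| <= C * om (u - s).

(** Translations by the germ: their compositions are the Riemann sums, so the sewing lemma for sums
    is the case of [flow_sewing] with Lipschitz constant 1. *)
Let y (s t : R) (z : 'rV[R]_n) := z + Xi s t.

Lemma additive_scheme s p x : scheme y s p x = x + scheme y s p 0.
Proof.
elim: p s x => [|t p IH] s x /=; first by rewrite addr0.
by rewrite IH [in RHS]IH /y add0r addrA.
Qed.

Lemma sum_additive_scheme b s p :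
  \sum_(0 <= k < size p) Xi (nth b (s :: p) k) (nth b (s :: p) k.+1) = scheme y s p 0.
Proof.
elim: p s => [|t p IH] s; first by rewrite big_geq.
by rewrite big_nat_recl //= IH [in RHS]additive_scheme /y add0r.
Qed.

Lemma additive_sewing : exists L Z, [/\ 0 <= L, Z 0 = 0,
  forall s t, 0 <= s -> s < t -> t <= T -> t - s <= delta -> `|Z t - Z s - Xi s t| <= L * om (t - s) &
  forall t e, 0 <= t <= T -> 0 < e -> exists2 r, 0 < r & forall p, itv_partition 0 t p -> mesh 0 p < r ->
    `|\sum_(0 <= k < size p) Xi (nth 0 (0 :: p) k) (nth 0 (0 :: p) k.+1) - Z t| < e].
Proof.
pose kappa := 2^-1 `^ (1 + theta) : R.
have k0 : 0 <= kappa := powR_ge0 _ _.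
have khalf : kappa < 2^-1.
  rewrite /kappa powRD; last by rewrite invr_eq0 pnatr_eq0 implybT.
  rewrite powRr1 ?invr_ge0 // gtr_pMr ?invr_gt0 //.
  apply: (@lt_le_trans _ _ (1 `^ theta)); last by rewrite powR1.
  by apply: gt0_ltr_powR; rewrite ?nnegrE //; lra.
(* The solution of 2 kappa L + 2 C = L, the condition of [scheme_one_step] for eps = 0. *)
pose L := C * 2 / (1 - 2 * kappa).
have L0 : 0 <= L by apply: divr_ge0; [exact: mulr_ge0|lra].
have yss s x : 0 <= s <= T -> y s s x = x by move=> hs; rewrite /y Xi0 // addr0.
have y_lip s p x x' : fine_path T delta s p ->
    `|scheme y s p x - scheme y s p x'| <= 1 * `|x - x'|.
  by move=> _; rewrite additive_scheme [scheme y s p x']additive_scheme opprD addrACA subrr addr0 mul1r.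
have y_local s p x : fine_path T delta s p -> last s p - s <= delta ->
    `|scheme y s p x - y s (last s p) x| <= L * om (last s p - s).
  move=> [s0 hp hT _] hd.
  have := @scheme_one_step R _ y (fun h => om h) T delta kappa 0 C L setT setT (lexx _) C0 L0.
  apply => //; try by [exact: stays_setT].
  - move=> h h' h0 hh' _; rewrite powR_ge0 /=.
    by apply: ge0_ler_powR; rewrite ?nnegrE ?addr_ge0 ?(ltW theta0) // (le_trans h0).
  - by move=> h h0 _; rewrite powRM // mulrC.
  - move=> s' t x1 x2 _ _ _ _ _ _; rewrite addr0 mul1r.
    by rewrite opprD addrACA subrr addr0.
  - move=> s' t u x1 h1 h2 h3 h4 h5 _.
    have -> : y t u (y s' t x1) - y s' u x1 = - (Xi s' u - Xi s' t - Xi t u).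
      by rewrite /y -[x1 + _ + _]addrA opprD addrACA subrr add0r !opprB addrCA addrA.
    by rewrite normrN Xi_defect.
  have -> : L * (1 + (1 + 0) ^+ 2) * kappa + C * (2 + 0) = L * (2 * kappa) + C * 2.
    by rewrite !addr0; ring.
  have -> : C * 2 = L * (1 - 2 * kappa) by rewrite /L mulfVK //; apply/eqP; lra.
  by rewrite -mulrDr [2 * kappa + _]addrC subrK mulr1.
have [X [hX0 hX hXl]] := flow_sewing delta0 theta0 L0 ler01 y_local y_lip.
exists L, (X 0); split=> //.
- move=> s t s0 st tT ts; have := hX 0 s t s0 st tT ts.
  by rewrite /y opprD addrA.
move=> t e /andP[t0 tT] e0.
have b0 : 0 <= 2 * L * t by apply: mulr_ge0 => //; apply: mulr_ge0.
have b1 : 0 < 2 * L * t + 1 by apply: (le_lt_trans b0); rewrite ltrDl.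
have c1 : 0 < e / (2 * L * t + 1) by rewrite divr_gt0.
have [eta [/andP[eta0 _] heta]] := powR_small theta0 c1.
pose r := Num.min eta delta.
have r0 : 0 < r by rewrite lt_min eta0.
exists r => // p [hp /eqP hl] hm.
have hr : r <= eta by rewrite ge_min lexx.
have hfine : fine_path T r 0 p.
  split=> //; first by rewrite hl.
  apply/(pathP 0) => i hi; apply: (le_trans _ (ltW hm)).
  rewrite /mesh big_mkord.
  exact: (le_bigmax _ (fun k : 'I_(size p) => nth 0 (0 :: p) k.+1 - nth 0 (0 :: p) k) (Ordinal hi)).
have rd : r <= delta by rewrite ge_min lexx orbT.
have := davie_path_scheme theta0 ler01 y_lip L0 rd (hX 0) hfine.
rewrite sum_additive_scheme hX0 hl subr0 mul1r distrC => h.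
apply: (le_lt_trans h).
have -> : L * t * r `^ theta + L * t * r `^ theta = 2 * L * t * r `^ theta by ring.
apply: (le_lt_trans (ler_wpM2l b0 (heta _ (ltW r0) hr))).
by rewrite mulrCA gtr_pMr // ltr_pdivrMr // mul1r ltrDl.
Qed.

End AdditiveSewing.

(** * Expansion along the flow and rough integrals *)

Lemma sum_dec_rcons (A : Type) (V : nmodType) (v : seq A) i (F : seq A * seq A -> V) :
  \sum_(p <- dec (rcons v i)) F p = \sum_(p <- dec v) F (p.1, rcons p.2 i) + F (rcons v i, [::]).
Proof.
elim: v F => [|a v IH] F; first by rewrite sum_dec_cons !sum_dec_nil.
rewrite rcons_cons sum_dec_cons (IH (fun p => F (a :: p.1, p.2))).
by rewrite [in RHS]sum_dec_cons addrA.
Qed.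

Lemma sum_bseqS_rcons (d : nat) (V : nmodType) N (G : word d -> V) :
  \sum_(v : N.+1.-bseq 'I_d) G v = G [::] + \sum_(i < d) \sum_(v : N.-bseq 'I_d) G (rcons v i).
Proof.
rewrite (@sum_bseq_seq _ _ _ _ ([::] :: [seq rcons u i | i <- index_enum 'I_d, u <- words d N])).
- rewrite big_cons; congr (_ + _).
  rewrite big_allpairs_dep; apply: eq_bigr => i _.
  by rewrite (sum_bseq_words N (fun v => G (rcons v i))).
- rewrite cons_uniq; apply/andP; split.
    by apply/negP => /allpairsP[[i [|a u]]] /= [].
  apply: allpairs_uniq; rewrite ?index_enum_uniq ?words_uniq //.
  by move=> [i u] [j v] _ _ /= /rcons_inj[-> ->].
move=> v; case/lastP: v => [|u i]; first by rewrite mem_head.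
rewrite inE size_rcons ltnS -mem_words.
have -> : (rcons u i == [::]) = false by case: u.
apply/allpairsP/idP => [[[j v]] /= [_ hv /rcons_inj[-> _]]//|hw].
by exists (i, u); split => //=; rewrite mem_index_enum.
Qed.

Section PathExpansion.
Variables (R : realType) (d n : nat) (T gamma Cw : R) (w : R -> R -> word d -> R).
Variable f : 'I_d -> 'rV[R]_n -> 'rV[R]_n.
Hypothesis hgamma : 0 < gamma < 1.
Local Notation N := (Ngamma gamma).
Hypothesis hw : rough_increments N T gamma Cw w.
Hypothesis hf : Cbdv N setT f.
Hypothesis T0 : 0 < T.
Local Notation y := (euler N f w).
Local Notation q s t := ((t - s) `^ gamma).

Lemma gamma_ge0 : 0 <= gamma.
Proof. by case/andP: hgamma => /ltW. Qed.

Lemma q_far (delta s t : R) k : 0 < delta -> delta <= t - s ->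
  1 <= (q 0 delta ^+ k)^-1 * q s t ^+ k.
Proof.
move=> d0 h; rewrite subr0 mulrC -[leLHS](mulfV (x := (delta `^ gamma) ^+ k)).
  rewrite ler_pM2r ?invr_gt0 ?exprn_gt0 ?powR_gt0 //.
  apply: lerXn2r; rewrite ?nnegrE ?powR_ge0 //.
  by apply: ge0_ler_powR; rewrite ?gamma_ge0 ?nnegrE ?(ltW d0) // (le_trans (ltW d0)).
by rewrite gt_eqF // exprn_gt0 // powR_gt0.
Qed.

Lemma q_leT s t : 0 <= s -> s <= t -> t <= T -> q s t <= q 0 T.
Proof. by move=> s0 st tT; apply: q_mono => //; case/andP: hgamma. Qed.

(** The constant is chosen before the path because it must serve all trajectories of the flow at
    once when the expansion is integrated against a measure. Any path that follows the Euler maps to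
    an order above M inherits their expansion, as g is Lipschitz. *)
Lemma path_expansion I (g : I -> 'rV[R]_n -> R) M m (L delta : R) :
  (M < m)%N -> (M <= N)%N -> 0 < delta -> 0 <= L -> Cbd M.+1 setT g ->
  exists C, 0 <= C /\ forall X : R -> 'rV[R]_n,
    (forall s t, 0 <= s -> s < t -> t <= T -> t - s <= delta ->
       `|X t - y s t (X s)| <= L * q s t ^+ m) ->
    forall i s t, 0 <= s -> s <= t -> t <= T ->
      `|g i (X t) - \sum_(v : M.-bseq 'I_d) w s t v * Gamma f v (g i) (X s)| <= C * q s t ^+ M.+1.
Proof.
move=> Mm MN d0 L0 hg; have C0 := ri_ge0 hw.
have cT : convex_domain [set: 'rV[R]_n] by [].
have [Lg [Lg0 hLg]] := Cbd_lipschitz cT hg.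
have [Ce [Ce0 hCe]] := euler_expansion hw gamma_ge0 hf MN (fun x v _ _ => Logic.I : setT (x + v)) hg.
have [Cm [Cm0 hCm]] := euler_move hw gamma_ge0 hf.
have hGam : forall v : M.-bseq 'I_d, xpredT v -> exists B, forall (p : I * 'rV[R]_n), setT p ->
    `|Gamma f v (g p.1) p.2| <= B.
  move=> v _.
  have hG : Cbd 0 setT (fun i => Gamma f v (g i)).
    apply: (Cbd_Gamma (K := N)) => //; first by rewrite addn0 (leq_trans (size_bseq v)) // leqW.
    by apply: Cbd_le hg; rewrite addn0 leqW ?size_bseq.
  by have [B [_ hB]] := Cbd_bounded hG; exists B => p _; exact: hB.
have [B [B0 hB]] := fin_bound hGam.
have [Bg [Bg0 hBg]] := Cbd_bounded hg.
have c1 : 0 < (Cm + 1)^-1 by rewrite invr_gt0 ltr_pwDr.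
have [d1 [/andP[d10 d11] hd1]] := powR_small (andP hgamma).1 c1.
pose dd := Num.min delta d1.
have dd0 : 0 < dd by rewrite lt_min d0.
have qT0 : 0 <= q 0 T := powR_ge0 _ _.
pose K := Bg + \sum_(v : M.-bseq 'I_d) Cw * (q 0 T ^+ size v) * B.
have K0 : 0 <= K.
  by apply: addr_ge0 => //; apply: sumr_ge0 => v _; rewrite !mulr_ge0 ?exprn_ge0.
have D0 : 0 <= (q 0 dd ^+ M.+1)^-1 by rewrite invr_ge0 exprn_ge0 ?powR_ge0.
exists (Lg * L + Ce + K * (q 0 dd ^+ M.+1)^-1).
split; first by rewrite !addr_ge0 ?mulr_ge0.
move=> X hX i s t s0; rewrite le_eqVlt => /orP[/eqP<-|st] tT.
  have -> : \sum_(v : M.-bseq 'I_d) w s s v * Gamma f v (g i) (X s) = g i (X s).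
    rewrite (sum_bseq_nil _ (fun v => w s s v * Gamma f v (g i) (X s))).
    rewrite (ri_refl hw) ?s0 // mul1r big1 ?addr0 // => v hv.
    by rewrite (ri_refl hw) ?s0 // (negbTE hv) mul0r.
  by rewrite subrr normr0 !mulr_ge0 ?addr_ge0 ?mulr_ge0 ?exprn_ge0 ?powR_ge0.
have q0 : 0 <= q s t := powR_ge0 _ _.
case: (leP (t - s) dd) => hts; last first.
  (* At distant times all terms are bounded, while q is bounded below. *)
  have qf := q_far M.+1 dd0 (ltW hts).
  apply: (@le_trans _ _ K).
    rewrite (le_trans (ler_normB _ _)) // lerD //; first exact: hBg.
    rewrite (le_trans (ler_norm_sum _ _ _)) //; apply: ler_sum => v _.
    rewrite normrM ler_pM //; last exact: (hB v (i, X s)).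
    apply: (le_trans (ri_bound hw s0 (ltW st) tT (leq_trans (size_bseq v) MN))).
    apply: ler_wpM2l => //; apply: lerXn2r; rewrite ?nnegrE //.
    exact: q_leT s0 (ltW st) tT.
  rewrite mulrDl -[leLHS]add0r lerD ?mulr_ge0 ?addr_ge0 ?mulr_ge0 ?exprn_ge0 //.
  by rewrite -mulrA ler_peMr.
have htd : t - s <= delta by apply: le_trans hts _; rewrite ge_min lexx.
have htd1 : t - s <= d1 by apply: le_trans hts _; rewrite ge_min lexx orbT.
have ht1 : t - s <= 1 := le_trans htd1 d11.
have /andP[_ q1] := q_le1 gamma_ge0 (ltW st) ht1.
have hm : `|y s t (X s) - X s| <= 1.
  apply: (le_trans (hCm s t (X s) s0 (ltW st) tT ht1 Logic.I)).
  apply: (le_trans (ler_wpM2l Cm0 (hd1 _ (etrans (subr_ge0 _ _) (ltW st)) htd1))).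
  by rewrite ler_pdivrMr ?ltr_pwDr // mul1r lerDl.
have h1 : `|g i (X t) - g i (y s t (X s))| <= Lg * L * q s t ^+ M.+1.
  apply: (le_trans (hLg i _ _ Logic.I Logic.I)); rewrite -mulrA ler_wpM2l //.
  apply: (le_trans (hX s t s0 st tT htd)); rewrite ler_wpM2l //.
  exact: ler_wiXn2l.
have h2 := hCe i s t (X s) s0 (ltW st) tT ht1 Logic.I hm.
rewrite -(subrKA (g i (y s t (X s)))) (le_trans (ler_normD _ _)) //.
apply: (le_trans (lerD h1 h2)); rewrite -mulrDl ler_wpM2r ?exprn_ge0 //.
by rewrite lerDl mulr_ge0.
Qed.

End PathExpansion.

Section RoughIntegrals.
Variables (R : realType) (d n : nat) (T gamma Cw : R) (w : R -> R -> word d -> R).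
Variable f : 'I_d -> 'rV[R]_n -> 'rV[R]_n.
Hypothesis hgamma : 0 < gamma < 1.
Local Notation N := (Ngamma gamma).
Hypothesis hw : rough_increments N T gamma Cw w.
Hypothesis hf : Cbdv N setT f.
Hypothesis T0 : 0 < T.
Local Notation y := (euler N f w).
Local Notation q s t := ((t - s) `^ gamma).
Variables (X : R -> 'rV[R]_n) (L delta : R).
Hypothesis L0 : 0 <= L.
Hypothesis delta0 : 0 < delta.
Hypothesis hX : forall s t, 0 <= s -> s < t -> t <= T -> t - s <= delta ->
  `|X t - y s t (X s)| <= L * q s t ^+ N.

(** The part of y_st(X_s) carried by the words ending in i. As F_(vi) = Gamma_v f_i, it is the
    compensated increment of the integral of f_i(X) against W^i. *)
Definition germ (i : 'I_d) (s t : R) : 'rV[R]_n :=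
  \sum_(v : N.-1.-bseq 'I_d) w s t (rcons v i) *: Fvec f (rcons v i) (X s).

Lemma N_pred : N.-1.+1 = N.
Proof. by rewrite prednK // Ngamma_gt0. Qed.

Lemma size_rcons_bseq (v : N.-1.-bseq 'I_d) i : (size (rcons v i) <= N)%N.
Proof. by rewrite size_rcons; have := size_bseq v; have := N_pred; lia. Qed.

Lemma euler_germs s t x : 0 <= s -> s <= t -> t <= T -> x = X s ->
  y s t x = x + \sum_(i < d) germ i s t.
Proof.
move=> s0 st tT ->; rewrite /euler -[in LHS]N_pred.
rewrite (sum_bseqS_rcons _ (fun v => w s t v *: Fvec f v (X s))).
by rewrite (ri_nil hw) // scale1r Fvec_nil.
Qed.

Lemma germ_refl i s : 0 <= s <= T -> germ i s s = 0.
Proof.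
move=> hs; rewrite /germ big1 // => v _; rewrite (ri_refl hw) //.
by case: (bseqval v) => [|a u]; rewrite scale0r.
Qed.

(** An order N estimate on X is enough to gain the order N + 1: the coefficient F_(vi) is expanded
    with an error of order N - |v|, and it is multiplied by w_tu(vi), which is of order |v| + 1. *)
Lemma germ_defect i : exists C, 0 <= C /\ forall s t u, 0 <= s -> s <= t -> t <= u -> u <= T ->
  `|germ i s u - germ i s t - germ i t u| <= C * (u - s) `^ (1 + excess gamma).
Proof.
have C0 := ri_ge0 hw.
have /choice[C hC] : forall v : N.-1.-bseq 'I_d, exists C, 0 <= C /\ forall j s t,
   0 <= s -> s <= t -> t <= T ->
    `|Fvec f (rcons v i) (X t) 0 j - \sum_(u : (N.-1 - size v).-bseq 'I_d)
       w s t u * Fvec f (u ++ rcons v i) (X s) 0 j| <= C * q s t ^+ (N.-1 - size v).+1.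
  move=> v; have hv := size_bseq v; have Np := N_pred.
  have vne : rcons v i != [::] by case: (bseqval v).
  have hs : (size (rcons v i) + (N.-1 - size v).+1 <= N.+1)%N.
    by rewrite size_rcons; lia.
  have /choice[C hC] : forall j, exists C, 0 <= C /\ forall s t, 0 <= s -> s <= t -> t <= T ->
    `|Fvec f (rcons v i) (X t) 0 j - \sum_(u : (N.-1 - size v).-bseq 'I_d)
       w s t u * Fvec f (u ++ rcons v i) (X s) 0 j| <= C * q s t ^+ (N.-1 - size v).+1.
    move=> j; have hg := Cbd_Fvec j hf vne hs.
    have MN : (N.-1 - size v <= N)%N by lia.
    have Mm : (N.-1 - size v < N)%N by lia.
    have [C [hC0 hC]] := path_expansion hgamma hw hf Mm MN delta0 L0 hg.
    exists C; split=> // s t s0 st tT; have := hC X hX tt s t s0 st tT.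
    congr (`|_ - _| <= _); apply: eq_bigr => u _; congr (_ * _).
    by rewrite mxE Gamma_cat -Fvec_coord.
  exists (\sum_j C j); split; first by apply: sumr_ge0 => j _; exact: (hC j).1.
  move=> j s t s0 st tT; apply: (le_trans ((hC j).2 s t s0 st tT)).
  apply: ler_wpM2r; first by rewrite exprn_ge0 ?powR_ge0.
  by rewrite (bigD1 j) //= lerDl sumr_ge0 // => l _; exact: (hC l).1.
exists (\sum_(v : N.-1.-bseq 'I_d) Cw * C v); split.
  by apply: sumr_ge0 => v _; apply: mulr_ge0 => //; exact: (hC v).1.
move=> s t u s0 st tu uT; rewrite -powR_excess.
have su := le_trans st tu; have t0 := le_trans s0 st; have tT := le_trans tu uT.
apply: norm_rV_le => [|j].
  rewrite mulr_ge0 ?exprn_ge0 ?powR_ge0 // sumr_ge0 // => v _; apply: mulr_ge0 => //.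
  exact: (hC v).1.
have gE a b : germ i a b 0 j = \sum_(v : N.-1.-bseq 'I_d) w a b (rcons v i) * Fvec f (rcons v i) (X a) 0 j.
  by rewrite summxE; apply: eq_bigr => v _; rewrite mxE.
have -> : (germ i s u - germ i s t - germ i t u) 0 j = - \sum_(v : N.-1.-bseq 'I_d)
   w t u (rcons v i) * (Fvec f (rcons v i) (X t) 0 j - \sum_(u : (N.-1 - size v).-bseq 'I_d)
       w s t u * Fvec f (u ++ rcons v i) (X s) 0 j).
  have -> : (germ i s u - germ i s t - germ i t u) 0 j =
    germ i s u 0 j - germ i s t 0 j - germ i t u 0 j by rewrite !mxE.
  under eq_bigr do rewrite mulrBr.
  rewrite !gE sumrB opprB; congr (_ - _).
  apply/eqP; rewrite subr_eq; apply/eqP.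
  (* In a cut of vi the letter i stays in the right part, except for the cut with empty right part,
     which yields [germ i s t]. *)
  have -> : \sum_(v : N.-1.-bseq 'I_d) w s u (rcons v i) * Fvec f (rcons v i) (X s) 0 j =
   \sum_(v : N.-1.-bseq 'I_d) (\sum_(p <- dec v) (w s t p.1 * w t u (rcons p.2 i)) *
      Fvec f (p.1 ++ rcons p.2 i) (X s) 0 j) +
   \sum_(v : N.-1.-bseq 'I_d) w s t (rcons v i) * Fvec f (rcons v i) (X s) 0 j.
    rewrite -big_split /=; apply: eq_bigr => v _.
    rewrite (ri_chen hw s0 st tu uT (size_rcons_bseq v i)) sum_dec_rcons /=.
    rewrite (ri_nil hw) // mulr1 mulrDl; congr (_ + _); rewrite mulr_suml.
    by apply: sum_dec_eq => v1 v2 e /=; rewrite -e rcons_cat.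
  congr (_ + _).
  rewrite (sum_bseq_dec N.-1 (fun v1 v2 => (w s t v1 * w t u (rcons v2 i)) *
     Fvec f (v1 ++ rcons v2 i) (X s) 0 j)).
  apply: eq_bigr => v _; rewrite mulr_sumr; apply: eq_bigr => u' _.
  by rewrite mulrCA mulrA.
rewrite normrN (le_trans (ler_norm_sum _ _ _)) // mulr_suml; apply: ler_sum => v _.
rewrite normrM.
have hN : N.+1 = (size (rcons v i) + (N.-1 - size v).+1)%N.
  by rewrite size_rcons addSn addnS subnKC ?size_bseq // N_pred.
have Cv0 := (hC v).1.
rewrite hN exprD mulrACA; apply: ler_pM => //.
  apply: (le_trans (ri_bound hw t0 tu uT (size_rcons_bseq v i))); apply: ler_wpM2l => //.
  by apply: lerXn2r; rewrite ?nnegrE ?powR_ge0 //; apply: q_mono => //; case/andP: hgamma.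
apply: (le_trans ((hC v).2 j s t s0 st tT)); apply: ler_wpM2l => //.
by apply: lerXn2r; rewrite ?nnegrE ?powR_ge0 //; apply: q_mono => //; case/andP: hgamma.
Qed.

Lemma germ_integral i : exists C Z, [/\ 0 <= C, Z 0 = 0,
  forall s t, 0 <= s -> s < t -> t <= T -> t - s <= delta ->
    `|Z t - Z s - germ i s t| <= C * (t - s) `^ (1 + excess gamma) &
  forall t e, 0 <= t <= T -> 0 < e -> exists2 r, 0 < r & forall p, itv_partition 0 t p -> mesh 0 p < r ->
    `|\sum_(0 <= k < size p) germ i (nth 0 (0 :: p) k) (nth 0 (0 :: p) k.+1) - Z t| < e].
Proof.
have [C [C0 hC]] := germ_defect i.
apply: (additive_sewing (excess_gt0 hgamma) C0 (@germ_refl i) delta0).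
by move=> s t u s0 st tu uT _; exact: hC.
Qed.

End RoughIntegrals.

(** * Solutions in the sense of Davie *)

Lemma norm_rV_bound (R : realType) n (A : Type) (P : A -> Prop) (F : A -> 'rV[R]_n) (g : A -> R) :
  (forall a, P a -> 0 <= g a) ->
  (forall j, exists C, forall a, P a -> `|F a 0 j| <= C * g a) ->
  exists C, 0 <= C /\ forall a, P a -> `|F a| <= C * g a.
Proof.
move=> g0 /choice[C hC]; exists (\sum_j `|C j|); split; first exact: sumr_ge0.
move=> a Pa; apply: norm_rV_le => [|j]; first by rewrite mulr_ge0 ?g0 ?sumr_ge0.
apply: (le_trans (hC j a Pa)); apply: ler_wpM2r; first exact: g0.
by rewrite (le_trans (ler_norm _)) // (bigD1 j) //= lerDl sumr_ge0.
Qed.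

Lemma level_pred (N s : nat) : (s < N)%N -> (N.-1 - s).+1 = (N - s)%N.
Proof. lia. Qed.

Lemma level_add (N s u : nat) : (s < N)%N -> (u <= N.-1 - s)%N -> (u + s < N)%N.
Proof. lia. Qed.

Lemma level_le (N s M : nat) : (0 < N)%N -> (M + s <= N.-1)%N ->
  [/\ (s + M.+1 <= N.+1)%N, (M <= N)%N & (M < N)%N].
Proof. by move=> *; split; lia. Qed.

Lemma addr_cancel_germ (V : zmodType) (x z x' z' g : V) :
  x - z - (x' - z') = (x - (x' + g)) - (z - z' - g).
Proof.
rewrite (opprB _ g) (opprB z) (opprB x') (opprD x') !addrA subrK -!addrA; congr (x + _).
by rewrite addrA addrC (addrC (- z)).
Qed.

Section DavieSolutions.
Variables (R : realType) (d n : nat) (T gamma : R) (W : R -> word d -> R).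
Variable f : 'I_d -> 'rV[R]_n -> 'rV[R]_n.
Hypothesis T0 : 0 < T.
Hypothesis hgamma : 0 < gamma < 1.
Local Notation N := (Ngamma gamma).
Hypothesis hW : geometric_rough_path T gamma W.
Hypothesis hf : Cbdv N.+1 setT f.
Local Notation w := (increment gamma W).
Local Notation y := (euler N f w).
Local Notation q s t := ((t - s) `^ gamma).
Local Notation om h := (h `^ (1 + excess gamma)).

Let hfN : Cbdv N setT f := fun j => CbdW (hf j).
Let hf0 : Cbdv N set0 f := Cbdv_smooth hfN.
Let g0 : 0 < gamma := (andP hgamma).1.

Lemma euler_bounded : exists K, 0 <= K /\ forall s t x, 0 <= s -> s <= t -> t <= T -> `|y s t x - x| <= K.
Proof.
have [Cw hw] := rough_path_increments hW; have C0 := ri_ge0 hw.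
have [B [B0 hB]] := Fvec_bound hfN.
exists (\sum_(v : N.-bseq 'I_d) Cw * (q 0 T ^+ size v) * B); split.
  by apply: sumr_ge0 => v _; rewrite !mulr_ge0 ?exprn_ge0 ?powR_ge0.
move=> s t x s0 st tT; rewrite (euler_split f hw) // addrC addKr.
rewrite (le_trans (ler_norm_sum _ _ _)) //.
rewrite [leRHS](bigID (fun v : N.-bseq 'I_d => v != [::] :> word d)) /= -[leLHS]addr0.
apply: lerD; last by apply: sumr_ge0 => v _; rewrite !mulr_ge0 ?exprn_ge0 ?powR_ge0.
apply: ler_sum => v hv; rewrite normrZ ler_pM // ?hB ?size_bseq //.
apply: (le_trans (ri_bound hw s0 st tT (size_bseq v))); apply: ler_wpM2l => //.
apply: lerXn2r; rewrite ?nnegrE ?powR_ge0 //.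
exact: (q_leT hgamma s0 st tT).
Qed.

(** The sums in the definition of a controlled path stop at length N - 1, those of the Euler map at
    N; the words of length N account for the difference. *)
Lemma euler_top_level : exists C, 0 <= C /\ forall s t x, 0 <= s -> s <= t -> t <= T ->
  `|y s t x - \sum_(v : N.-1.-bseq 'I_d) w s t v *: Fvec f v x| <= C * q s t ^+ N.
Proof.
have [Cw hw] := rough_path_increments hW; have C0 := ri_ge0 hw.
have [B [B0 hB]] := Fvec_bound hfN; have N0 := Ngamma_gt0 hgamma.
exists (\sum_(v : N.-bseq 'I_d) Cw * B); split; first by apply: sumr_ge0 => v _; exact: mulr_ge0.
move=> s t x s0 st tT.
rewrite (sum_bseq_le (fun v => w s t v *: Fvec f v x) (leq_pred N)) /euler.
rewrite (bigID (fun v : N.-bseq 'I_d => (size v <= N.-1)%N)) /= addrAC subrr add0r.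
rewrite (le_trans (ler_norm_sum _ _ _)) // mulr_suml.
rewrite [leRHS](bigID (fun v : N.-bseq 'I_d => (size v <= N.-1)%N)) /= -[leLHS]add0r.
apply: lerD; first by apply: sumr_ge0 => v _; rewrite !mulr_ge0 ?exprn_ge0 ?powR_ge0.
apply: ler_sum => v hv; have sv : size v = N.
  by apply/eqP; rewrite eqn_leq size_bseq /=; move: hv; rewrite -ltnNge prednK.
rewrite normrZ mulrAC ler_pM //; last first.
  by apply: hB; rewrite ?size_bseq // -size_eq0 sv -lt0n.
by apply: (le_trans (ri_bound hw s0 st tT (size_bseq v))); rewrite sv.
Qed.

Variables (X : R -> 'rV[R]_n).

Section FromDavie.
Variables (L delta : R).
Hypothesis L0 : 0 <= L.
Hypothesis hdelta : 0 < delta <= 1.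
Hypothesis hX : davie_path y T delta (excess gamma) L X.

Let d0 : 0 < delta := (andP hdelta).1.

Lemma q_local s t : s <= t -> t - s <= delta -> 0 <= q s t <= 1.
Proof.
move=> st h; apply: q_le1 => //; first exact: ltW.
by apply: le_trans h _; case/andP: hdelta.
Qed.

Lemma davie_bounded : exists K, 0 <= K /\ forall s t, 0 <= s -> s <= t -> t <= T -> `|X t - X s| <= K.
Proof.
have [Ke [Ke0 hKe]] := euler_bounded.
have local s t : 0 <= s -> s <= t -> t <= T -> t - s <= delta -> `|X t - X s| <= L + Ke.
  move=> s0; rewrite le_eqVlt => /orP[/eqP<-|st] tT ts; first by rewrite subrr normr0 addr_ge0.
  rewrite -(subrKA (y s t (X s))) (le_trans (ler_normD _ _)) // lerD //; last exact: hKe s0 (ltW st) tT.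
  apply: (le_trans (hX s0 st tT ts)); rewrite -powR_excess -[leRHS]mulr1 ler_wpM2l //.
  by have /andP[q0 q1] := q_local (ltW st) ts; exact: exprn_ile1.
have chain m s t : 0 <= s -> s <= t -> t <= T -> t - s <= m%:R * delta -> `|X t - X s| <= m%:R * (L + Ke).
  elim: m s t => [|m IH] s t s0 st tT.
    rewrite !mul0r subr_le0 => ts; have -> : t = s by apply/eqP; rewrite eq_le ts.
    by rewrite subrr normr0.
  rewrite -natr1 !mulrDl !mul1r => hm.
  case: (leP (t - s) delta) => h.
    by apply: (le_trans (local s t s0 st tT h)); rewrite lerDr mulr_ge0 ?addr_ge0.
  have hs : s + delta <= t by rewrite -lerBrDl ltW.
  rewrite -(subrKA (X (s + delta))) (le_trans (ler_normD _ _)) // lerD //.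
    apply: IH => //; first by rewrite addr_ge0 // ltW.
    by rewrite opprD addrA lerBlDr.
  apply: local => //; [by rewrite lerDl ltW|exact: le_trans tT|by rewrite addrC addKr].
have [m hm] : exists m, T <= m%:R * delta.
  exists (Num.truncn (T / delta)).+1.
  by rewrite -ler_pdivrMr // ltW // truncnS_gt.
exists (m%:R * (L + Ke)); split; first by rewrite mulr_ge0 ?addr_ge0.
move=> s t s0 st tT; apply: chain => //; apply: le_trans hm; apply: le_trans tT.
by rewrite lerBlDr lerDl.
Qed.

(** The remainder of a controlled path is demanded for all s < t. Beyond [delta] both terms are
    bounded and q is bounded below; the exponent drops to N, which is the one demanded for the empty
    word. *)
Lemma davie_global : exists C, 0 <= C /\ forall s t, 0 <= s -> s < t -> t <= T ->
  `|X t - y s t (X s)| <= C * q s t ^+ N.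
Proof.
have [K [K0 hK]] := davie_bounded; have [Ke [Ke0 hKe]] := euler_bounded.
have D0 : 0 <= (q 0 delta ^+ N)^-1 by rewrite invr_ge0 exprn_ge0 ?powR_ge0.
exists (L + (K + Ke) * (q 0 delta ^+ N)^-1); split; first by rewrite addr_ge0 ?mulr_ge0 ?addr_ge0.
move=> s t s0 st tT; have q0 : 0 <= q s t ^+ N by rewrite exprn_ge0 ?powR_ge0.
case: (leP (t - s) delta) => h.
  apply: (le_trans (hX s0 st tT h)); rewrite -powR_excess mulrDl.
  rewrite -[leLHS]addr0 lerD ?mulr_ge0 ?addr_ge0 // ler_wpM2l //.
  by have /andP[ql0 ql1] := q_local (ltW st) h; exact: ler_wiXn2l.
apply: (@le_trans _ _ (K + Ke)).
  rewrite -(subrKA (X s)) (le_trans (ler_normD _ _)) // lerD //; first exact: hK s0 (ltW st) tT.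
  by rewrite distrC; exact: hKe s0 (ltW st) tT.
rewrite mulrDl -[leLHS]add0r lerD ?mulr_ge0 // -mulrA ler_peMr ?addr_ge0 //.
exact: (q_far hgamma N d0 (ltW h)).
Qed.

Lemma davie_expansion (v : word d) : v != [::] -> (size v < N)%N -> forall M, (M + size v <= N.-1)%N ->
  exists C, 0 <= C /\ forall a : R * R, 0 <= a.1 /\ a.1 <= a.2 /\ a.2 <= T ->
  `|Fvec f v (X a.2) - \sum_(u : M.-bseq 'I_d) w a.1 a.2 u *: Fvec f (u ++ v) (X a.1)|
   <= C * q a.1 a.2 ^+ M.+1.
Proof.
move=> vne vN M hM; have [Cw hw] := rough_path_increments hW; have N0 := Ngamma_gt0 hgamma.
have [Cg [Cg0 hCg]] := davie_global.
apply: norm_rV_bound => [a _|j]; first by rewrite exprn_ge0 ?powR_ge0.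
have [hs MN Mm] := level_le N0 hM.
have hg := Cbd_Fvec j hfN vne hs.
have [C [_ hC]] := path_expansion hgamma hw hfN Mm MN T0 Cg0 hg.
exists C => -[s t] /= [s0 [st tT]].
have := hC X (fun s t s0 st tT _ => hCg s t s0 st tT) tt s t s0 st tT.
congr (`|_| <= _).
have -> (a b : 'rV[R]_n) : (a - b) 0 j = a 0 j - b 0 j by rewrite !mxE.
rewrite summxE; congr (_ - _); apply: eq_bigr => u _.
have -> (c : R) (a : 'rV[R]_n) : (c *: a) 0 j = c * a 0 j by rewrite mxE.
by congr (_ * _); rewrite mxE Gamma_cat -Fvec_coord.
Qed.

(** The only coefficients compatible with the equation, as the proof of [rde_davie] shows. *)
Definition lifted_path (t : R) (v : word d) : 'rV[R]_n :=
  if (size v < N)%N then Fvec f v (X t) else 0.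

Lemma lifted_pathE t v : (size v < N)%N -> lifted_path t v = Fvec f v (X t).
Proof. by rewrite /lifted_path => ->. Qed.

Lemma davie_controlled : controlled T gamma W N lifted_path.
Proof.
have N0 := Ngamma_gt0 hgamma.
have hq (s t : R) k : s <= t -> q s t ^+ k = `|t - s| `^ (k%:R * gamma).
  by move=> st; rewrite powR_natmul ger0_norm ?subr_ge0.
split.
- by move=> t _ v hv; rewrite /lifted_path ltnNge; move: hv; rewrite prednK // => ->.
- move=> v hv.
  have [C [C0 hC]] : exists C, 0 <= C /\ forall a : R * R, 0 <= a.1 /\ a.1 <= a.2 /\ a.2 <= T ->
      `|lifted_path a.2 v - lifted_path a.1 v| <= C * q a.1 a.2 ^+ 1.
    have [Cw hw] := rough_path_increments hW.
    (* For the empty word F_v is the identity, which is not bounded, so [davie_expansion] does not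
       apply; the Davie estimate is used directly. *)
    have [ve|vne] := eqVneq v [::].
      have [Cm [Cm0 hCm]] := euler_move hw (ltW g0) hfN.
      have [K [K0 hK]] := davie_bounded.
      have D0 : 0 <= (q 0 delta ^+ 1)^-1 by rewrite invr_ge0 exprn_ge0 ?powR_ge0.
      exists (L + Cm + K * (q 0 delta ^+ 1)^-1); split; first by rewrite !addr_ge0 ?mulr_ge0.
      move=> [s t] /= [s0 [st tT]]; rewrite !lifted_pathE // ve !Fvec_nil.
      have q0 : 0 <= q s t ^+ 1 by rewrite exprn_ge0 ?powR_ge0.
      case: (leP (t - s) delta) => h; last first.
        apply: (le_trans (hK s t s0 st tT)); rewrite mulrDl -[leLHS]add0r.
        rewrite lerD ?mulr_ge0 ?addr_ge0 // -mulrA ler_peMr //.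
        exact: (q_far hgamma 1 d0 (ltW h)).
      rewrite mulrDl -[leLHS]addr0 lerD ?mulr_ge0 //.
      move: st; rewrite le_eqVlt => /orP[/eqP<-|st].
        by rewrite subrr normr0 mulr_ge0 ?addr_ge0 // exprn_ge0 ?powR_ge0.
      have ql := q_local (ltW st) h; have /andP[ql0 ql1] := ql.
      rewrite mulrDl -(subrKA (y s t (X s))) (le_trans (ler_normD _ _)) // lerD //.
        apply: (le_trans (hX s0 st tT h)); rewrite -powR_excess ler_wpM2l //.
        exact: ler_wiXn2l.
      rewrite expr1; apply: hCm => //; first exact: ltW.
      by apply: le_trans h _; case/andP: hdelta.
    have hM : (0 + size v <= N.-1)%N by rewrite -ltnS prednK.
    have [C [C0 hC]] := davie_expansion vne hv hM.
    exists C; split=> // -[s t] /= hst; have := hC (s, t) hst; have [s0 [st tT]] := hst.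
    rewrite /= (sum_bseq0 (fun u => w s t u *: Fvec f (u ++ v) (X s))) /= !lifted_pathE //.
    by rewrite (ri_nil hw) // scale1r.
  exists C => s t /andP[s0 sT] /andP[t0' tT].
  case: (leP s t) => st.
    have := hC (s, t) (conj s0 (conj st tT)); rewrite /= (hq s t 1%N st) mul1r; exact.
  have := hC (t, s) (conj t0' (conj (ltW st) sT)); rewrite /= (hq t s 1%N (ltW st)) mul1r.
  by rewrite distrC (distrC s t).
move=> v hv.
have [ve|vne] := eqVneq v [::].
  have [Cg [Cg0 hCg]] := davie_global; have [Ct [Ct0 hCt]] := euler_top_level.
  exists (Cg + Ct) => s t s0 st tT; rewrite ve /= !subn0 -(hq s t N (ltW st)).
  rewrite lifted_pathE // Fvec_nil.
  rewrite (eq_bigr (fun u : N.-1.-bseq 'I_d => w s t u *: Fvec f u (X s))); last first.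
    by move=> u _; rewrite cats0 lifted_pathE // -[X in (_ < X)%N]prednK // ltnS size_bseq.
  rewrite -(subrKA (y s t (X s))) (le_trans (ler_normD _ _)) // mulrDl.
  by rewrite lerD ?hCg // hCt // ltW.
have hM : (N.-1 - size v + size v <= N.-1)%N by rewrite subnK // -ltnS prednK.
have [C [C0 hC]] := davie_expansion vne hv hM.
exists C => s t s0 st tT; have := hC (s, t) (conj s0 (conj (ltW st) tT)) => /=.
rewrite (level_pred hv).
rewrite (hq s t _ (ltW st)) (lifted_pathE t hv).
congr (`|_ - _| <= _); apply: eq_bigr => u _.
by rewrite lifted_pathE // size_cat; exact: level_add (size_bseq u).
Qed.

(** Gamma_v f_i = F_(vi): lifting f_i(X) and integrating against W^i reproduces the coefficients F
    on words ending in i, which closes the equation on all nonempty words. *)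
Lemma lift_fieldE (XX : word d -> 'rV[R]_n) i (v : word d) x : (size v < N)%N ->
  (forall u, (size u <= size v)%N -> XX u = Fvec f u x) ->
  lift N (f i) XX v = Fvec f (rcons v i) x.
Proof.
move=> hv hXX.
have hs l k : (k <= N.+1)%N -> smooth k (fun x => f i x 0 l).
  move=> hk; apply: (Cbd_le hk); exact: (Cbd_reindex (fun _ : unit => i) (Cbdv_smooth hf l)).
rewrite (lift_Gamma (K := N) (x := x) hf0) //; last first.
- by move=> l; apply: hs; rewrite leqW // ltnW.
- by rewrite leqW // ltnW.
apply/rowP => j; rewrite (Gamma_coord (K := N)) //; first by rewrite mxE Gamma_rcons_coord.
  by rewrite leqW // ltnW.
by move=> l; apply: hs; rewrite leqW // ltnW.
Qed.

(** Increments of order above 1 force a path to be constant; this is Davie uniqueness for the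
    identity maps in place of the Euler maps. *)
Lemma constant_path (D : R -> 'rV[R]_n) C : 0 <= C ->
  (forall s t, 0 <= s -> s < t -> t <= T -> t - s <= delta -> `|D t - D s| <= C * om (t - s)) ->
  forall t, 0 <= t <= T -> D t = D 0.
Proof.
move=> C0 hD t ht.
apply: (@davie_path_unique _ _ (fun _ _ z => z) T delta (excess gamma) 1 d0 (excess_gt0 hgamma) ler01 _
   C 0 D (fun=> D 0)) => //.
  move=> s p x x' _; rewrite mul1r.
  have e (z : 'rV[R]_n) q0 s0 : scheme (fun _ _ z => z) s0 q0 z = z.
    by elim: q0 s0 => //= b q0 IH s0; apply: IH.
  by rewrite !e.
by move=> a b *; rewrite subrr normr0 mul0r.
Qed.

Lemma davie_rde : rde_solution T gamma W f X.
Proof.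
have [Cw hw] := rough_path_increments hW; have N0 := Ngamma_gt0 hgamma.
have [Cg [Cg0 hCg]] := davie_global.
have hXg s t : 0 <= s -> s < t -> t <= T -> t - s <= delta -> `|X t - y s t (X s)| <= Cg * q s t ^+ N.
  by move=> s0 st tT _; exact: hCg.
have /choice[C /choice[Z hZ]] := fun i => germ_integral hgamma hw hfN T0 Cg0 d0 hXg i.
exists lifted_path; split.
- exact: davie_controlled.
- by move=> t _; rewrite lifted_pathE // Fvec_nil.
- by move=> v hv; rewrite lifted_pathE // (Fvf_Fvec (K := N)) // leqW // ltnW.
have liftE i t (v : word d) : (size v < N)%N -> lift N (f i) (lifted_path t) v = Fvec f (rcons v i) (X t).
  move=> hv; apply: lift_fieldE => // u hu; apply: lifted_pathE; exact: leq_ltn_trans hv.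
(* The integral against W^i has nonzero coefficients only on the empty word and on words ending in
   i. In the second branch v is nonempty, so [last i v] is its last letter. *)
pose ZZ i t (v : word d) : 'rV[R]_n := if v == [::] then Z i t else
  if (size v <= N)%N then (if last i v == i then Fvec f v (X t) else 0) else 0.
exists ZZ; split.
  move=> i t ht; split.
  - move=> v hv; rewrite /ZZ leqNgt hv /=; case: eqP => // e.
    by move: hv; rewrite e.
  - rewrite /ZZ /= => e e0; have [_ _ _ /(_ t e ht e0)[r r0 hr]] := hZ i.
    exists r => // p hp hm; have := hr p hp hm.
    congr (`|_ - Z i t| < e); rewrite /compensated_sum; apply: eq_bigr => k _.
    rewrite /germ; apply: eq_bigr => v _; rewrite liftE //.
    by rewrite -[X in (_ < X)%N]prednK // ltnS size_bseq.
  move=> v j hv; rewrite /ZZ.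
  have -> : (rcons v j == [::]) = false by case: v {hv}.
  rewrite size_rcons hv last_rcons; case: eqP => // ->.
  by rewrite liftE.
move=> s t v s0 st tT hv.
have t0 : 0 <= t by rewrite (le_trans s0) // ltW.
have sT : s <= T by rewrite (le_trans _ tT) // ltW.
case/lastP: v hv => [|v j] hv; last first.
  have ne : (rcons v j == [::]) = false by case: v {hv}.
  rewrite (bigD1 j) //= big1 ?addr0.
    rewrite /ZZ ne (ltnW hv) last_rcons eqxx !lifted_pathE //.
  by move=> i ij; rewrite /ZZ ne (ltnW hv) last_rcons eq_sym (negbTE ij) subrr.
rewrite !lifted_pathE // !Fvec_nil /ZZ /=.
(* The germs of all letters add up to y_ab(X_a) - X_a, so the increments of D are of order above 1
   and D is constant. *)
pose D u := X u - \sum_i Z i u.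
have hD : forall u, 0 <= u <= T -> D u = D 0.
  apply: (@constant_path D (L + \sum_i C i)).
    by rewrite addr_ge0 // sumr_ge0 // => i _; have [] := hZ i.
  move=> a b a0 ab bT hab.
  have -> : D b - D a = (X b - y a b (X a)) - \sum_i (Z i b - Z i a - germ gamma w f X i a b).
    rewrite (euler_germs f hgamma hw a0 (ltW ab) bT erefl) /D !sumrB.
    exact: (addr_cancel_germ (X b)).
  rewrite (le_trans (ler_normB _ _)) // mulrDl lerD //; first exact: hX.
  rewrite (le_trans (ler_norm_sum _ _ _)) // mulr_suml; apply: ler_sum => i _.
  by have [_ _ h _] := hZ i; exact: h.
have e1 := hD t; have e2 := hD s; rewrite t0 tT in e1; rewrite s0 sT in e2.
rewrite sumrB; move: (etrans (e1 isT) (esym (e2 isT))); rewrite /D => e.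
by apply/eqP; rewrite subr_eq -addrA (addrC (- _)) -e addrC subrK.
Qed.

End FromDavie.

(** The equation determines the coefficients as F_v(X), by induction on v through its last letter.
    The controlled remainder then gives the Davie estimate to order N, and sewing the germs of the
    integrals improves it to order N + 1. *)
Lemma rde_davie : rde_solution T gamma W f X ->
  exists C, 0 <= C /\ davie_path y T 1 (excess gamma) C X.
Proof.
move=> [XX [[_ _ hctrl] hX0 hXi [Z [hZ hXZ]]]].
have [Cw hw] := rough_path_increments hW; have N0 := Ngamma_gt0 hgamma.
have T0' : 0 <= (0 : R) <= T by rewrite lexx ltW.
have hXX t v : 0 <= t <= T -> (size v < N)%N -> XX t v = Fvec f v (X t).
  move=> ht; have [m] := ubnP (size v); elim: m v t ht => // m IH v t ht.
  rewrite ltnS => hm hv.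
  case/lastP: v hm hv => [|v j] hm hv; first by rewrite hX0 // Fvec_nil.
  have hv' : (size v < N)%N by apply: leq_trans hv; rewrite size_rcons.
  have lE u : 0 <= u <= T -> lift N (f j) (XX u) v = Fvec f (rcons v j) (X u).
    move=> hu; apply: lift_fieldE => // z hz; apply: IH => //.
      by move: hm; rewrite size_rcons; apply: leq_ltn_trans.
    exact: leq_ltn_trans hv'.
  have e0 : XX 0 (rcons v j) = Fvec f (rcons v j) (X 0).
    by rewrite hXi // (Fvf_Fvec (K := N)) // leqW // ltnW.
  have /andP[t0 tT] := ht.
  move: t0; rewrite le_eqVlt => /orP[/eqP<-//|t0].
  (* On the word vj only the integral against W^j moves, and its increment is that of F_(vj)(X); the
     prescribed coefficients at time 0 fix the constant. *)
  have := hXZ 0 t (rcons v j) (lexx _) t0 tT hv.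
  have zE u i : 0 <= u <= T -> Z i u (rcons v j) = if j == i then lift N (f i) (XX u) v else 0.
    by move=> hu; have [_ _ h] := hZ i u hu; exact: h.
  rewrite (bigD1 j) //= big1 ?addr0; last first.
    by move=> i ij; rewrite !zE // eq_sym (negbTE ij) subrr.
  rewrite !zE // eqxx !lE // e0 => /eqP; rewrite subr_eq subrK => /eqP ->.
  by [].
have [Cc hCc] := hctrl [::] N0; have [Ct [Ct0 hCt]] := euler_top_level.
have hXg s t : 0 <= s -> s < t -> t <= T -> t - s <= 1 -> `|X t - y s t (X s)| <= (`|Cc| + Ct) * q s t ^+ N.
  move=> s0 st tT _.
  have sT : 0 <= s <= T by rewrite s0 (le_trans _ tT) // ltW.
  have tT' : 0 <= t <= T by rewrite tT (le_trans s0) // ltW.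
  have := hCc s t s0 st tT; rewrite subn0 hX0 //.
  rewrite (eq_bigr (fun u : N.-1.-bseq 'I_d => w s t u *: Fvec f u (X s))); last first.
    by move=> u _; rewrite cats0 hXX // -[X in (_ < X)%N]prednK // ltnS size_bseq.
  rewrite gtr0_norm ?subr_gt0 // -powR_natmul => h.
  rewrite -(subrKA (\sum_(u : N.-1.-bseq 'I_d) w s t u *: Fvec f u (X s))).
  rewrite (le_trans (ler_normD _ _)) // mulrDl lerD //.
    apply: (le_trans h); rewrite subn0; apply: ler_wpM2r; first by rewrite exprn_ge0 ?powR_ge0.
    exact: ler_norm.
  by rewrite distrC hCt // ltW.
have K0 : 0 <= `|Cc| + Ct by rewrite addr_ge0.
have /choice[C /choice[Z' hZ']] := fun i => germ_integral hgamma hw hfN T0 K0 ltr01 hXg i.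
(* The two integrals are limits of the same compensated sums, since the coefficients of the lift are
   known. *)
have ZE i t : 0 <= t <= T -> Z i t [::] = Z' i t.
  move=> ht; have [_ hI _] := hZ i t ht; have [_ _ _ hI'] := hZ' i.
  apply/eqP; rewrite -subr_eq0 -normr_le0; apply/ler_addgt0Pr => e e0; rewrite add0r.
  have e2 : 0 < e / 2 by rewrite divr_gt0.
  have [r r0 hr] := hI _ e2; have [r' r'0 hr'] := hI' t _ ht e2.
  (* Fine partitions have mesh at most m, and the halving makes the inequality strict. *)
  pose m := Num.min r r' / 2.
  have m0 : 0 < m by rewrite divr_gt0 // lt_min r0.
  have t0 := (andP ht).1; have tT := (andP ht).2.
  have [p [h1 h2 h3]] := fine_partition_ex t0 m0.
  have hp : itv_partition 0 t p by split=> //; apply/eqP.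
  have hm : mesh 0 p <= m.
    rewrite /mesh big_mkord; apply: bigmax_le; first exact: ltW.
    by move=> k _; have /(pathP 0)/(_ k (ltn_ord k)) := h3.
  have hmr : mesh 0 p < Num.min r r'.
    by apply: (le_lt_trans hm); rewrite ltr_pdivrMr // ltr_pMr ?lt_min ?r0 //; lra.
  have b1 := hr p hp (lt_le_trans hmr _); have b2 := hr' p hp (lt_le_trans hmr _).
  have {}b1 := b1 ltac:(by rewrite ge_min lexx).
  have {}b2 := b2 ltac:(by rewrite ge_min lexx orbT).
  have eS : compensated_sum gamma W (fun t => lift N (f i) (XX t)) i 0 p =
     \sum_(0 <= k < size p) germ gamma w f X i (nth 0 (0 :: p) k) (nth 0 (0 :: p) k.+1).
    rewrite /compensated_sum; apply: eq_big_nat => k /andP[_ hk]; apply: eq_bigr => v _.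
    have hv : (size v < N)%N by rewrite -[X in (_ < X)%N]prednK // ltnS size_bseq.
    congr (_ *: _); apply: lift_fieldE => // u hu; apply: hXX; last exact: leq_ltn_trans hv.
    have hk' : (k < (size p).+1)%N by rewrite ltnW.
    rewrite (set_nth_default t) // (itv_partition_nth_ge hk' hp) /=.
    exact: le_trans (itv_partition_nth_le hk' hp) tT.
  rewrite eS in b1.
  rewrite -(subrKA (\sum_(0 <= k < size p) germ gamma w f X i (nth 0 (0 :: p) k) (nth 0 (0 :: p) k.+1))).
  rewrite (le_trans (ler_normD _ _)) // [e]splitr; apply: lerD; last exact: ltW.
  by rewrite distrC; exact: ltW.
exists (\sum_i C i); split; first by apply: sumr_ge0 => i _; have [] := hZ' i.
move=> s t s0 st tT ts.
have sT : 0 <= s <= T by rewrite s0 (le_trans _ tT) // ltW.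
have tT' : 0 <= t <= T by rewrite tT (le_trans s0) // ltW.
have := hXZ s t [::] s0 st tT N0; rewrite !hX0 //.
rewrite (eq_bigr (fun i => Z' i t - Z' i s)) => [e|i _]; last by rewrite !ZE.
rewrite (euler_germs f hgamma hw s0 (ltW st) tT erefl) opprD addrA e -sumrB.
rewrite (le_trans (ler_norm_sum _ _ _)) // mulr_suml; apply: ler_sum => i _.
by have [_ _ h _] := hZ' i; exact: h.
Qed.

End DavieSolutions.

(** * Smooth functions determine finite Borel measures *)

Section Logistic.
Variable R : realType.

(** A smooth step between 0 and 1. Its derivative is the polynomial L (1 - L) in itself, so that the
    boundedness of all derivatives follows by induction from that of L. *)
Definition logistic (z : R) : R := (1 + expR (- z))^-1.

Lemma logistic_den_gt0 z : 0 < 1 + expR (- z) :> R.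
Proof. by rewrite addr_gt0 // expR_gt0. Qed.

Lemma logistic_ge0 z : 0 <= logistic z.
Proof. by rewrite invr_ge0 ltW // logistic_den_gt0. Qed.

Lemma logisticN z : logistic (- z) = 1 - logistic z.
Proof.
rewrite /logistic opprK expRN.
have h : expR z != 0 by rewrite gt_eqF // expR_gt0.
have h2 : expR z + 1 != 0 by rewrite gt_eqF // addr_gt0 // expR_gt0.
have h3 : 1 + expR z != 0 by rewrite addrC.
by field; rewrite ?h ?h2 ?h3.
Qed.

Lemma logistic_le1 z : logistic z <= 1.
Proof. by have := logistic_ge0 (- z); rewrite logisticN subr_ge0. Qed.

Lemma is_derive_logistic (z : R) : is_derive z (1 : R) logistic (logistic z * (1 - logistic z)).
Proof.
have nz : 1 + expR (- z) != 0 by rewrite gt_eqF // logistic_den_gt0.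
have h1 : is_derive z (1 : R) (fun y : R => expR (- y)) (- expR (- z)).
  have := is_derive1_comp (is_derive_expR (- z)) (is_deriveN (is_derive_id z (1 : R))).
  by rewrite mulrN1.
have h2 : is_derive z (1 : R) (fun y : R => 1 + expR (- y)) (- expR (- z)).
  by have := is_deriveD (is_derive_cst (1 : R) z (1 : R)) h1; rewrite add0r.
have h3 : is_derive z (1 : R) logistic (- (1 + expR (- z)) ^- 2 *: (- expR (- z))) :=
  @is_deriveV _ (fun y : R => 1 + expR (- y)) z _ 1 nz h2.
apply: (is_derive_eq h3).
by rewrite /logistic /GRing.scale /=; field.
Qed.

Lemma logistic_differentiable (z : R) : differentiable logistic z.
Proof. by apply/derivable1_diffP; have := is_derive_logistic z; case. Qed.

Lemma diff_logistic (z h : R) : 'd logistic z h = h * (logistic z * (1 - logistic z)).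
Proof.
have -> := diff1E (logistic_differentiable z).
by rewrite derive1E (@derive_val _ _ _ _ _ _ _ (is_derive_logistic z)).
Qed.

Lemma logistic_tail m z : 0 < m -> m <= z -> 1 - logistic z <= m^-1.
Proof.
move=> m0 mz; rewrite -logisticN /logistic opprK lef_pV2 ?posrE ?addr_gt0 ?expR_gt0 //.
  by have := expR_ge1Dx z; lra.
Qed.

(* The shift by [m] makes the limit vanish at the end point [c = 0]. *)
Lemma logistic_cvg_step (c : R) :
  (fun m : nat => logistic (m%:R ^+ 2 * c - m%:R)) @ \oo --> ((0 < c)%R%:R : R).
Proof.
apply/cvgrPdist_le => e e0; near=> m.
have m0 : 0 < (m%:R : R) by near: m; exact: nbhs_infty_gtr.
have me : (m%:R : R)^-1 <= e.
  rewrite -[e]invrK lef_pV2 ?posrE ?invr_gt0 //.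
  by apply: ltW; near: m; exact: nbhs_infty_gtr.
have [c0|c0] := ltP 0 c.
  have mc : 2 / c < m%:R by near: m; exact: nbhs_infty_gtr.
  rewrite ger0_norm ?subr_ge0 ?logistic_le1 //; apply: (le_trans _ me).
  apply: logistic_tail => //; rewrite expr2 -mulrA -[X in X <= _]mulr1 -[X in _ - X]mulr1 -mulrBr.
  by rewrite ler_pM2l //; move: mc; rewrite ltr_pdivrMr //; lra.
rewrite sub0r normrN ger0_norm ?logistic_ge0 //; apply: (le_trans _ me).
rewrite -[X in logistic X]opprK logisticN; apply: logistic_tail => //.
by rewrite opprB lerBrDr gerDl mulr_ge0_le0 // sqr_ge0.
Unshelve. all: by end_near.
Qed.

Lemma Cbd_logistic n k (c e : R) (j : 'I_n) :
  Cbd k setT (fun (_ : unit) (x : 'rV[R]_n) => logistic (c * x 0 j + e)).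
Proof.
have dA (x : 'rV[R]_n) : differentiable (fun y : 'rV[R]_n => c * y 0 j + e) x.
  apply: differentiable_add; last exact: differentiable_cst.
  by apply: differentiable_scale; exact: differentiable_rV_coord.
have dL (x : 'rV[R]_n) : differentiable (fun y : 'rV[R]_n => logistic (c * y 0 j + e)) x.
  exact: (differentiable_chain (dA x) (logistic_differentiable _)).
have bd : exists M : R, forall (i : unit) (x : 'rV[R]_n), setT x -> `|logistic (c * x 0 j + e)| <= M.
  by exists 1 => _ x _; rewrite ger0_norm ?logistic_le1 ?logistic_ge0.
elim: k => [|k IH]; split=> //.
  by move=> _ x; exact: differentiable_continuous.
split=> [_ x //|i].
have -> : (fun _ : unit => pd i (fun x : 'rV[R]_n => logistic (c * x 0 j + e))) =
  (fun (_ : unit) (x : 'rV[R]_n) => (c * (i == j)%:R) *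
     (logistic (c * x 0 j + e) + (- 1) * (logistic (c * x 0 j + e) * logistic (c * x 0 j + e)))).
  apply/funext => _; apply/funext => x; rewrite /pd.
  apply: (etrans (diff_chain _ (dA x) (logistic_differentiable _))).
  apply: (etrans (diff_logistic _ _)).
  have -> : 'd (fun y : 'rV[R]_n => c * y 0 j + e) x (delta_mx 0 i) = c * (i == j)%:R.
    apply: (etrans (diff_add _ (differentiable_scale c (differentiable_rV_coord x j)) (differentiable_cst e x))).
    have -> := diff_const e x (delta_mx 0 i : 'rV[R]_n); rewrite addr0.
    apply: (etrans (diff_scale _ _ (differentiable_rV_coord x j))).
    have -> := diff_rV_coord x (delta_mx 0 i) j.
    by rewrite mxE eqxx eq_sym.
  by ring.
apply: Cbd_scale; apply: Cbd_add => //; apply: Cbd_scale; exact: Cbd_mul.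
Qed.

End Logistic.

(** * Borel sets of R^n and integrals of bounded continuous functions *)

Section BorelRn.
Variables (R : realType) (n : nat).
Implicit Types (a b x : 'rV[R]_n) (m : finite_borel_measure R n).

Lemma borel_open (O : set 'rV[R]_n) : open O -> measurable (O : set (borelRn R n)).
Proof. exact: sub_sigma_algebra. Qed.

Lemma borel_continuous (phi : 'rV[R]_n -> R) : continuous phi ->
  measurable_fun [set: borelRn R n] (phi : borelRn R n -> R).
Proof.
move=> /continuousP cphi; apply: (measurability _ (RGenOpens.measurableE R)).
move=> _ [_ [x [y ->]] <-]; rewrite setTI; apply: borel_open.
by apply: cphi; exact: interval_open.
Qed.

Lemma borel_continuous_rV (F : 'rV[R]_n -> 'rV[R]_n) : continuous F ->
  measurable_fun [set: borelRn R n] (F : borelRn R n -> borelRn R n).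
Proof.
move=> /continuousP cF; apply: (@measurability _ _ (borelRn R n) (borelRn R n) _ _ (@open 'rV[R]_n)) => //.
by move=> _ [U oU <-]; rewrite setTI; apply: borel_open; exact: cF.
Qed.

Lemma bounded_continuous_integrable m (phi : 'rV[R]_n -> R) M : continuous phi ->
  (forall x, `|phi x| <= M) -> m.-integrable [set: borelRn R n] (EFin \o phi).
Proof.
move=> cphi bphi; apply: measurable_bounded_integrable => //.
- by rewrite ltey_eq fin_num_measure.
- exact: borel_continuous.
exists M; split; first exact: num_real.
by move=> c Mc x _ /=; exact: le_trans (bphi x) (ltW Mc).
Qed.

Lemma norm_Rintegral_le m (phi : 'rV[R]_n -> R) M : continuous phi ->
  (forall x, `|phi x| <= M) -> `|\int[m]_x phi x| <= M * fine (m setT).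
Proof.
move=> cphi bphi; have hi := bounded_continuous_integrable m cphi bphi.
apply: (le_trans (le_normr_Rintegral measurableT hi)).
rewrite -Rintegral_cst //; apply: le_Rintegral => //.
  apply: (@bounded_continuous_integrable m (fun x => `|phi x|) M) => [x|x].
    by apply: (continuous_comp (cphi x)); exact: norm_continuous.
  by rewrite normr_id.
by apply: (@bounded_continuous_integrable m (fun=> M) `|M|) => //; exact: cst_continuous.
Qed.

Lemma Rintegral_bigsum m (J : Type) (s : seq J) (F : J -> 'rV[R]_n -> R) :
  (forall j, continuous (F j)) -> (forall j, exists M, forall x, `|F j x| <= M) ->
  \int[m]_x (\sum_(j <- s) F j x) = \sum_(j <- s) \int[m]_x F j x.
Proof.
move=> cF bF; elim: s => [|j s IH].
  rewrite big_nil; under eq_Rintegral do rewrite big_nil.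
  by rewrite Rintegral_cst // mul0r.
rewrite big_cons -IH; under eq_Rintegral do rewrite big_cons.
have [M hM] := bF j; apply: RintegralD => //.
  exact: bounded_continuous_integrable hM.
have /choice[B hB] := bF.
apply: (@bounded_continuous_integrable m (fun x => \sum_(i <- s) F i x) (\sum_(i <- s) B i)).
  elim: s {IH} => [|i s IH]; first by under eq_fun do rewrite big_nil; exact: cst_continuous.
  under eq_fun do rewrite big_cons.
  by move=> x; apply: continuousD; [exact: cF|exact: IH].
by move=> x; apply: (le_trans (ler_norm_sum _ _ _)); apply: ler_sum => i _; exact: hB.
Qed.

Definition box a b : set 'rV[R]_n := [set x | forall j, a 0 j < x 0 j < b 0 j].

Lemma box_open a b : open (box a b).
Proof.
rewrite openE => x hx; rewrite /interior.
apply: (@filter_forall _ _ (fun j (y : 'rV[R]_n) => a 0 j < y 0 j < b 0 j) (nbhs x)) => j.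
have cj : (fun y : 'rV[R]_n => y 0 j) @ x --> x 0 j by exact: coord_continuous.
apply: (cj (fun z => a 0 j < z < b 0 j)).
have hj : x 0 j \in `]a 0 j, b 0 j[ by rewrite in_itv; exact: hx.
by apply: filterS (near_in_itvoo hj) => z; rewrite in_itv.
Qed.

Lemma box_setI a b a' b' : box a b `&` box a' b' =
  box (\row_j Num.max (a 0 j) (a' 0 j)) (\row_j Num.min (b 0 j) (b' 0 j)).
Proof.
apply/seteqP; split => x.
  move=> [h h'] j; rewrite !mxE gt_max lt_min.
  by have /andP[-> ->] := h j; have /andP[-> ->] := h' j.
move=> h; split => j; have := h j; rewrite !mxE gt_max lt_min.
  by move=> /andP[/andP[-> _] /andP[-> _]].
by move=> /andP[/andP[_ ->] /andP[_ ->]].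
Qed.

Definition boxes : set (set 'rV[R]_n) := [set A | exists a b, A = box a b].

Lemma open_rational_box (O : set 'rV[R]_n) x : open O -> O x -> exists (a b : 'rV[rat]_n),
  box (map_mx ratr a) (map_mx ratr b) x /\ box (map_mx ratr a) (map_mx ratr b) `<=` O.
Proof.
move=> oO Ox; have [e /= e0 he] := (nbhs_ballP _ _).1 (open_nbhs_nbhs (conj oO Ox)).
have /choice[a ha] : forall j, exists q : rat, x 0 j - e < ratr q < x 0 j.
  move=> j; have /rat_in_itvoo[q] : x 0 j - e < x 0 j by rewrite gtrBl.
  by rewrite in_itv; exists q.
have /choice[b hb] : forall j, exists q : rat, x 0 j < ratr q < x 0 j + e.
  move=> j; have /rat_in_itvoo[q] : x 0 j < x 0 j + e by rewrite ltrDl.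
  by rewrite in_itv; exists q.
exists (\row_j a j), (\row_j b j); split.
  by move=> j; rewrite !mxE; have /andP[_ ->] := ha j; have /andP[->] := hb j.
move=> z hz; apply: he; split=> // i j; rewrite ord1.
have := hz j; rewrite !mxE => /andP[z1 z2].
have /andP[a1 a2] := ha j; have /andP[b1 b2] := hb j.
by rewrite /ball /= ltr_norml; apply/andP; split; lra.
Qed.

Lemma borel_boxes : @measurable _ (borelRn R n) = <<s boxes >>.
Proof.
apply/seteqP; split.
  apply: smallest_sub; first exact: smallest_sigma_algebra.
  move=> O oO.
  (* An enumeration of the rational boxes, those not contained in O being replaced by the empty
     set. *)
  pose G (k : nat) : set (g_sigma_algebraType boxes) :=
    if (unpickle k : option ('rV[rat]_n * 'rV[rat]_n)) is Some ab then
      if `[< box (map_mx ratr ab.1) (map_mx ratr ab.2) `<=` O >] then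
        box (map_mx ratr ab.1) (map_mx ratr ab.2) else set0
    else set0.
  have -> : O = \bigcup_k G k.
    apply/seteqP; split => [x Ox|x [k _]].
      have [a [b [h1 h2]]] := open_rational_box oO Ox.
      by exists (pickle (a, b)) => //; rewrite /G pickleK /= ifT //; apply/asboolP.
    by rewrite /G; case: unpickle => // ab; case: asboolP => // h; exact: h.
  apply: (@bigcupT_measurable _ (g_sigma_algebraType boxes)) => k; rewrite /G.
  case: unpickle => [ab|]; last exact: measurable0.
  case: asboolP => _; last exact: measurable0.
  by apply: sub_sigma_algebra; exists (map_mx ratr ab.1), (map_mx ratr ab.2).
apply: smallest_sub; first exact: sigma_algebra_measurable.
by move=> _ [a [b ->]]; apply: borel_open; exact: box_open.
Qed.

End BorelRn.

Lemma cvg_prodr (R : realType) (J : Type) (s : seq J) (u : J -> nat -> R) (l : J -> R) :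
  (forall j, u j @ \oo --> l j) ->
  (fun i => \prod_(j <- s) u j i) @ \oo --> \prod_(j <- s) l j.
Proof.
move=> h; elim: s => [|j s IH].
  by rewrite big_nil; under eq_fun do rewrite big_nil; exact: cvg_cst.
by rewrite big_cons; under eq_fun do rewrite big_cons; exact: cvgM.
Qed.

Lemma Cbd_prod (R : realType) n k D (I J : Type) (s : seq J) (F : J -> I -> 'rV[R]_n -> R) :
  (forall j, Cbd k D (F j)) -> Cbd k D (fun i x => \prod_(j <- s) F j i x).
Proof.
move=> h; elim: s => [|j s IH].
  have -> : (fun i x => \prod_(j <- [::]) F j i x) = (fun _ _ => 1).
    by apply/funext => i; apply/funext => x; rewrite big_nil.
  by apply: (@Cbd_const _ _ _ _ _ (fun=> 1) 1) => _; rewrite normr1.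
have -> : (fun i x => \prod_(j <- j :: s) F j i x) = (fun i x => F j i x * \prod_(j <- s) F j i x).
  by apply/funext => i; apply/funext => x; rewrite big_cons.
exact: Cbd_mul.
Qed.

Section MeasuresDetermined.
Variables (R : realType) (n : nat).
Implicit Types (a b x : 'rV[R]_n).

(** Smooth functions with values in [0, 1] that converge pointwise to the indicator of the open box;
    the shift in each factor makes them vanish in the limit on the faces too. *)
Definition box_test a b (i : nat) x : R := \prod_(j < n)
  (logistic (i%:R ^+ 2 * (x 0 j - a 0 j) - i%:R) * logistic (i%:R ^+ 2 * (b 0 j - x 0 j) - i%:R)).

Lemma Cbd_box_test k a b i : Cbd k setT (fun _ : unit => box_test a b i).
Proof.
apply: Cbd_prod => j; apply: Cbd_mul.
  under eq_fun do under eq_fun do rewrite mulrBr -addrA.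
  exact: Cbd_logistic.
under eq_fun do under eq_fun do rewrite mulrBr -addrA addrCA -mulNr.
exact: Cbd_logistic.
Qed.

Lemma box_test_itv a b i x : 0 <= box_test a b i x <= 1.
Proof.
apply/andP; split.
  by apply: prodr_ge0 => j _; rewrite mulr_ge0 ?logistic_ge0.
apply: prodr_ile1 => j _.
by rewrite mulr_ge0 ?logistic_ge0 // mulr_ile1 ?logistic_ge0 ?logistic_le1.
Qed.

Lemma box_test_cvg a b x : box_test a b i x @[i --> \oo] --> (\1_(box a b) x : R).
Proof.
have -> : \1_(box a b) x = \prod_(j < n) ((0 < x 0 j - a 0 j)%R%:R * (0 < b 0 j - x 0 j)%R%:R : R).
  rewrite indicE; case: (pselect (box a b x)) => hx.
    rewrite mem_set // big1 // => j _.
    by have /andP[h1 h2] := hx j; rewrite !subr_gt0 h1 h2 mulr1.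
  rewrite memNset //.
  have [j hj] : exists j, ~ (a 0 j < x 0 j < b 0 j) by apply/existsNP.
  rewrite (bigD1 j) //= !subr_gt0 -natrM mulnb; move/negP/negbTE: hj => ->.
  by rewrite mul0r.
by apply: cvg_prodr => j; apply: cvgM; exact: logistic_cvg_step.
Qed.

Lemma integral_box_test_cvg (m : finite_borel_measure R n) a b :
  (\int[m]_x box_test a b i x)%:E @[i --> \oo] --> m (box a b).
Proof.
have hint i := @bounded_continuous_integrable _ _ m (box_test a b i) 1
  (@Cbd_continuous _ _ _ _ _ _ tt (Cbd_box_test 0 a b i)).
have bnd i x : `|box_test a b i x| <= 1.
  by have /andP[h0 h1] := box_test_itv a b i x; rewrite ger0_norm.
have mb : measurable (box a b : set (borelRn R n)) by apply: borel_open; exact: box_open.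
have -> : m (box a b) = (\int[m]_(x in setT) (\1_(box a b) x)%:E)%E.
  by rewrite integral_indic // setIT.
have -> : (fun i => (\int[m]_x box_test a b i x)%:E) =
    (fun i => (\int[m]_(x in setT) (box_test a b i x)%:E)%E).
  by apply/funext => i; rewrite /Rintegral fineK //; apply: integrable_fin_num => //; exact: hint.
have [] // := @dominated_convergence _ (borelRn R n) R m setT measurableT
  (fun i x => (box_test a b i x)%:E) (fun x => (\1_(box a b) x)%:E) (cst 1%:E).
- by move=> i; apply/measurable_EFinP; apply: borel_continuous; exact: (@Cbd_continuous _ _ _ _ _ _ tt (Cbd_box_test 0 a b i)).
- by apply/measurable_EFinP; exact: measurable_indic.
- by apply: aeW => x _; apply: cvg_EFin; [exact: nearW|exact: box_test_cvg].
- apply/integrableP; split; first exact: measurable_cst.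
  by rewrite integral_cst // lte_mul_pinfty // ltey_eq fin_num_measure.
- by apply: aeW => x i _; rewrite lee_fin.
Qed.

(** Dominated convergence along [box_test] gives equality on open boxes. These form a pi-system that
    generates the Borel sets and exhausts R^n, which determines finite measures. *)
Lemma finite_measure_determined k (m1 m2 : finite_borel_measure R n) :
  (forall phi, Cbd k setT (fun _ : unit => phi) -> \int[m1]_x phi x = \int[m2]_x phi x) ->
  forall A : set (borelRn R n), measurable A -> m1 A = m2 A.
Proof.
move=> h A mA.
apply: (@measure_unique _ R (borelRn R n) (@boxes R n) (fun i => box (const_mx (- i%:R)) (const_mx i%:R))) => //.
- exact: borel_boxes.
- by move=> _ _ [a [b ->]] [a' [b' ->]]; rewrite box_setI; eexists; eexists.
- by move=> i; eexists; eexists.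
- apply/seteqP; split => // x _; exists (Num.bound `|x|) => // j.
  rewrite !mxE -ltr_norml; apply: le_lt_trans (norm_coord_le x j) _.
  by apply: archi_boundP.
- move=> _ [a [b ->]].
  have e1 := cvg_lim (@ereal_hausdorff R) (@integral_box_test_cvg m1 a b).
  have e2 := cvg_lim (@ereal_hausdorff R) (@integral_box_test_cvg m2 a b).
  have e : (fun i => (\int[m1]_x box_test a b i x)%:E) = (fun i => (\int[m2]_x box_test a b i x)%:E).
    by apply/funext => i; congr EFin; apply: h; exact: Cbd_box_test.
  rewrite e in e1; exact: (etrans (esym (e1 eventually_filter)) (e2 eventually_filter)).
- by move=> i; rewrite ltey_eq fin_num_measure //; apply: borel_open; exact: box_open.
Qed.

End MeasuresDetermined.

(** * Measure-valued solutions *)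

Notation bounded_continuous phi := (Cbd 0 setT (fun _ : unit => phi)).

Section BoundedContinuous.
Variables (R : realType) (n : nat).
Implicit Types (m nu mu : finite_borel_measure R n) (phi psi : 'rV[R]_n -> R).

Lemma bounded_continuous_family (I : Type) k (g : I -> 'rV[R]_n -> R) i :
  Cbd k setT g -> bounded_continuous (g i).
Proof. by move=> hg; apply: (Cbd_le (leq0n k)); exact: (Cbd_reindex (fun _ : unit => i) hg). Qed.

Lemma bounded_continuous_comp phi (F : 'rV[R]_n -> 'rV[R]_n) : continuous F ->
  bounded_continuous phi -> bounded_continuous (fun x => phi (F x)).
Proof.
move=> cF [[M hM] cphi]; split; first by exists M => i x _; exact: hM.
move=> i x; apply: (continuous_comp (cF x)); exact: cphi.
Qed.

Lemma bounded_continuousB phi psi : bounded_continuous phi -> bounded_continuous psi ->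
  bounded_continuous (fun x => phi x - psi x).
Proof.
move=> h1 h2; have := Cbd_add h1 (Cbd_scale (-1) h2).
by under [X in Cbd _ _ X -> _]eq_fun do under eq_fun do rewrite mulN1r.
Qed.

Lemma Cbd_integrable m phi : bounded_continuous phi ->
  m.-integrable [set: borelRn R n] (EFin \o phi).
Proof.
by move=> [[M hM] cphi]; apply: (@bounded_continuous_integrable _ _ _ _ M); [exact: cphi tt|move=> x; exact: hM tt x Logic.I].
Qed.

Lemma Rintegral_expansion_bound m (J : finType) phi (psi : J -> 'rV[R]_n -> R) (c : J -> R) M :
  bounded_continuous phi -> (forall j, bounded_continuous (psi j)) ->
  (forall x, `|phi x - \sum_j c j * psi j x| <= M) ->
  `|\int[m]_x phi x - \sum_j (\int[m]_x psi j x) * c j| <= M * fine (m setT).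
Proof.
move=> hphi hpsi hM.
have hcpsi j : bounded_continuous (fun x => c j * psi j x) by exact: Cbd_scale.
have hsum : bounded_continuous (fun x => \sum_j c j * psi j x).
  exact: (@Cbd_sum _ _ _ _ _ _ (index_enum J) xpredT (fun j _ x => c j * psi j x)).
have -> : \int[m]_x phi x - \sum_j (\int[m]_x psi j x) * c j = \int[m]_x (phi x - \sum_j c j * psi j x).
  rewrite RintegralB //; try exact: Cbd_integrable.
  rewrite Rintegral_bigsum; first last.
  - by move=> j; have [[B hB] _] := hcpsi j; exists B => x; exact: hB tt x Logic.I.
  - by move=> j; have [_ h] := hcpsi j; exact: h tt.
  congr (_ - _); apply: eq_bigr => j _.
  by rewrite mulrC RintegralZl //; exact: Cbd_integrable.
apply: norm_Rintegral_le => //.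
by have [_ h] := bounded_continuousB hphi hsum; exact: h tt.
Qed.

Lemma Rintegral_close m phi psi M : bounded_continuous phi -> bounded_continuous psi ->
  (forall x, `|phi x - psi x| <= M) ->
  `|\int[m]_x phi x - \int[m]_x psi x| <= M * fine (m setT).
Proof.
move=> h1 h2 hM; rewrite -RintegralB //; try exact: Cbd_integrable.
apply: norm_Rintegral_le => //.
by have [_ h] := bounded_continuousB h1 h2; exact: h tt.
Qed.

Lemma eq_measure_Rintegral m nu phi : (forall A : set (borelRn R n), measurable A -> m A = nu A) ->
  \int[m]_x phi x = \int[nu]_x phi x.
Proof.
by move=> h; congr fine; apply: eq_measure_integral => A mA _; exact: h.
Qed.

Section PushforwardBorel.
Variables (mu : finite_borel_measure R n) (F : 'rV[R]_n -> 'rV[R]_n).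
Hypothesis mF : measurable_fun [set: borelRn R n] (F : borelRn R n -> borelRn R n).

Let map : set (borelRn R n) -> \bar R := pushforward mu (F : borelRn R n -> borelRn R n).

Let map0 : map set0 = 0%E. Proof. exact: measure0. Qed.

Let map_ge0 A : (0 <= map A)%E. Proof. exact: measure_ge0. Qed.

Let map_sigma_additive : semi_sigma_additive map.
Proof. exact: measure_semi_sigma_additive. Qed.

HB.instance Definition _ := isMeasure.Build _ _ _ map map0 map_ge0 map_sigma_additive.

Let map_fin_num : fin_num_fun map.
Proof.
by move=> A mA; apply: fin_num_measure; rewrite -[X in measurable X]setTI; exact: mF.
Qed.

HB.instance Definition _ := Measure_isFinite.Build _ _ _ map map_fin_num.

Definition pushforward_borel : finite_borel_measure R n := map.

Lemma pushforward_borelE A : pushforward_borel A = mu (F @^-1` A).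
Proof. by []. Qed.

End PushforwardBorel.

Lemma Rintegral_pushforward_borel mu (F : 'rV[R]_n -> 'rV[R]_n) phi (cF : continuous F) :
  bounded_continuous phi ->
  \int[pushforward_borel mu (borel_continuous_rV cF)]_x phi x = \int[mu]_x phi (F x).
Proof.
move=> hphi; congr fine.
have [_ /(_ tt) cphi] := hphi.
apply: (@integral_pushforward _ _ (borelRn R n) (borelRn R n) R F (borel_continuous_rV cF) mu setT
  (EFin \o phi)) => //.
  by apply/measurable_EFinP; exact: borel_continuous.
exact: (Cbd_integrable mu (bounded_continuous_comp cF hphi)).
Qed.

End BoundedContinuous.

Lemma level_sub (N s : nat) : (s <= N)%N ->
  [/\ (N - s < N.+1)%N, (N - s <= N)%N, (s + (N - s).+1 <= N.+1)%N & (N - s).+1 = (N.+1 - s)%N].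
Proof. by move=> *; split; lia. Qed.

Lemma level_cat (N s u : nat) : (s <= N)%N -> (u <= N - s)%N -> (u + s <= N.+1)%N.
Proof. lia. Qed.

Section RoughContinuity.
Variables (R : realType) (d n : nat) (T gamma : R) (W : R -> word d -> R).
Variable f : 'I_d -> 'rV[R]_n -> 'rV[R]_n.
Hypothesis T0 : 0 < T.
Hypothesis hgamma : 0 < gamma < 1.
Local Notation N := (Ngamma gamma).
Hypothesis hW : geometric_rough_path T gamma W.
Local Notation w := (increment gamma W).
Local Notation y := (euler N f w).
Local Notation q s t := ((t - s) `^ gamma).
Local Notation om h := (h `^ (1 + excess gamma)).

Section Existence.
Hypothesis hf : Cbdv N setT f.
Variables (X : 'rV[R]_n -> R -> 'rV[R]_n) (L delta : R).
Hypothesis delta0 : 0 < delta.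
Hypothesis L0 : 0 <= L.
Hypothesis hX : forall x, davie_path y T delta (excess gamma) L (X x).
Hypothesis X0 : forall x, X x 0 = x.
Hypothesis cX : forall t, 0 <= t <= T -> continuous (fun x => X x t).
Variables (mu : finite_borel_measure R n) (rho : R -> finite_borel_measure R n).
Hypothesis rho0 : forall A : set (borelRn R n), measurable A -> rho 0 A = mu A.
Hypothesis hrho : forall t phi, 0 <= t <= T -> bounded_continuous phi ->
  \int[rho t]_x phi x = \int[mu]_x phi (X x t).

(** The expansion of Gamma_v phi holds along each trajectory with a constant common to all starting
    points and, phi being an index of the family, to all of B; integrating it against mu gives the
    definition. *)
Lemma flow_measure_valued_solution : measure_valued_solution T gamma W f mu rho.
Proof.
split=> // v B hv [M hB].
have [Cw hw] := rough_path_increments hW.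
have hphi : Cbd N.+1 setT (fun p : {phi | B phi} => sval p).
  by apply: (@Ck_Cbd _ _ _ M) => p; apply: hB; exact: svalP.
have hG k (u : word d) : (size u + k <= N.+1)%N ->
    Cbd k setT (fun p : {phi | B phi} => Gamma f u (sval p)).
  by move=> hu; apply: (Cbd_Gamma hf hu); exact: Cbd_le hu hphi.
have [h1 h2 h3 h4] := level_sub hv.
have [C [C0 hC]] := path_expansion hgamma hw hf h1 h2 delta0 L0 (hG _ _ h3).
exists (C * fine (mu setT)) => s t phi s0 st tT Bphi.
have sT : 0 <= s <= T by rewrite s0 (le_trans (ltW st)).
have tT' : 0 <= t <= T by rewrite tT (le_trans s0 (ltW st)).
have hb k (u : word d) : (size u <= N.+1)%N -> bounded_continuous (Gamma f u phi).
  move=> hu; apply: (@bounded_continuous_family _ _ _ 0 (fun p : {phi | B phi} => Gamma f u (sval p)) (exist _ phi Bphi)).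
  by apply: hG; rewrite addn0.
have hv' : (size v <= N.+1)%N by rewrite leqW.
rewrite hrho //; last exact: hb.
under eq_bigr => u _.
  rewrite hrho //; last by apply: hb => //; rewrite size_cat; exact: level_cat hv (size_bseq u).
  over.
have ts0 : 0 < t - s by rewrite subr_gt0.
rewrite (gtr0_norm ts0) -powR_natmul -h4 mulrAC.
apply: (@Rintegral_expansion_bound _ _ mu _ (fun x => Gamma f v phi (X x t))
  (fun (u : (N - size v).-bseq 'I_d) x => Gamma f (u ++ v) phi (X x s)) (fun u : (N - size v).-bseq 'I_d => w s t u)).
- by apply: (bounded_continuous_comp (cX tT')); exact: hb.
- move=> u; apply: (bounded_continuous_comp (cX sT)); apply: hb => //.
  by rewrite size_cat; exact: level_cat hv (size_bseq u).
move=> x.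
have hXx : forall s t, 0 <= s -> s < t -> t <= T -> t - s <= delta ->
    `|X x t - y s t (X x s)| <= L * q s t ^+ N.+1.
  by move=> a b a0 ab bT hab; rewrite powR_excess; exact: hX.
have := hC (X x) hXx (exist _ phi Bphi) s t s0 (ltW st) tT.
by under eq_bigr do rewrite -Gamma_cat.
Qed.

End Existence.

(** * Uniqueness of measure-valued solutions *)

Section Uniqueness.
Hypothesis hf : Cbdv N setT f.
Variables (mu : finite_borel_measure R n) (rho : R -> finite_borel_measure R n).
Hypothesis hrho : measure_valued_solution T gamma W f mu rho.

(** Pointwise expansions will be integrated against [rho s], so its mass must be bounded in s; this
    comes from testing the solution on the constant 1 between 0 and t. *)
Lemma mass_bound : exists K, 0 <= K /\ forall t, 0 <= t <= T -> fine (rho t setT) <= K.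
Proof.
have [Cw hw] := rough_path_increments hW; have [_ hex] := hrho.
have h1 : Cbd N.+1 setT (fun (_ : unit) (_ : 'rV[R]_n) => (1 : R)).
  by apply: (@Cbd_const _ _ _ _ _ (fun=> 1) 1) => _; rewrite normr1.
have [M hM] := Cbd_derivatives_le h1.
pose cst1 : 'rV[R]_n -> R := fun=> 1.
have hB1 : bounded_in_Ckb N.+1 [set cst1] by exists M => phi /= ->; exact: hM tt.
have [C hC] := hex [::] _ (leq0n _) hB1.
move: hC; rewrite !subn0 => hC.
pose qT := (T - 0) `^ gamma.
pose J (v : word d) := `|\int[rho 0]_x Gamma f (v ++ [::]) cst1 x|.
exists (`|C| * qT ^+ N.+1 + \sum_(v : N.-bseq 'I_d) J v * (Cw * qT ^+ size v) + fine (rho 0 setT)).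
have qT0 : 0 <= qT by exact: powR_ge0.
have Cw0 := ri_ge0 hw.
have s0 : 0 <= \sum_(v : N.-bseq 'I_d) J v * (Cw * qT ^+ size v).
  by apply: sumr_ge0 => v _; rewrite /J !mulr_ge0 ?exprn_ge0.
have r0 s : 0 <= fine (rho s setT) by apply: fine_ge0.
have c0 : 0 <= `|C| * qT ^+ N.+1 by rewrite mulr_ge0 ?exprn_ge0.
split; first by rewrite !addr_ge0.
move=> t /andP[]; rewrite le_eqVlt => /predU1P[<- _|t0 tT]; first by rewrite lerDr addr_ge0.
have qt : (t - 0) `^ gamma <= qT by apply: q_leT => //; exact: ltW.
have q0 : 0 <= (t - 0) `^ gamma by exact: powR_ge0.
apply: (@le_trans _ _ (`|C| * qT ^+ N.+1 + \sum_(v : N.-bseq 'I_d) J v * (Cw * qT ^+ size v))); last first.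
  by rewrite lerDl.
have := hC 0 t cst1 (lexx _) t0 tT erefl; rewrite /= Rintegral_cst // mul1r.
have t0' : 0 < t - 0 by rewrite subr0.
rewrite (gtr0_norm t0') -powR_natmul => h.
rewrite -[X in X <= _](subrK (\sum_(v : N.-bseq 'I_d) (\int[rho 0]_x Gamma f (v ++ [::]) cst1 x) * w 0 t v)).
apply: lerD.
  apply: (le_trans (ler_norm _)); apply: (le_trans h); apply: (le_trans (ler_wpM2r _ (ler_norm C))).
    by rewrite exprn_ge0.
  by apply: ler_wpM2l => //; apply: lerXn2r; rewrite ?nnegrE.
apply: ler_sum => v _; apply: (le_trans (ler_norm _)); rewrite normrM; apply: ler_wpM2l => //.
apply: (le_trans (ri_bound hw (lexx _) (ltW t0) tT (size_bseq v))); apply: ler_wpM2l => //.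
by apply: lerXn2r; rewrite ?nnegrE.
Qed.

(** To order N + 1, rho_t(psi) and rho_s(psi o y_st) have the same expansion in rho_s(Gamma_v psi):
    the former by the definition of a solution, the latter by [euler_expansion]. *)
Lemma continuity_step (I : Type) (psi : I -> 'rV[R]_n -> R) : Cbd N.+1 setT psi ->
  exists eta C, [/\ 0 < eta, 0 <= C & forall i s t, 0 <= s -> s < t -> t <= T -> t - s <= eta ->
    `|\int[rho t]_x psi i x - \int[rho s]_x psi i (y s t x)| <= C * om (t - s)].
Proof.
move=> hpsi; have [K [K0 hK]] := mass_bound.
have [Cw hw] := rough_path_increments hW; have [_ hex] := hrho.
have g0 : 0 < gamma by case/andP: hgamma.
have [M hM] := Cbd_derivatives_le hpsi.
have hB : bounded_in_Ckb N.+1 [set psi i | i in setT] by exists M => _ [i _ <-]; exact: hM.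
have [C1 hC1] := hex [::] _ (leq0n _) hB.
move: hC1; rewrite !subn0 => hC1.
have [C2 [C20 hC2]] := euler_expansion hw (ltW g0) hf (leqnn N)
   (fun x v _ _ => Logic.I : setT (x + v)) hpsi.
have [Cm [Cm0 hCm]] := euler_move hw (ltW g0) hf.
have Cm1 : 0 < Cm + 1 by rewrite ltr_wpDl.
have e0 : 0 < (Cm + 1)^-1 by rewrite invr_gt0.
have [eta [/andP[eta0 eta1] heta]] := powR_small g0 e0.
exists eta, (`|C1| + C2 * K); split=> //; first by rewrite addr_ge0 ?mulr_ge0.
move=> i s t s0 st tT hts.
have ts0 : 0 < t - s by rewrite subr_gt0.
have ts1 := le_trans hts eta1.
have sT : 0 <= s <= T by rewrite s0 (le_trans (ltW st)).
have hb (u : word d) : (size u <= N)%N -> bounded_continuous (Gamma f u (psi i)).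
  move=> hu; apply: (@bounded_continuous_family _ _ _ 0 (fun i => Gamma f u (psi i))).
  by apply: (Cbd_Gamma hf); rewrite addn0 ?leqW //; exact: Cbd_le (leqW hu) hpsi.
have hby : bounded_continuous (fun x => psi i (y s t x)).
  apply: bounded_continuous_comp; last exact: bounded_continuous_family hpsi.
  by move=> x; apply: differentiable_continuous; apply: euler_differentiable; exact: Cbdv_smooth.
have hyx x : `|y s t x - x| <= 1.
  apply: (le_trans (hCm s t x s0 (ltW st) tT ts1 Logic.I)).
  apply: (le_trans (ler_wpM2l Cm0 (heta _ (ltW ts0) hts))).
  by rewrite ler_pdivrMr // mul1r lerDl.
have b1 := hC1 s t (psi i) s0 st tT (ex_intro2 _ _ i Logic.I erefl).
have b2 : `|\int[rho s]_x psi i (y s t x) - \sum_(v : N.-bseq 'I_d) (\int[rho s]_x Gamma f v (psi i) x) * w s t v|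
   <= C2 * om (t - s) * fine (rho s setT).
  apply: (@Rintegral_expansion_bound _ _ (rho s) _ (fun x => psi i (y s t x))
    (fun v : N.-bseq 'I_d => Gamma f v (psi i)) (fun v : N.-bseq 'I_d => w s t v)) => //.
    by move=> v; apply: hb; exact: size_bseq.
  move=> x; rewrite -powR_excess; exact: (hC2 i s t x s0 (ltW st) tT ts1 Logic.I (hyx x)).
move: b1; under eq_bigr do rewrite cats0.
rewrite (gtr0_norm ts0) -powR_natmul powR_excess => b1.
rewrite -(subrKA (\sum_(v : N.-bseq 'I_d) (\int[rho s]_x Gamma f v (psi i) x) * w s t v)).
apply: (le_trans (ler_normD _ _)); rewrite mulrDl; apply: lerD.
  by apply: (le_trans b1); apply: ler_wpM2r; [exact: powR_ge0|exact: ler_norm].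
rewrite distrC; apply: (le_trans b2); rewrite mulrAC; apply: ler_wpM2r; first exact: powR_ge0.
by apply: ler_wpM2l => //; exact: hK.
Qed.

Hypothesis hfk : Cbdv (N + N.+1) setT f.
Variables (X : 'rV[R]_n -> R -> 'rV[R]_n) (L Lam delta : R).
Hypothesis delta0 : 0 < delta.
Hypothesis L0 : 0 <= L.
Hypothesis Lam0 : 0 <= Lam.
Hypothesis y_lip : forall s p x x', fine_path T delta s p ->
  `|scheme y s p x - scheme y s p x'| <= Lam * `|x - x'|.
Hypothesis hX : forall x, davie_path y T delta (excess gamma) L (X x).
Hypothesis X0 : forall x, X x 0 = x.
Hypothesis cX : forall t, 0 <= t <= T -> continuous (fun x => X x t).

Lemma measure_valued_flow phi t : Cbd N.+1 setT (fun _ : unit => phi) -> 0 <= t <= T ->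
  \int[rho t]_x phi x = \int[mu]_x phi (X x t).
Proof.
move=> hphi ht; have [t0 tT] := andP ht.
have [Cw hw] := rough_path_increments hW; have [hrho0 _] := hrho.
have g0 : 0 < gamma by case/andP: hgamma.
have theta0 := excess_gt0 hgamma.
(* Here k = N + 1, so N + k = 2 N + 1 derivatives of the fields are used. *)
have [delta1 [d10 hpsi]] := scheme_Cbd hw g0 (half_excess hgamma) (setT_good_domain R n) (fun=> hfk)
  (setT_no_explosion T gamma w f) (fun=> hphi) 0.
have [eta1 [C [eta10 C0 hC]]] := continuity_step hpsi.
have [M [M0 hM]] := Cbd_lipschitz (fun _ _ _ _ _ _ => Logic.I : setT _) hphi.
have hphi0 : bounded_continuous phi by exact: Cbd_le hphi.
have hscheme s p : bounded_continuous (fun x => phi (scheme y s p x)).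
  by apply: bounded_continuous_comp => //; apply: scheme_continuous; exact: Cbdv_smooth hf.
(* On the first step the test function is phi composed with the scheme over the remaining ones; all
   these functions belong to the single bounded family [hpsi], so C does not depend on the
   partition. *)
have chain eta s p : eta <= delta1 -> eta <= eta1 -> fine_path T eta s p ->
    `|\int[rho (last s p)]_x phi x - \int[rho s]_x phi (scheme y s p x)| <=
    C * (last s p - s) * eta `^ excess gamma.
  move=> he1 he2; elim: p s => [|b p IH] s hp /=.
    by rewrite !subrr normr0 mulr0 mul0r.
  have [s0 sb bT bs hbp] := fine_path_cons hp.
  have hst := hC (exist _ (b, p) (fine_path_le he1 hbp)) s b s0 sb bT (le_trans bs he2).
  rewrite /= in hst.
  rewrite -(subrKA (\int[rho b]_x phi (scheme y b p x))) (le_trans (ler_normD _ _)) //.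
  have e : C * (last b p - s) * eta `^ excess gamma =
    C * (last b p - b) * eta `^ excess gamma + C * ((b - s) * eta `^ excess gamma) by ring.
  rewrite e; apply: lerD; first exact: IH.
  apply: (le_trans hst); apply: ler_wpM2l => //.
  by apply: om_le => //; rewrite subr_ge0 ltW.
pose K := M * (Lam * L * t + L * t) * fine (mu setT).
have K0 : 0 <= K by rewrite /K !mulr_ge0 ?addr_ge0 ?mulr_ge0 ?fine_ge0.
pose dm := Num.min delta (Num.min delta1 eta1).
have dm0 : 0 < dm by rewrite /dm !lt_min delta0 d10.
apply/eqP; rewrite -subr_eq0 -normr_le0.
have b0 : 0 <= C * t + K by rewrite addr_ge0 // mulr_ge0.
apply: (fine_zero_limit dm0 theta0 b0) => eta eta0.
rewrite /dm !le_min => /and3P[h1 h2 h3].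
have [p [p1 p2 p3]] := fine_partition_ex t0 eta0.
have hp : fine_path T eta 0 p by split=> //; rewrite p2.
have a1 := chain eta 0 p h2 h3 hp; rewrite p2 subr0 in a1.
have a2 : `|\int[mu]_x phi (scheme y 0 p x) - \int[mu]_x phi (X x t)| <=
    M * (Lam * L * t * eta `^ excess gamma + L * t * eta `^ excess gamma) * fine (mu setT).
  apply: (@Rintegral_close _ _ mu (fun x => phi (scheme y 0 p x)) (fun x => phi (X x t))) => //.
    exact: (bounded_continuous_comp (cX ht) hphi0).
  move=> x; apply: (le_trans (hM tt _ _ Logic.I Logic.I)); apply: ler_wpM2l => //.
  have := davie_path_scheme theta0 Lam0 y_lip L0 h1 (hX x) hp.
  by rewrite p2 subr0 X0 distrC.
rewrite (eq_measure_Rintegral _ hrho0) in a1.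
rewrite -(subrKA (\int[mu]_x phi (scheme y 0 p x))) (le_trans (ler_normD _ _)) //.
have e : (C * t + K) * eta `^ excess gamma = C * t * eta `^ excess gamma +
    M * (Lam * L * t * eta `^ excess gamma + L * t * eta `^ excess gamma) * fine (mu setT).
  by rewrite /K; ring.
by rewrite e; exact: lerD.
Qed.

End Uniqueness.

End RoughContinuity.

Theorem theorem4p6 (R : realType) (d n : nat) (T gamma : R)
    (W : R -> word d -> R) (f : 'I_d -> 'rV[R]_n -> 'rV[R]_n)
    (mu : finite_borel_measure R n) :
  (0 < d)%N -> (0 < n)%N -> 0 < T -> 0 < gamma < 1 ->
  geometric_rough_path T gamma W ->
  (forall i, Ckb (2 * Ngamma gamma + 1) (f i)) ->
  exists X : 'rV[R]_n -> R -> 'rV[R]_n,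
    (forall x : 'rV[R]_n,
       [/\ rde_solution T gamma W f (X x), X x 0 = x &
           forall Y : R -> 'rV[R]_n,
             rde_solution T gamma W f Y -> Y 0 = x ->
             forall t, 0 <= t <= T -> Y t = X x t]) /\
    exists rho : R -> finite_borel_measure R n,
      [/\ measure_valued_solution T gamma W f mu rho,
          forall rho' : R -> finite_borel_measure R n,
            measure_valued_solution T gamma W f mu rho' ->
            forall t, 0 <= t <= T ->
              forall A : set (borelRn R n), measurable A ->
                rho' t A = rho t A &
          forall (phi : 'rV[R]_n -> R) t,
            Ckb (Ngamma gamma).+1 phi -> 0 <= t <= T ->
            mu.-integrable [set: borelRn R n]
              (fun x => (phi (X x t))%:E) /\
            \int[rho t]_x phi x = \int[mu]_x phi (X x t)].
Proof.
move=> _ _ T0 hgamma hW hf.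
have N0 := Ngamma_gt0 hgamma.
have hfk : Cbdv (Ngamma gamma + (Ngamma gamma).+1) setT f.
  by move=> j; apply: (Cbd_le _ (Ckb_Cbdv hf j)); rewrite mul2n -addnn addn1 addnS.
have hf1 : Cbdv (Ngamma gamma).+1 setT f.
  by move=> j; apply: (Cbd_le _ (hfk j)); rewrite leq_addl.
have hfN : Cbdv (Ngamma gamma) setT f by move=> j; exact: CbdW.
have theta0 := excess_gt0 hgamma.
have [Cw hw] := rough_path_increments hW.
have [delta [L [Lam [hdelta L0 Lam0 hloc hlip]]]] := euler_flow hgamma hw hf1.
have [delta0 delta1] := andP hdelta.
have [X [X0 hX Xlip]] := flow_sewing delta0 theta0 L0 Lam0 hloc hlip.
have cX t : 0 <= t <= T -> continuous (fun x => X x t).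
  move=> ht x; apply/(@cvgrPdist_le _ _ _ (nbhs x)) => e e0.
  have e1 : 0 < e / (Lam + 1) by rewrite divr_gt0 // ltr_wpDl.
  have he : \forall z \near x, `|x - z| <= e / (Lam + 1).
    by have /cvgrPdist_le/(_ _ e1) := @cvg_id _ (nbhs x).
  apply: filterS he => z hz; apply: (le_trans (Xlip x z t ht)).
  apply: (@le_trans _ _ ((Lam + 1) * (e / (Lam + 1)))).
    apply: ler_pM => //; by rewrite lerDl.
  by rewrite mulrC divfK // gt_eqF // ltr_wpDl.
exists X; split.
  move=> x; split=> [||Y hY Y0 t ht].
  - exact: (davie_rde T0 hgamma hW hf1 L0 hdelta (hX x)).
  - exact: X0.
  have [C [C0 hC]] := rde_davie T0 hgamma hW hf1 hY.
  have hC' : davie_path (euler (Ngamma gamma) f (increment gamma W)) T delta (excess gamma) C Y.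
    by move=> a b a0 ab bT hab; apply: hC => //; exact: le_trans hab delta1.
  apply: (davie_path_unique delta0 theta0 Lam0 hlip C0 L0 hC' (hX x)) => //.
  by rewrite Y0 X0.
(* The image of mu under X_t; outside [0, T] the default value is mu. *)
have /choice[rho hrho] : forall t, exists nu : finite_borel_measure R n, 0 <= t <= T ->
    (forall A : set (borelRn R n), measurable A -> nu A = mu ((fun x => X x t) @^-1` A)) /\
    (forall phi, bounded_continuous phi -> \int[nu]_x phi x = \int[mu]_x phi (X x t)).
  move=> t; case: (boolP (0 <= t <= T)) => [ht|_]; last by exists mu.
  exists (pushforward_borel mu (borel_continuous_rV (cX t ht))) => _; split=> [A mA|phi hphi].
    exact: pushforward_borelE.
  exact: Rintegral_pushforward_borel.
have hint t phi : 0 <= t <= T -> bounded_continuous phi ->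
    \int[rho t]_x phi x = \int[mu]_x phi (X x t) by move=> ht; exact: (hrho t ht).2.
exists rho; split.
- apply: (flow_measure_valued_solution hgamma hW hfN delta0 L0 hX cX _ hint).
  move=> A mA; have T0' : 0 <= (0 : R) <= T by rewrite lexx ltW.
  rewrite (hrho 0 T0').1 //; congr (mu _).
  by apply/seteqP; split=> x /=; rewrite X0.
- move=> rho' hrho' t ht; apply: (@finite_measure_determined _ _ (Ngamma gamma).+1) => phi hphi.
  rewrite (measure_valued_flow hgamma hW hfN hrho' hfk delta0 L0 Lam0 hlip hX X0 cX hphi ht).
  by rewrite hint //; exact: Cbd_le hphi.
move=> phi t hphi ht.
have hb : bounded_continuous phi := Cbd_le (leq0n _) (Ckb_Cbd hphi).
split; last exact: hint.
exact: (Cbd_integrable mu (bounded_continuous_comp (cX t ht) hb)).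
Qed.
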